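(* Let $n\ge 1$, let $\Gamma$ be a real symmetric $n\times n$ matrix, let $\hat P\in\mathbb{R}^n$ and $\omega:=\Gamma\hat P$, and let $\rho,\sigma,\zeta\in(0,1)$. Consider the Hamiltonian $$H(q,p,\xi,\eta)=\langle\omega,p\rangle+\tfrac12\langle\Gamma p,p\rangle+\eta+\varepsilon f(q,p,\xi),\qquad \varepsilon>0,$$ where $(q,p)$ and $(\xi,\eta)$ are pairs of canonically conjugate variables and $f$ is quadratic in $p$ (a polynomial of degree at most $2$ in $p$, with coefficients depending on $(q,\xi)$ and $2\pi$-periodic in each $q_l$). Assume: (i) there exists $m\in(0,1)$ such that $|\Gamma v|\le m^{-1}|v|$ for all $v\in\mathbb{C}^n$; (ii) (slow decay) $f$ is analytic on $\mathcal{D}=\Delta_\rho\times\mathbb{T}^n_{2\sigma}\times\mathcal{S}_\rho\times\mathcal{R}_\zeta$ and there are $M_f>0$ and $a\in(0,1)$ such that $\|f\|_{[\rho,\sigma;\zeta]}\le M_f e^{-a|\xi|}$ for every $\xi\in\mathcal{R}_\zeta$; (iii) $\omega$ is $\gamma$-$\tau$ Diophantine: there exist $\gamma>0$ and $\tau>n-1$ such that $|\langle\omega,k\rangle|\ge\gamma|k|^{-\tau}$ for all $k\in\mathbb{Z}^n\setminus\{0\}$, where $|k|:=|k_1|+\dots+|k_n|$. Then, for every $a\in(0,1)$, there exists $\varepsilon_a>0$ such that for every $\varepsilon\in(0,\varepsilon_a]$ there is a canonical, $\varepsilon$-close to the identity, analytic change of variables $$(q,p,\xi,\eta)=\mathcal{K}(q^{(\infty)},p^{(\infty)},\xi,\eta^{(\infty)}),\qquad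 \mathcal{K}:\mathcal{D}_*\to\mathcal{D},\quad \mathcal{D}_*\subset\mathcal{D},$$ (leaving $\xi$ unchanged) which casts $H$ into the Kolmogorov normal form $$H_\infty(q^{(\infty)},p^{(\infty)},\xi,\eta^{(\infty)})=\langle\omega,p^{(\infty)}\rangle+\eta^{(\infty)}+\mathcal{Q}(q^{(\infty)},p^{(\infty)},\xi;\varepsilon)$$ up to an additive function of $\xi$ only, where $\partial_p^\alpha\mathcal{Q}(\cdot,0,\cdot;\varepsilon)=0$ for all $\alpha\in\mathbb{N}^n$ with $|\alpha|:=\alpha_1+\dots+\alpha_n\le 1$ ($\mathcal{Q}$ is a homogeneous polynomial of degree $2$ in $p$).
   Context: Domains: $\Delta_\rho=\{p\in\mathbb{C}^n:|p|<\rho\}$; $\mathbb{T}^n_{2\sigma}=\{q\in\mathbb{C}^n:|\Im q|<2\sigma\}$, with $|\Im q|=\max_l|\Im q_l|$ (functions on it are $2\pi$-periodic in each $q_l$); $\mathcal{S}_\rho=\{\eta\in\mathbb{C}:|\Im\eta|<\rho\}$; $\mathcal{R}_\zeta=\{\xi=x+iy\in\mathbb{C}:x>-\zeta,\ |y|<\zeta\}$, a complex neighbourhood of the time half-line $\xi\ge 0$. The domain $\mathcal{D}_*$ has the form $\Delta_{\rho_*}\times\mathbb{T}^n_{2\sigma_*}\times\mathcal{S}_{\rho_*}\times\mathbb{R}^+$ for some $\rho_*\in(0,\rho)$, $\sigma_*\in(0,\sigma)$. Fourier norm: for $g=\sum_{k\in\mathbb{Z}^n}g_k(p,\xi)e^{i\langle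 k,q\rangle}$ and a fixed parameter $\nu\in(0,1/2]$ (understood to be sufficiently small), $$\|g\|_{[\rho,\sigma;\zeta]}:=\sum_{k\in\mathbb{Z}^n}\ \sup_{p\in\Delta_\rho}|g_k(p,\xi)|\;e^{2|k|(1-\nu)\sigma},$$ evaluated at each $\xi\in\mathcal{R}_\zeta$, so that it is a function of $\xi$ and bounds such as $\|f\|\le M_fe^{-a|\xi|}$ hold pointwise in $\xi\in\mathcal{R}_\zeta$. ''$\varepsilon$-close to the identity'' means that $\mathcal{K}$ tends to the identity as $\varepsilon\to0$. ''Canonical'' means symplectic with respect to $dp\wedge dq+d\eta\wedge d\xi$. *)

(* Defs.v *)
From HB Require Import structures.
From mathcomp Require Import all_boot all_order all_algebra complex finmap.
From mathcomp Require Import all_classical all_reals all_analysis.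
Set Implicit Arguments.
Unset Strict Implicit.
Unset Printing Implicit Defensive.
Import Order.TTheory GRing.Theory Num.Theory.
Import numFieldNormedType.Exports.
Local Open Scope classical_set_scope.
Local Open Scope ring_scope.

(* The complex numbers R[i] of mathcomp-real-closed
   are repackaged as a numFieldType, so that the normed-module structures that
   MathComp-Analysis puts on every numFieldType, and with them complex
   differentiability, become available. *)
Definition Cx (R : realType) : numFieldType := R[i]%C.

Definition cofR (R : realType) (x : R) : Cx R := (x%:C)%C.

Definition mxofR (R : realType) m n (A : 'M[R]_(m, n)) : 'M[Cx R]_(m, n) :=
  map_mx (@cofR R) A.

Definition ReC (R : realType) (z : Cx R) : R := complex.Re z.
Definition ImC (R : realType) (z : Cx R) : R := complex.Im z.

(* The norm of a normed module over the complex numbers is a complex number;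
   cnorm is the same number seen in R.  On Cx R it is the modulus, on column
   vectors and on tuples it is the maximum norm. *)
Definition cnorm (R : realType) (V : normedModType (Cx R)) (v : V) : R :=
  ReC `|v|.

Definition cexp (R : realType) (z : Cx R) : Cx R :=
  cofR (expR (ReC z)) * Complex (cos (ImC z)) (sin (ImC z)).

(* Complex bilinear, without conjugation. *)
Definition dot (T : pzSemiRingType) n (x y : 'cV[T]_n) : T :=
  \sum_(l < n) x l 0 * y l 0.

(* Points are (q, p, xi, eta).  The q-component is a lift to C^n of a point of
   the complexified torus: periodicity is always required separately. *)
Definition phase (R : realType) (n : nat) : normedModType (Cx R) :=
  ('cV[Cx R]_n * 'cV[Cx R]_n * Cx R * Cx R)%type.

Definition qof (R : realType) n (z : phase R n) : 'cV[Cx R]_n := z.1.1.1.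
Definition pof (R : realType) n (z : phase R n) : 'cV[Cx R]_n := z.1.1.2.
Definition xiof (R : realType) n (z : phase R n) : Cx R := z.1.2.
Definition etaof (R : realType) n (z : phase R n) : Cx R := z.2.

Definition Delta (R : realType) n (rho : R) : set 'cV[Cx R]_n :=
  [set p | cnorm p < rho].

(* The norm of 'cV[R]_n is the maximum norm. *)
Definition Torus (R : realType) n (s : R) : set 'cV[Cx R]_n :=
  [set q | `|map_mx (@ImC R) q| < s].

Definition Strip (R : realType) (rho : R) : set (Cx R) :=
  [set eta | `|ImC eta| < rho].

Definition Rzeta (R : realType) (zeta : R) : set (Cx R) :=
  [set xi | - zeta < ReC xi /\ `|ImC xi| < zeta].

Definition Halfline (R : realType) : set (Cx R) :=
  [set xi | 0 <= ReC xi /\ ImC xi = 0].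

(* Delta_rho x T^n_(2 sigma) x S_rho x X. *)
Definition Dom (R : realType) n (rho sigma : R) (X : set (Cx R)) :
    set (phase R n) :=
  [set z | [/\ Delta rho (pof z), Torus (2 * sigma) (qof z),
               Strip rho (etaof z) & X (xiof z)]].

(* Complex analyticity at every point of a set that need not be open. *)
Definition analytic_on (R : realType) (V W : normedModType (Cx R))
    (A : set V) (F : V -> W) : Prop :=
  forall x, A x -> \forall y \near x, differentiable F y.

(* 2 pi times the l-th vector of the standard basis. *)
Definition period (R : realType) n (l : 'I_n) : 'cV[Cx R]_n :=
  cofR (2 * pi) *: delta_mx l 0.

Definition periodic_on (R : realType) n (T : Type) (sigma : R)
    (X : set (Cx R)) (g : 'cV[Cx R]_n -> Cx R -> T) : Prop :=
  forall q xi, Torus (2 * sigma) q -> X xi ->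
  forall l, g (q + period R l) xi = g q xi.

Definition quadratic_in_p (R : realType) n (rho sigma zeta : R)
    (f : 'cV[Cx R]_n -> 'cV[Cx R]_n -> Cx R -> Cx R) : Prop :=
  exists (f0 : 'cV[Cx R]_n -> Cx R -> Cx R)
         (f1 : 'cV[Cx R]_n -> Cx R -> 'cV[Cx R]_n)
         (f2 : 'cV[Cx R]_n -> Cx R -> 'M[Cx R]_n),
    [/\ periodic_on sigma (Rzeta zeta) f0,
        periodic_on sigma (Rzeta zeta) f1,
        periodic_on sigma (Rzeta zeta) f2 &
        forall q p xi,
          Torus (2 * sigma) q -> Delta rho p -> Rzeta zeta xi ->
          f q p xi = f0 q xi + dot (f1 q xi) p + dot (f2 q xi *m p) p].

Definition l1norm n (k : 'cV[int]_n) : nat := (\sum_(l < n) `|k l 0%R|)%N.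

(* Unconditional convergence, along the finite subsets of the index type. *)
Definition has_sum (R : realType) (I : choiceType) (u : I -> Cx R)
    (s : Cx R) : Prop :=
  forall e : R, 0 < e -> exists A : {fset I}, forall B : {fset I},
    (A `<=` B)%fset -> cnorm ((\sum_(i <- B) u i) - s) < e.

Definition character (R : realType) n (k : 'cV[int]_n) (q : 'cV[Cx R]_n) :
    Cx R :=
  cexp (Complex 0 1 * dot (map_mx (fun j : int => j%:~R : Cx R) k) q).

(* f = \sum_k fhat_k(p, xi) e^(i <k, q>); this determines fhat uniquely. *)
Definition fourier_expansion (R : realType) n (rho sigma zeta : R)
    (f : 'cV[Cx R]_n -> 'cV[Cx R]_n -> Cx R -> Cx R)
    (fhat : 'cV[int]_n -> 'cV[Cx R]_n -> Cx R -> Cx R) : Prop :=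
  forall q p xi, Torus (2 * sigma) q -> Delta rho p -> Rzeta zeta xi ->
    has_sum (fun k => fhat k p xi * character k q) (f q p xi).

Definition fourier_norm (R : realType) n (nu rho sigma : R)
    (fhat : 'cV[int]_n -> 'cV[Cx R]_n -> Cx R -> Cx R) (xi : Cx R) : \bar R :=
  (\esum_(k in [set: 'cV[int]_n])
     (ereal_sup [set (cnorm (fhat k p xi))%:E | p in @Delta R n rho] *
      (expR (2 * (l1norm k)%:R * (1 - nu) * sigma))%:E))%E.

Definition Diophantine (R : realType) n (gamma tau : R) (omega : 'cV[R]_n) :
    Prop :=
  forall k : 'cV[int]_n, k != 0 ->
    gamma * (l1norm k)%:R `^ (- tau) <=
    `|dot omega (map_mx (fun j : int => j%:~R : R) k)|.

Definition Ham (R : realType) n (Gamma : 'M[R]_n) (omega : 'cV[R]_n) (eps : R)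
    (f : 'cV[Cx R]_n -> 'cV[Cx R]_n -> Cx R -> Cx R) (z : phase R n) : Cx R :=
  dot (mxofR omega) (pof z) + 2^-1 * dot (mxofR Gamma *m pof z) (pof z)
  + etaof z + cofR eps * f (qof z) (pof z) (xiof z).

Definition Kolmogorov_nf (R : realType) n (omega : 'cV[R]_n)
    (Q : 'cV[Cx R]_n -> 'cV[Cx R]_n -> Cx R -> Cx R) (z : phase R n) : Cx R :=
  dot (mxofR omega) (pof z) + etaof z + Q (qof z) (pof z) (xiof z).

(* dp /\ dq + deta /\ dxi. *)
Definition symp (R : realType) n (u v : phase R n) : Cx R :=
  (dot (pof u) (qof v) - dot (qof u) (pof v)) +
  (etaof u * xiof v - xiof u * etaof v).

(* K preserves the symplectic form. *)
Definition canonical_on (R : realType) n (A : set (phase R n))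
    (K : phase R n -> phase R n) : Prop :=
  forall z, A z -> forall u v : phase R n,
    symp ('d K z u) ('d K z v) = symp u v.

(* An analytic diffeomorphism onto its image, commuting with the translations
   of q by periods (it is the lift of a map of the complexified torus; together
   with the left inverse, this also gives injectivity modulo periods). *)
Definition analytic_change_of_variables (R : realType) n (A : set (phase R n))
    (K : phase R n -> phase R n) : Prop :=
  [/\ analytic_on A K,
      exists L : phase R n -> phase R n,
        analytic_on (K @` A) L /\ (forall z, A z -> L (K z) = z) &
      forall z, A z -> forall l : 'I_n,
        K (z + (period R l, 0, 0, 0)) = K z + (period R l, 0, 0, 0)].

Definition partial_p (R : realType) n (l : 'I_n) (g : 'cV[Cx R]_n -> Cx R) :
    'cV[Cx R]_n -> Cx R :=
  fun p => 'D_(delta_mx l 0) g p.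

Definition mpartial_p (R : realType) n (alpha : 'I_n -> nat)
    (g : 'cV[Cx R]_n -> Cx R) : 'cV[Cx R]_n -> Cx R :=
  foldr (fun l h => iter (alpha l) (partial_p l) h) g (enum 'I_n).

Definition Kolmogorov_remainder (R : realType) n (sigma : R)
    (Q : 'cV[Cx R]_n -> 'cV[Cx R]_n -> Cx R -> Cx R) : Prop :=
  (forall q xi, Torus (2 * sigma) q -> Halfline xi ->
     forall alpha : 'I_n -> nat, (\sum_(l < n) alpha l <= 1)%N ->
     mpartial_p alpha (fun p => Q q p xi) 0 = 0) /\
  (exists Q2 : 'cV[Cx R]_n -> Cx R -> 'M[Cx R]_n,
     periodic_on sigma (@Halfline R) Q2 /\
     forall q p xi, Torus (2 * sigma) q -> Halfline xi ->
       Q q p xi = dot (Q2 q xi *m p) p).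

(* Convergence to the identity as eps -> 0, uniformly on A. *)
Definition tends_to_id (R : realType) n (eps0 : R) (A : set (phase R n))
    (K : R -> phase R n -> phase R n) : Prop :=
  forall e : R, 0 < e -> exists2 delta : R, 0 < delta &
    forall eps, 0 < eps <= eps0 -> eps < delta ->
    forall z, A z -> cnorm (K eps z - z) < e.

(* Main.v *)
Require Import Defs.
From HB Require Import structures.
From mathcomp Require Import all_boot all_order all_algebra complex finmap.
From mathcomp Require Import all_classical all_reals all_analysis.
From mathcomp Require Import ring lra.
Set Implicit Arguments.
Unset Strict Implicit.
Unset Printing Implicit Defensive.
Import Order.TTheory GRing.Theory Num.Theory.
Import numFieldNormedType.Exports.
Local Open Scope classical_set_scope.
Local Open Scope ring_scope.

(* No small divisors occur: since the perturbation decays exponentially in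
   xi, the equation D_w G = - F, with w = (omega, 1), is solved by
   integrating F along the real ray z + t w, without loss of decay.
   Iterating this, one finds the asymptotic torus (theta, xi) |-> (phi, y,
   xi), which is invariant and tends to q = theta, p = 0 as Re xi -> +oo.
   Let h be the energy along the torus.  The one-form y dphi - h dxi differs
   from an exact form by a decaying solution of D_w G = 0, which must vanish:
   the torus is isotropic.  If psi(., xi) is the inverse of phi(., xi), the
   map (theta, P, xi, E) |-> (phi, y + dpsi^T P, xi, E + P . dpsi/dxi - h) is
   thus symplectic; it maps P = 0 to the torus, so in the new variables the
   Hamiltonian is omega . P + E plus the quadratic part in P.  Holomorphy in
   several variables is handled by Cauchy's estimate, proved on squares from
   Goursat's theorem on rectangles. *)

(** On the torus phi = theta + x the Hamilton equations read D_w x = Gamma y + eps f_p, D_w y = -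
    eps f_q. The term Gamma y carries no small factor, so plain iteration need not contract. With
    eps = d^2 and y = d u every term on the right carries a factor d, and Picard's iteration
    converges linearly once d is small against a. This is why the constants are expressed in d, the
    square root of eps. Decay is measured by e^(-a Re xi) rather than e^(-a |xi|): moving by s along
    w multiplies this weight by e^(-a s), so inverting D_w costs a factor 1/a and neither decay nor
    domain. Domain is lost only to Cauchy's estimate and to the inversion of phi, a fixed number of
    times and in steps of one length r; hence no rapidly convergent scheme is called for. The lift
    is affine in P and f has degree at most 2 in p, so the Taylor expansion in p at the torus is
    exact and leaves a homogeneous quadratic remainder. Uniqueness of decaying solutions of D_w G =
    0 gives both the periodicity of the torus and its isotropy. *)

(** * Complex numbers and norms *)

(* Kept abstract because unification against the concrete numFieldType R[i]
   unfolds its whole structure and does not terminate in practice. *)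
Record cxType (R : realType) := CxType {
  cx_sort :> numFieldType;
  cre : cx_sort -> R;
  cim : cx_sort -> R;
  cpl : R -> R -> cx_sort;
  cre_cpl : forall x y, cre (cpl x y) = x;
  cim_cpl : forall x y, cim (cpl x y) = y;
  complex_ext : forall z w, cre z = cre w -> cim z = cim w -> z = w;
  creD : forall z w, cre (z + w) = cre z + cre w;
  cimD : forall z w, cim (z + w) = cim z + cim w;
  creM : forall z w, cre (z * w) = cre z * cre w - cim z * cim w;
  cimM : forall z w, cim (z * w) = cre z * cim w + cim z * cre w;
  cre1 : cre 1 = 1;
  cim1 : cim 1 = 0;
  cx_ge0 : forall z, (0 <= z) = (cim z == 0) && (0 <= cre z);
  cx_norm : forall z : cx_sort,
    `|z| = cpl (Num.sqrt (cre z ^+ 2 + cim z ^+ 2)) 0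
}.

Section ComplexNorm.
Context {R : realType} {C : cxType R}.

Lemma cre0 : cre (0 : C) = 0.
Proof. by apply: (addrI (cre (0 : C))); rewrite -creD !addr0. Qed.
Lemma cim0 : cim (0 : C) = 0.
Proof. by apply: (addrI (cim (0 : C))); rewrite -cimD !addr0. Qed.
Lemma creN (z : C) : cre (- z) = - cre z.
Proof. by apply/eqP; rewrite -addr_eq0 -creD addNr cre0. Qed.
Lemma cimN (z : C) : cim (- z) = - cim z.
Proof. by apply/eqP; rewrite -addr_eq0 -cimD addNr cim0. Qed.
Lemma creB (z w : C) : cre (z - w) = cre z - cre w.
Proof. by rewrite creD creN. Qed.
Lemma cimB (z w : C) : cim (z - w) = cim z - cim w.
Proof. by rewrite cimD cimN. Qed.

Definition ofR (x : R) : C := cpl C x 0.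
Lemma cre_ofR (x : R) : cre (ofR x) = x. Proof. exact: cre_cpl. Qed.
Lemma cim_ofR (x : R) : cim (ofR x) = 0. Proof. exact: cim_cpl. Qed.

Lemma ofR_is_zmod_morphism : zmod_morphism ofR.
Proof.
by move=> x y; apply: complex_ext; rewrite ?creB ?cimB ?cre_ofR ?cim_ofR ?subr0.
Qed.
HB.instance Definition _ := GRing.isZmodMorphism.Build R C ofR ofR_is_zmod_morphism.

Lemma ofR_is_monoid_morphism : monoid_morphism ofR.
Proof.
split=> [|x y]; apply: complex_ext;
  rewrite ?creM ?cimM ?cre_ofR ?cim_ofR ?cre1 ?cim1 // !(mulr0, mul0r) ?subr0 ?addr0 //.
Qed.
HB.instance Definition _ := GRing.isMonoidMorphism.Build R C ofR ofR_is_monoid_morphism.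

Lemma ler_ofR (x y : R) : (ofR x <= ofR y) = (x <= y).
Proof. by rewrite -subr_ge0 -rmorphB cx_ge0 /= cre_ofR cim_ofR eqxx subr_ge0. Qed.

Lemma ofR_inj : injective ofR.
Proof. by move=> x y h; rewrite -(cre_ofR x) h cre_ofR. Qed.

Lemma ltr_ofR (x y : R) : (ofR x < ofR y) = (x < y).
Proof. by rewrite !lt_def ler_ofR (inj_eq ofR_inj). Qed.

Lemma realC (x : R) : ofR x \is Num.real.
Proof. by rewrite realE -(rmorph0 ofR) !ler_ofR le_total. Qed.

Lemma cpl_hline (t y : R) : cpl C t y = cpl C 0 y + ofR t *: (1 : C).
Proof.
by apply: complex_ext; rewrite ?creD ?cimD /GRing.scale /= ?mulr1 ?cre_cpl ?cim_cpl;
  rewrite ?add0r ?addr0.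
Qed.

Lemma cpl_vline (x t : R) : cpl C x t = cpl C x 0 + ofR t *: cpl C 0 1.
Proof.
by apply: complex_ext; rewrite ?creD ?cimD /GRing.scale /= ?creM ?cimM ?cre_cpl ?cim_cpl; ring.
Qed.

Lemma complex_decomp (z : C) : z = ofR (cre z) + cpl C 0 1 * ofR (cim z).
Proof.
by apply: complex_ext; rewrite ?(creD, cimD, creM, cimM) ?cre_cpl ?cim_cpl; ring.
Qed.

Lemma ge0_ofR (z : C) : 0 <= z -> z = ofR (cre z).
Proof.
rewrite cx_ge0 => /andP[/eqP z0 _].
by apply: complex_ext; rewrite ?cre_ofR ?cim_ofR.
Qed.

Lemma complex_eq0 (z : C) : cre z ^+ 2 + cim z ^+ 2 = 0 -> z = 0.
Proof.
move=> /eqP; rewrite paddr_eq0 ?sqr_ge0 // !sqrf_eq0 => /andP[/eqP h1 /eqP h2].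
by apply: complex_ext; rewrite ?cre0 ?cim0.
Qed.

Lemma complex_inv (z : C) : z^-1 =
  cpl C (cre z / (cre z ^+ 2 + cim z ^+ 2)) (- cim z / (cre z ^+ 2 + cim z ^+ 2)).
Proof.
have [->|z0] := eqVneq z 0.
  by rewrite invr0; apply: complex_ext;
    rewrite cre0 cim0 ?cre_cpl ?cim_cpl ?oppr0 mul0r.
have n0 : cre z ^+ 2 + cim z ^+ 2 != 0 by apply: contra_neq z0; exact: complex_eq0.
apply: (mulfI z0); rewrite divff //; apply: complex_ext;
  by rewrite ?creM ?cimM !cre_cpl !cim_cpl ?cre1 ?cim1; field.
Qed.

Lemma creV (z : C) : cre z^-1 = cre z / (cre z ^+ 2 + cim z ^+ 2).
Proof. by rewrite complex_inv cre_cpl. Qed.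
Lemma cimV (z : C) : cim z^-1 = - cim z / (cre z ^+ 2 + cim z ^+ 2).
Proof. by rewrite complex_inv cim_cpl. Qed.

Definition nrm (V : normedModType C) (v : V) : R := cre `|v|.

Section NormedModule.
Context {V : normedModType C}.
Implicit Types (u v : V).

Lemma normE v : `|v| = ofR (nrm v).
Proof. by rewrite /nrm -ge0_ofR. Qed.

Lemma nrm_ge0 v : 0 <= nrm v.
Proof. by rewrite -ler_ofR rmorph0 -normE. Qed.

Lemma nrm0 : nrm (0 : V) = 0.
Proof. by rewrite /nrm normr0 cre0. Qed.

Lemma nrmN v : nrm (- v) = nrm v.
Proof. by rewrite /nrm normrN. Qed.

Lemma nrmBC u v : nrm (u - v) = nrm (v - u).
Proof. by rewrite -opprB nrmN. Qed.

Lemma nrmD u v : nrm (u + v) <= nrm u + nrm v.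
Proof. by rewrite -ler_ofR rmorphD /= -!normE ler_normD. Qed.

Lemma nrmB u v : nrm (u - v) <= nrm u + nrm v.
Proof. by rewrite -(nrmN v) nrmD. Qed.

Lemma nrm_eq0 v : nrm v = 0 -> v = 0.
Proof. by move=> h; apply/normr0_eq0; rewrite normE h rmorph0. Qed.

Lemma nrmZ (c : C) v : nrm (c *: v) = nrm c * nrm v.
Proof.
by apply: ofR_inj; rewrite rmorphM /= -(normE (c *: v)) -(normE v) normrZ [nrm c]/nrm -ge0_ofR.
Qed.

Lemma nrm_tri u v w : nrm (u - w) <= nrm (u - v) + nrm (v - w).
Proof. by rewrite -{1}(subrK v u) -addrA nrmD. Qed.

(** The bridge between filters and balls of real radius: the radii of a normed module over [C] lie
    in [C], and a positive element of [C] is [ofR] of its real part. *)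
Lemma nbhs_nrmP (x : V) (P : V -> Prop) : (\forall y \near x, P y) <->
  exists2 r : R, 0 < r & forall y, nrm (y - x) < r -> P y.
Proof.
split=> [/nbhs_normP[e /= e0 he]|[r r0 hr]].
  have eE := ge0_ofR (ltW e0).
  exists (cre e); first by rewrite -ltr_ofR rmorph0 -eE.
  by move=> y hy; apply: he; rewrite /= distrC normE eE ltr_ofR.
apply/nbhs_normP; exists (ofR r); first by rewrite /= -(rmorph0 (ofR : R -> C)) ltr_ofR.
by move=> y /=; rewrite distrC normE ltr_ofR => /hr.
Qed.

End NormedModule.

Lemma nrmM (z w : C) : nrm (z * w) = nrm z * nrm w.
Proof. by apply: ofR_inj; rewrite rmorphM /= -!normE normrM. Qed.

Lemma nrmV (z : C) : nrm z^-1 = (nrm z)^-1.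
Proof. by apply: ofR_inj; rewrite fmorphV /= -!normE normfV. Qed.

Lemma nrm_ofR (x : R) : nrm (ofR x) = `|x|.
Proof. by rewrite /nrm cx_norm cre_cpl cre_ofR cim_ofR expr0n /= addr0 sqrtr_sqr. Qed.

Lemma nrm1 : nrm (1 : C) = 1.
Proof. by rewrite /nrm normr1 cre1. Qed.

Lemma nrm_sqrt (z : C) : nrm z = Num.sqrt (cre z ^+ 2 + cim z ^+ 2).
Proof. by rewrite /nrm cx_norm cre_cpl. Qed.

Lemma cre_le (z : C) : `|cre z| <= nrm z.
Proof. by rewrite nrm_sqrt -sqrtr_sqr ler_wsqrtr // lerDl sqr_ge0. Qed.

Lemma cim_le (z : C) : `|cim z| <= nrm z.
Proof. by rewrite nrm_sqrt -sqrtr_sqr ler_wsqrtr // lerDr sqr_ge0. Qed.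

Lemma nrmi : nrm (cpl C 0 1) = 1.
Proof. by rewrite nrm_sqrt cre_cpl cim_cpl expr0n expr1n add0r sqrtr1. Qed.

Lemma nrm_le_ReIm (z : C) : nrm z <= `|cre z| + `|cim z|.
Proof.
rewrite [in leLHS](complex_decomp z); apply: le_trans (nrmD _ _) _.
by rewrite nrmM nrmi mul1r !nrm_ofR.
Qed.

Lemma nrm_le_max (z : C) (e : R) :
  `|cre z| <= e -> `|cim z| <= e -> nrm z <= 2 * e.
Proof. by move=> h1 h2; apply: le_trans (nrm_le_ReIm z) _; lra. Qed.

Lemma nrm_pair (V W : normedModType C) (u : V) (v : W) :
  nrm ((u, v) : V * W) = Num.max (nrm u) (nrm v).
Proof.
apply: ofR_inj; rewrite -normE prod_normE /= !normE.
by case: leP => h; [rewrite max_r // ler_ofR | rewrite max_l // ler_ofR ltW].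
Qed.

Lemma nrm_pair_le (V W : normedModType C) (u : V) (v : W) (e : R) :
  (nrm ((u, v) : V * W) <= e) = (nrm u <= e) && (nrm v <= e).
Proof. by rewrite nrm_pair ge_max. Qed.

Lemma nrm_fst (V W : normedModType C) (z : V * W) : nrm z.1 <= nrm z.
Proof. by case: z => u v; rewrite nrm_pair le_max lexx. Qed.

Lemma nrm_snd (V W : normedModType C) (z : V * W) : nrm z.2 <= nrm z.
Proof. by case: z => u v; rewrite nrm_pair le_max lexx orbT. Qed.

Lemma nrm_col_ge n (v : 'cV[C]_n) i : nrm (v i 0) <= nrm v.
Proof.
rewrite -ler_ofR -!normE [leRHS]mx_normE.
by rewrite -[leLHS]nngE num_le; exact: (le_bigmax _ _ (i, 0)).
Qed.

Lemma nrm_col_le n (v : 'cV[C]_n) (e : R) : 0 <= e ->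
  (forall i, nrm (v i 0) <= e) -> nrm v <= e.
Proof.
move=> e0 h; have [->//|v0] := eqVneq (nrm v) 0.
have [|[i j] ij] := @mx_norm_neq0 C n 1 v.
  apply: contra_neq v0 => v0; apply: ofR_inj; rewrite -normE rmorph0; exact: v0.
rewrite -ler_ofR -normE [leLHS]ij /= (ord1 j) normE ler_ofR; exact: h.
Qed.

End ComplexNorm.

(** Nested intervals: [u n - 2 * A * 2^-1 ^+ n] increases, [u n + 2 * A * 2^-1 ^+ n] decreases, and
    the limit is the supremum of the lower ends. Limits below are taken at such a geometric rate,
    with explicit errors. *)
Lemma real_geometric_limit (R : realType) (u : nat -> R) (A : R) :
  (forall n, `|u n.+1 - u n| <= A * 2^-1 ^+ n) ->
  exists l, forall n, `|l - u n| <= 2 * A * 2^-1 ^+ n.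
Proof.
move=> h.
have A0 : 0 <= A by have := le_trans (normr_ge0 _) (h 0%N); rewrite expr0 mulr1.
have low n m : u n - 2 * A * 2^-1 ^+ n <= u (m + n)%N - 2 * A * 2^-1 ^+ (m + n).
  elim: m => [//|m IH]; apply: le_trans IH _; rewrite addSn exprS.
  have := h (m + n)%N; rewrite ler_norml => /andP[]; lra.
have upp n m : u (m + n)%N + 2 * A * 2^-1 ^+ (m + n) <= u n + 2 * A * 2^-1 ^+ n.
  elim: m => [//|m IH]; apply: le_trans _ IH; rewrite addSn exprS.
  have := h (m + n)%N; rewrite ler_norml => /andP[]; lra.
have p0 n : 0 <= 2 * A * 2^-1 ^+ n.
  by rewrite mulr_ge0 ?exprn_ge0 ?mulr_ge0 // invr_ge0.
have lu n m : u n - 2 * A * 2^-1 ^+ n <= u m + 2 * A * 2^-1 ^+ m.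
  have := low n m; have := upp m n; rewrite (addnC n m).
  have := p0 (m + n)%N; lra.
set S := [set x | exists n, x = u n - 2 * A * 2^-1 ^+ n].
have S0 : S !=set0 by exists (u 0%N - 2 * A * 2^-1 ^+ 0); exists 0%N.
have Sub : has_ubound S.
  by exists (u 0%N + 2 * A * 2^-1 ^+ 0) => x [n ->]; exact: lu.
exists (sup S) => n; rewrite ler_norml; apply/andP; split.
  have : u n - 2 * A * 2^-1 ^+ n <= sup S.
    by apply: sup_upper_bound => //; exists n.
  lra.
have : sup S <= u n + 2 * A * 2^-1 ^+ n.
  by apply: ge_sup => // x [m ->]; exact: lu.
lra.
Qed.

(** The constant doubles because the real and imaginary parts converge separately. *)
Lemma geometric_limit (R : realType) (C : cxType R) (u : nat -> C) (A : R) :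
  (forall n, nrm (u n.+1 - u n) <= A * 2^-1 ^+ n) ->
  exists l, forall n, nrm (l - u n) <= 4 * A * 2^-1 ^+ n.
Proof.
move=> h.
have [a ha] : exists l, forall n, `|l - cre (u n)| <= 2 * A * 2^-1 ^+ n.
  by apply: real_geometric_limit => n; rewrite -creB (le_trans (cre_le _)).
have [b hb] : exists l, forall n, `|l - cim (u n)| <= 2 * A * 2^-1 ^+ n.
  by apply: real_geometric_limit => n; rewrite -cimB (le_trans (cim_le _)).
exists (cpl C a b) => n.
have -> : 4 * A * 2^-1 ^+ n = 2 * (2 * A * 2^-1 ^+ n) by ring.
by apply: nrm_le_max; rewrite ?creB ?cimB ?cre_cpl ?cim_cpl.
Qed.

Lemma exp_half_small (R : realType) (B e : R) : 0 < e ->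
  exists N, forall n, (N <= n)%N -> B * 2^-1 ^+ n < e.
Proof.
move=> e0.
have [N hN] : exists N : nat, `|B| / e < N%:R.
  exists (Num.bound (`|B| / e)); apply: archi_boundP.
  by rewrite divr_ge0 // ltW.
exists N => n Nn; apply: le_lt_trans (ler_norm _) _.
rewrite normrM (@ger0_norm _ (_ ^+ _)); last by rewrite exprn_ge0 // invr_ge0.
rewrite exprVn ltr_pdivrMr ?exprn_gt0 // mulrC -ltr_pdivrMr //.
apply: lt_le_trans hN _; rewrite -natrX ler_nat.
by apply: leq_trans Nn _; apply: ltnW; apply: ltn_expl.
Qed.

(** * Derivatives in epsilon-delta form *)

Section EpsilonDerivative.
Context {R : realType} {C : cxType R}.

Lemma differentiable_eps (V W : normedModType C) (F : V -> W) x :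
  differentiable F x -> forall e : R, 0 < e -> exists2 d, 0 < d &
  forall h, nrm h < d -> nrm (F (x + h) - F x - 'd F x h) <= e * nrm h.
Proof.
move=> /diff_locally/eqaddoP dF e e0.
have /dF : (0 : C) < ofR e by rewrite -(rmorph0 (ofR : R -> C)) ltr_ofR.
move/nbhs_nrmP => [d d0 hd]; exists d => // h hh.
have := hd h; rewrite subr0 => /(_ hh) /=.
rewrite !normE -rmorphM ler_ofR; congr (nrm _ <= _).
by rewrite !fctE /= (addrC h) opprD addrA.
Qed.

(** The bound [B] yields the continuity of [L], which differentiability includes. [L] is a plain
    function, so that integrals and pointwise limits can serve as differentials. *)
Lemma differentiable_intro (V W : normedModType C) (F L : V -> W) x (B : R) :
  linear L -> (forall h, nrm (L h) <= B * nrm h) ->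
  (forall e : R, 0 < e -> exists2 d, 0 < d &
    forall h, nrm h < d -> nrm (F (x + h) - F x - L h) <= e * nrm h) ->
  differentiable F x /\ 'd F x = L :> (V -> W).
Proof.
move=> linL bL heps.
pose mL := GRing.isLinear.Build C V W _ L linL.
pose LL : {linear V -> W} := HB.pack L mL.
have cL : continuous LL.
  apply/linear_bounded_continuous/linear_boundedP.
  exists (ofR B); split=> [|r /ltW hr y]; first exact: realC.
  rewrite !normE; apply: le_trans (ler_wpM2r _ hr); last by rewrite -(rmorph0 (ofR : R -> C)) ler_ofR nrm_ge0.
  by rewrite -rmorphM ler_ofR bL.
have oL : F \o shift x = cst (F x) + LL +o_ 0 id.
  apply/eqaddoP => e e0; have := ge0_ofR (ltW e0); move: (cre e) => c eE.
  have [|d d0 hd] := heps c; first by rewrite -(ltr_ofR (C := C)) rmorph0 -eE.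
  apply/nbhs_nrmP; exists d => // h; rewrite subr0 => /hd.
  by rewrite eE /= !normE -rmorphM ler_ofR /= !fctE /= (addrC h) opprD addrA.
have dE : 'd F x = LL :> (V -> W) by apply: diff_unique.
split => //; apply/diff_locallyP; by rewrite dE; split.
Qed.

Lemma is_derive_eps (g : R -> R) (t l : R) :
  (forall e, 0 < e -> exists2 d, 0 < d & forall h, `|h| < d ->
     `|g (t + h) - g t - h * l| <= e * `|h|) -> is_derive t 1 g l.
Proof.
move=> hg.
have cv : (fun h => h^-1 *: ((g \o shift t) (h *: 1) - g t)) @ 0^' --> l.
  apply/cvgrPdist_le => e e0; have [d d0 hd] := hg e e0.
  near=> h.
  have h0 : h != 0 by near: h; exact: nbhs_dnbhs_neq.
  have hlt : `|h| < d.
    near: h; apply: dnbhs0_lt => //.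
  rewrite /= [h *: 1]mulr1 /= (addrC h) distrC -(ler_pM2r (x := `|h|)) ?normr_gt0 //.
  rewrite -normrM mulrBl [_ *: _ * h]mulrC mulrA divff // mul1r (mulrC l).
  exact: hd.
by split; [apply/cvg_ex; exists l | apply: cvg_lim].
Unshelve. all: by end_near.
Qed.

End EpsilonDerivative.

(** * Calculus of complex-valued curves on the real line *)

Section ComplexIntegral.
Context {R : realType} {C : cxType R}.
Local Notation mu := (@lebesgue_measure R).
Implicit Types (F G : R -> C) (a b t : R).

(** Curves are treated componentwise because [R] is not the field of scalars of [C]; the same holds
    for [rcont] and [cint]. *)
Definition rderiv F t (l : C) :=
  is_derive t 1 (fun s => cre (F s)) (cre l) /\
  is_derive t 1 (fun s => cim (F s)) (cim l).

Definition rcont F t :=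
  {for t, continuous (fun s => cre (F s))} /\
  {for t, continuous (fun s => cim (F s))}.

Lemma rderiv_cont F t l : rderiv F t l -> rcont F t.
Proof.
case=> h1 h2; split; apply: differentiable_continuous; apply/derivable1_diffP;
  exact: ex_derive.
Qed.

Lemma rderiv_eps F t l :
  (forall e, 0 < e -> exists2 d, 0 < d & forall h, `|h| < d ->
     nrm (F (t + h) - F t - ofR h * l) <= e * `|h|) -> rderiv F t l.
Proof.
move=> hF; split; apply: is_derive_eps => e /hF[d d0 hd]; exists d => // h /hd;
  apply: le_trans; [apply: le_trans (cre_le _)|apply: le_trans (cim_le _)].
  by rewrite !creB creM cre_ofR cim_ofR mul0r subr0.
by rewrite !cimB cimM cre_ofR cim_ofR mul0r addr0.
Qed.

Lemma rderiv_line (V : normedModType C) (F : V -> C) x v t :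
  differentiable F (x + ofR t *: v) ->
  rderiv (fun s => F (x + ofR s *: v)) t ('d F (x + ofR t *: v) v).
Proof.
move=> /differentiable_eps dF; apply: rderiv_eps => e e0.
have v1 : 0 < nrm v + 1 by have := nrm_ge0 v; lra.
have [|d d0 hd] := dF (e / (nrm v + 1)); first by rewrite divr_gt0.
exists (d / (nrm v + 1)); first by rewrite divr_gt0.
move=> h; rewrite ltr_pdivlMr // => hh.
have hle : nrm (ofR h *: v) <= `|h| * (nrm v + 1).
  by rewrite nrmZ nrm_ofR ler_wpM2l // lerDl.
have := hd (ofR h *: v) (le_lt_trans hle hh).
rewrite linearZ /= rmorphD scalerDl /= addrA => /le_trans; apply.
apply: le_trans (ler_wpM2l _ hle) _; first by rewrite divr_ge0 // ltW.
by rewrite (mulrC `|h|) mulrA divfK ?gt_eqF.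
Qed.

Lemma rcont_within a b (f : R -> R) :
  (forall t, a <= t <= b -> {for t, continuous f}) ->
  {within `[a, b], continuous f}.
Proof.
move=> cf; apply: continuous_in_subspaceT => t; rewrite inE /= in_itv /=.
exact: cf.
Qed.

Definition cint a b F : C :=
  cpl C (Rintegral mu `[a, b] (fun t => cre (F t)))
          (Rintegral mu `[a, b] (fun t => cim (F t))).

Lemma itv_integrable a b (f : R -> R) :
  (forall t, a <= t <= b -> {for t, continuous f}) ->
  mu.-integrable `[a, b] (EFin \o f).
Proof.
move=> cf; apply: continuous_compact_integrable; first exact: segment_compact.
exact: rcont_within.
Qed.

Lemma eq_cint a b F G : (forall t, a <= t <= b -> F t = G t) ->
  cint a b F = cint a b G.
Proof.
move=> FG; rewrite /cint; congr cpl; apply: eq_Rintegral => t;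
  by rewrite inE /= in_itv /= => /FG ->.
Qed.

Lemma cintD a b F G : (forall t, a <= t <= b -> rcont F t) ->
  (forall t, a <= t <= b -> rcont G t) ->
  cint a b (fun t => F t + G t) = cint a b F + cint a b G.
Proof.
move=> cF cG; apply: complex_ext; rewrite ?creD ?cimD /cint ?cre_cpl ?cim_cpl.
  rewrite -RintegralD //; [|by apply: itv_integrable => t /cF[]|by apply: itv_integrable => t /cG[]].
  by apply: eq_Rintegral => t _; rewrite creD.
rewrite -RintegralD //; [|by apply: itv_integrable => t /cF[]|by apply: itv_integrable => t /cG[]].
by apply: eq_Rintegral => t _; rewrite cimD.
Qed.

Lemma rcontM F t (c : C) : rcont F t -> rcont (fun t => c * F t) t.
Proof.
case=> h1 h2; split.
  have -> : (fun s => cre (c * F s)) = (fun s => cre c * cre (F s) - cim c * cim (F s)).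
    by apply/funext => s; rewrite creM.
  by apply: cvgB; apply: cvgMr.
have -> : (fun s => cim (c * F s)) = (fun s => cre c * cim (F s) + cim c * cre (F s)).
  by apply/funext => s; rewrite cimM.
by apply: cvgD; apply: cvgMr.
Qed.

Lemma rcontD F G t : rcont F t -> rcont G t -> rcont (fun t => F t + G t) t.
Proof.
case=> h1 h2 [h3 h4]; split.
  have -> : (fun s => cre (F s + G s)) = (fun s => cre (F s) + cre (G s)).
    by apply/funext => s; rewrite creD.
  exact: cvgD.
have -> : (fun s => cim (F s + G s)) = (fun s => cim (F s) + cim (G s)).
  by apply/funext => s; rewrite cimD.
exact: cvgD.
Qed.

Lemma rcontN F t : rcont F t -> rcont (fun t => - F t) t.
Proof. by move=> /(rcontM (-1)); under eq_fun do rewrite mulN1r. Qed.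

Lemma cintM a b (c : C) F : (forall t, a <= t <= b -> rcont F t) ->
  cint a b (fun t => c * F t) = c * cint a b F.
Proof.
move=> cF; apply: complex_ext; rewrite ?creM ?cimM /cint ?cre_cpl ?cim_cpl.
  rewrite -!RintegralZl //; try by apply: itv_integrable => t /cF[].
  rewrite -RintegralB //; try by apply: itv_integrable => t /cF[h1 h2]; apply: cvgMr.
  by apply: eq_Rintegral => t _; rewrite creM.
rewrite -!RintegralZl //; try by apply: itv_integrable => t /cF[].
rewrite -RintegralD //; try by apply: itv_integrable => t /cF[h1 h2]; apply: cvgMr.
by apply: eq_Rintegral => t _; rewrite cimM.
Qed.

Lemma cintN a b F : (forall t, a <= t <= b -> rcont F t) ->
  cint a b (fun t => - F t) = - cint a b F.
Proof.
move=> cF; rewrite -mulN1r -cintM //; apply: eq_cint => t _; by rewrite mulN1r.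
Qed.

Lemma cintB a b F G : (forall t, a <= t <= b -> rcont F t) ->
  (forall t, a <= t <= b -> rcont G t) ->
  cint a b (fun t => F t - G t) = cint a b F - cint a b G.
Proof.
by move=> cF cG; rewrite cintD // ?cintN // => t /cG; apply: rcontN.
Qed.

Lemma Rintegral_itv_bound a b (f : R -> R) (M : R) : a <= b ->
  (forall t, a <= t <= b -> {for t, continuous f}) ->
  (forall t, a <= t <= b -> `|f t| <= M) ->
  `|Rintegral mu `[a, b] f| <= M * (b - a).
Proof.
move=> ab cf hM; apply: le_trans (le_normr_Rintegral _ _) _ => //.
  exact: itv_integrable.
apply: (@le_trans _ _ (Rintegral mu `[a, b] (cst M))).
  apply: le_Rintegral => //.
  - by apply: itv_integrable => t ht; apply: cvg_norm; exact: cf.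
  - by apply: itv_integrable => t ht; exact: cvg_cst.
rewrite Rintegral_cst //= lebesgue_measure_itv /= lte_fin.
case: ltP => h; first by rewrite -EFinB.
have -> : b = a by apply/eqP; rewrite eq_le ab h.
by rewrite subrr.
Qed.

(** The factor 2 comes from bounding the real and imaginary integrals separately. No constant below
    has to be sharp; this loss reappears in the Cauchy estimates. *)
Lemma cint_bound a b F (M : R) : a <= b ->
  (forall t, a <= t <= b -> rcont F t) ->
  (forall t, a <= t <= b -> nrm (F t) <= M) ->
  nrm (cint a b F) <= 2 * (M * (b - a)).
Proof.
move=> ab cF hM; apply: nrm_le_max; rewrite /cint ?cre_cpl ?cim_cpl; apply: Rintegral_itv_bound => // t ht.
- by have [] := cF t ht.
- exact: le_trans (cre_le _) (hM t ht).
- by have [] := cF t ht.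
- exact: le_trans (cim_le _) (hM t ht).
Qed.

Lemma Rintegral_itv_split a b c (f : R -> R) : a <= b -> b <= c ->
  (forall t, a <= t <= c -> {for t, continuous f}) ->
  Rintegral mu `[a, c] f = Rintegral mu `[a, b] f + Rintegral mu `[b, c] f.
Proof.
move=> ab bc cf.
have intf := itv_integrable cf.
have /eqP := Rintegral_itvB intf (x := b) ab bc.
rewrite subr_eq addrC => /eqP ->; congr (_ + _).
apply: Rintegral_itv_obnd_cbnd; apply: integrableS intf => //.
by move=> t /=; rewrite !in_itv /= => /andP[/ltW h1 ->]; rewrite (le_trans ab).
Qed.

Lemma cint_split a b c F : a <= b -> b <= c ->
  (forall t, a <= t <= c -> rcont F t) -> cint a c F = cint a b F + cint b c F.
Proof.
move=> ab bc cF; apply: complex_ext; rewrite ?creD ?cimD /cint ?cre_cpl ?cim_cpl;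
  by apply: Rintegral_itv_split => // t /cF[].
Qed.

Lemma Rintegral_itv_FTC a b (f g : R -> R) : a <= b ->
  (forall t, a <= t <= b -> {for t, continuous f}) ->
  (forall t, a <= t <= b -> is_derive t 1 g (f t)) ->
  Rintegral mu `[a, b] f = g b - g a.
Proof.
rewrite le_eqVlt => /orP[/eqP <- _ _|ab cf dg].
  by rewrite set_itv1 Rintegral_set1 subrr.
have cg t : a <= t <= b -> {for t, continuous g}.
  by move=> /dg h; apply: differentiable_continuous; apply/derivable1_diffP; exact: ex_derive.
rewrite /Rintegral (@continuous_FTC2 _ f g) //=; first exact: rcont_within.
  split.
  - by move=> t; rewrite in_itv /= => /andP[h1 h2]; apply: ex_derive; apply: dg; rewrite !ltW.
  - by apply: cvg_at_right_filter; apply: cg; rewrite lexx ltW.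
  - by apply: cvg_at_left_filter; apply: cg; rewrite lexx ltW.
move=> t; rewrite in_itv /= => /andP[h1 h2]; rewrite derive1E; apply: derive_val.
by apply: dg; rewrite !ltW.
Qed.

Lemma cint_FTC a b F G : a <= b ->
  (forall t, a <= t <= b -> rcont F t) ->
  (forall t, a <= t <= b -> rderiv G t (F t)) ->
  cint a b F = G b - G a.
Proof.
move=> ab cF dG; apply: complex_ext; rewrite ?creB ?cimB /cint ?cre_cpl ?cim_cpl.
  apply: (@Rintegral_itv_FTC _ _ _ (fun t => cre (G t))) => // t ht;
  by have [] := cF t ht; have [] := dG t ht.
apply: (@Rintegral_itv_FTC _ _ _ (fun t => cim (G t))) => // t ht;
by have [] := cF t ht; have [] := dG t ht.
Qed.

End ComplexIntegral.

(** * Goursat's theorem and Cauchy's estimate *)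

Section Goursat.
Context {R : realType} {C : cxType R}.
Implicit Types (F G : C -> C) (a b c d : R).
Local Notation i := (cpl C 0 1 : C).
Definition rectD F a b c d :=
  forall x y, a <= x <= b -> c <= y <= d -> differentiable F (cpl C x y).

Lemma rderiv_hline F t y : differentiable F (cpl C t y) ->
  rderiv (fun s => F (cpl C s y)) t ('d F (cpl C t y) 1).
Proof.
rewrite cpl_hline => /rderiv_line; congr rderiv; apply/funext => s.
by rewrite [in RHS]cpl_hline.
Qed.

Lemma rderiv_vline F x t : differentiable F (cpl C x t) ->
  rderiv (fun s => F (cpl C x s)) t ('d F (cpl C x t) i).
Proof.
rewrite cpl_vline => /rderiv_line; congr rderiv; apply/funext => s.
by rewrite [in RHS]cpl_vline.
Qed.

Lemma hcont F t y : differentiable F (cpl C t y) -> rcont (fun s => F (cpl C s y)) t.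
Proof. by move=> /rderiv_hline; exact: rderiv_cont. Qed.

Lemma vcont F x t : differentiable F (cpl C x t) -> rcont (fun s => F (cpl C x s)) t.
Proof. by move=> /rderiv_vline; exact: rderiv_cont. Qed.

(** The contour integral around the rectangle, counterclockwise from the lower side; [i] is dz/dt on
    the vertical sides. *)
Definition loop F a b c d : C :=
  cint a b (fun t => F (cpl C t c)) + i * cint c d (fun t => F (cpl C b t))
  - cint a b (fun t => F (cpl C t d)) - i * cint c d (fun t => F (cpl C a t)).

Lemma rectDS F a b c d a' b' c' d' : a <= a' -> b' <= b -> c <= c' -> d' <= d ->
  rectD F a b c d -> rectD F a' b' c' d'.
Proof.
move=> h1 h2 h3 h4 hF x y /andP[x1 x2] /andP[y1 y2].
by apply: hF; apply/andP; split; lra.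
Qed.

Lemma loop_hsplit F a m b c d : a <= m -> m <= b -> c <= d -> rectD F a b c d ->
  loop F a b c d = loop F a m c d + loop F m b c d.
Proof.
move=> am mb cd hF; rewrite /loop.
rewrite (@cint_split _ _ a m b (fun t => F (cpl C t c))) //; last first.
  by move=> t ht; apply: hcont; apply: hF => //; rewrite lexx.
rewrite (@cint_split _ _ a m b (fun t => F (cpl C t d))) //; last first.
  by move=> t ht; apply: hcont; apply: hF => //; rewrite lexx andbT.
ring.
Qed.

Lemma loop_vsplit F a b c m d : a <= b -> c <= m -> m <= d -> rectD F a b c d ->
  loop F a b c d = loop F a b c m + loop F a b m d.
Proof.
move=> ab cm md hF; rewrite /loop.
rewrite (@cint_split _ _ c m d (fun t => F (cpl C b t))) //; last first.
  by move=> t ht; apply: vcont; apply: hF => //; rewrite lexx andbT.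
rewrite (@cint_split _ _ c m d (fun t => F (cpl C a t))) //; last first.
  by move=> t ht; apply: vcont; apply: hF => //; rewrite lexx.
ring.
Qed.

(* Integrands are only assumed differentiable here, because some have a
   singularity inside the rectangle. *)
Definition bdry a b c d (z : C) :=
  [/\ a <= cre z <= b, c <= cim z <= d &
      [|| cre z == a, cre z == b, cim z == c | cim z == d]].

Lemma bdry_h a b c d y t : c <= d -> (y == c) || (y == d) -> a <= t <= b ->
  bdry a b c d (cpl C t y).
Proof.
move=> cd hy ht; split; rewrite ?cre_cpl ?cim_cpl ?hy ?orbT //.
by case/orP: hy => /eqP ->; rewrite lexx ?cd.
Qed.

Lemma bdry_v a b c d x t : a <= b -> (x == a) || (x == b) -> c <= t <= d ->
  bdry a b c d (cpl C x t).
Proof.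
move=> ab hy ht; split; rewrite ?cre_cpl ?cim_cpl ?orbA ?hy //.
by case/orP: hy => /eqP ->; rewrite lexx ?ab.
Qed.

Lemma loop_bound F a b c d (M : R) : a <= b -> c <= d ->
  (forall z, bdry a b c d z -> differentiable F z) ->
  (forall z, bdry a b c d z -> nrm (F z) <= M) ->
  nrm (loop F a b c d) <= 4 * M * ((b - a) + (d - c)).
Proof.
move=> ab cd hF hM.
have B1 y t := @bdry_h a b c d y t cd.
have B2 x t := @bdry_v a b c d x t ab.
have H1 y : (y == c) || (y == d) -> nrm (cint a b (fun t => F (cpl C t y))) <= 2 * (M * (b - a)).
  by move=> hy; apply: cint_bound => // t ht; [apply/hcont/hF/B1|apply/hM/B1].
have H2 x : (x == a) || (x == b) -> nrm (i * cint c d (fun t => F (cpl C x t))) <= 2 * (M * (d - c)).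
  by move=> hy; rewrite nrmM nrmi mul1r; apply: cint_bound => // t ht; [apply/vcont/hF/B2|apply/hM/B2].
rewrite /loop.
have := H1 c; have := H1 d; have := H2 a; have := H2 b; rewrite !eqxx !orbT /=.
move=> /(_ isT) e1 /(_ isT) e2 /(_ isT) e3 /(_ isT) e4.
apply: le_trans (nrmB _ _) _; apply: le_trans (lerD (nrmB _ _) (lexx _)) _.
apply: le_trans (lerD (lerD (nrmD _ _) (lexx _)) (lexx _)) _; lra.
Qed.

Lemma loop_primitive F G a b c d : a <= b -> c <= d ->
  (forall z, bdry a b c d z -> differentiable F z) ->
  (forall z, bdry a b c d z -> is_derive z 1 G (F z)) ->
  loop F a b c d = 0.
Proof.
move=> ab cd hF hG.
have B1 y t := @bdry_h a b c d y t cd.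
have B2 x t := @bdry_v a b c d x t ab.
have dG z v : bdry a b c d z -> differentiable G z /\ 'd G z v = v * F z.
  move=> /hG h; have dz : derivable G z 1 by apply: ex_derive.
  split; first exact/derivable1_diffP.
  by rewrite (deriv1E dz) /= derive1E (@derive_val _ _ _ _ _ _ _ h).
have H1 y : (y == c) || (y == d) ->
    cint a b (fun t => F (cpl C t y)) = G (cpl C b y) - G (cpl C a y).
  move=> hy; apply: (@cint_FTC _ _ _ _ _ (fun t => G (cpl C t y))) => // t ht.
    exact/hcont/hF/B1.
  have [h1 h2] := dG _ 1 (B1 _ _ hy ht).
  by rewrite -[F _]mul1r -h2; apply: rderiv_hline.
have H2 x : (x == a) || (x == b) ->
    i * cint c d (fun t => F (cpl C x t)) = G (cpl C x d) - G (cpl C x c).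
  move=> hx; rewrite -cintM; last by move=> t ht; apply/vcont/hF/B2.
  apply: (@cint_FTC _ _ _ _ _ (fun t => G (cpl C x t))) => // t ht.
    exact/rcontM/vcont/hF/B2.
  have [h1 h2] := dG _ i (B2 _ _ hx ht).
  by rewrite -h2; apply: rderiv_vline.
rewrite /loop H1 ?eqxx // H1 ?eqxx ?orbT // H2 ?eqxx ?orbT // H2 ?eqxx //; ring.
Qed.

Lemma loopD F G a b c d : a <= b -> c <= d ->
  (forall z, bdry a b c d z -> differentiable F z) ->
  (forall z, bdry a b c d z -> differentiable G z) ->
  loop (fun z => F z + G z) a b c d = loop F a b c d + loop G a b c d.
Proof.
move=> ab cd hF hG.
have B1 y t := @bdry_h a b c d y t cd.
have B2 x t := @bdry_v a b c d x t ab.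
rewrite /loop !cintD;
  try (by move=> t ht; (apply/hcont/hF/B1 || apply/hcont/hG/B1) => //; rewrite ?eqxx ?orbT);
  try (by move=> t ht; (apply/vcont/hF/B2 || apply/vcont/hG/B2) => //; rewrite ?eqxx ?orbT).
ring.
Qed.

Lemma loopM (k : C) F a b c d : a <= b -> c <= d ->
  (forall z, bdry a b c d z -> differentiable F z) ->
  loop (fun z => k * F z) a b c d = k * loop F a b c d.
Proof.
move=> ab cd hF.
have B1 y t := @bdry_h a b c d y t cd.
have B2 x t := @bdry_v a b c d x t ab.
rewrite /loop !cintM;
  try (by move=> t ht; apply/hcont/hF/B1 => //; rewrite ?eqxx ?orbT);
  try (by move=> t ht; apply/vcont/hF/B2 => //; rewrite ?eqxx ?orbT).
ring.
Qed.

Lemma eq_loop F G a b c d : a <= b -> c <= d ->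
  (forall z, bdry a b c d z -> F z = G z) -> loop F a b c d = loop G a b c d.
Proof.
move=> ab cd FG.
have B1 y t := @bdry_h a b c d y t cd.
have B2 x t := @bdry_v a b c d x t ab.
rewrite /loop; congr (_ + _ * _ - _ - _ * _); apply: eq_cint => t ht; apply: FG;
 first [by apply: B1 => //; rewrite eqxx ?orbT | by apply: B2 => //; rewrite eqxx ?orbT].
Qed.

Lemma bdry_rect a b c d z : bdry a b c d z ->
  z = cpl C (cre z) (cim z) /\ a <= cre z <= b /\ c <= cim z <= d.
Proof. by case=> h1 h2 _; split => //; apply: complex_ext; rewrite ?cre_cpl ?cim_cpl. Qed.

(** Pigeonhole: the integrals around the four quarters add up to the whole. *)
Lemma loop_quarter F a b c d (e : R) : a <= b -> c <= d -> rectD F a b c d ->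
  let m := (a + b) / 2 in let k := (c + d) / 2 in
  4 * e < nrm (loop F a b c d) ->
  [|| e < nrm (loop F a m c k), e < nrm (loop F m b c k),
      e < nrm (loop F a m k d) | e < nrm (loop F m b k d)].
Proof.
move=> ab cd hF m k.
have am : a <= m by rewrite /m; lra.
have mb : m <= b by rewrite /m; lra.
have ck : c <= k by rewrite /k; lra.
have kd : k <= d by rewrite /k; lra.
rewrite (@loop_vsplit F a b c k d) //.
rewrite (@loop_hsplit F a m b c k) //; last exact: rectDS hF.
rewrite (@loop_hsplit F a m b k d) //; last exact: rectDS hF.
move=> h.
have := le_trans (nrmD _ _) (lerD (nrmD (loop F a m c k) (loop F m b c k)) (nrmD (loop F a m k d) (loop F m b k d))).
case: ltP => // h1; case: ltP => // h2; case: ltP => // h3; case: ltP => // h4.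
clear -h h1 h2 h3 h4; move: (nrm (loop F a m c k)) (nrm (loop F m b c k)) (nrm (loop F a m k d)) (nrm (loop F m b k d)) h h1 h2 h3 h4 => x1 x2 x3 x4.
move: (nrm _) => x5; lra.
Qed.

Lemma differentiable_affine (A B : C) (z : C) :
  differentiable (fun z : C => A + B * z) z.
Proof.
apply: differentiableD; first exact: differentiable_cst.
by apply: differentiableM; [exact: differentiable_cst|exact: ex_diff].
Qed.

(** Affine functions have primitives, so near the limit point of the subdivision only the
    first-order Taylor remainder contributes to the integral. *)
Lemma loop_sub_affine F (A B : C) a b c d : a <= b -> c <= d ->
  (forall z, bdry a b c d z -> differentiable F z) ->
  loop F a b c d = loop (fun z : C => F z - (A + B * z)) a b c d.
Proof.
move=> ab cd dF.
have dP (z : C) : is_derive z 1 (fun z : C => A * z + B / 2 * z ^+ 2) (A + B * z).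
  by apply: is_derive_eq; rewrite /GRing.scale /=; field.
have dA (z : C) : differentiable (fun z : C => A + B * z) z by exact: differentiable_affine.
have h0 := @loop_primitive (fun z : C => A + B * z) _ a b c d ab cd
  (fun z _ => dA z) (fun z _ => dP z).
have dR z : bdry a b c d z -> differentiable (fun z : C => F z - (A + B * z)) z.
  by move=> hz; exact: (differentiableB (dF z hz) (differentiable_affine A B z)).
have FE : F = (fun z : C => (F z - (A + B * z)) + (A + B * z)).
  by apply/funext => z; rewrite subrK.
by rewrite {1}FE (loopD ab cd dR (fun z _ => dA z)) h0 addr0.
Qed.

Record rect := Rect { rxl : R; rxr : R; ryl : R; ryr : R }.

Lemma goursat F a b c d : a <= b -> c <= d -> rectD F a b c d -> loop F a b c d = 0.
Proof.
move=> ab cd hF; apply: nrm_eq0; apply/eqP; rewrite eq_le nrm_ge0 andbT leNgt.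
apply/negP => L0.
pose s := (b - a) + (d - c).
have s0 : 0 <= s by rewrite /s; lra.
(* With [s] half the perimeter, [e * s ^+ 2] lies strictly below the modulus of the integral; the
   [+ 1] covers a degenerate rectangle. Halving the sides divides [s ^+ 2] by 4, so [loop_quarter]
   preserves the inequality, and differentiability at the limit point will contradict it. *)
pose e := nrm (loop F a b c d) / (2 * (s ^+ 2 + 1)).
have s2 : 0 < s ^+ 2 + 1 by have := sqr_ge0 s; lra.
have e0 : 0 < e by rewrite divr_gt0 // mulr_gt0.
have es : e * s ^+ 2 < nrm (loop F a b c d).
  rewrite /e mulrAC ltr_pdivrMr ?mulr_gt0 // ltr_pM2l //; lra.
pose per (Q : rect) := (rxr Q - rxl Q) + (ryr Q - ryl Q).
pose ok (Q : rect) := [/\ rxl Q <= rxr Q, ryl Q <= ryr Q,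
   (a <= rxl Q) && (rxr Q <= b), (c <= ryl Q) && (ryr Q <= d) &
   e * per Q ^+ 2 < nrm (loop F (rxl Q) (rxr Q) (ryl Q) (ryr Q))].
pose half (Q Q' : rect) := [/\ rxr Q' - rxl Q' = (rxr Q - rxl Q) / 2,
   ryr Q' - ryl Q' = (ryr Q - ryl Q) / 2, rxl Q <= rxl Q' <= rxr Q &
   ryl Q <= ryl Q' <= ryr Q].
have step (Q : {Q | ok Q}) : {Q' : {Q | ok Q} | half (sval Q) (sval Q')}.
  apply: cid; case: Q => -[l r u v] /= [/= h1 h2 /andP[h3 h4] /andP[h5 h6]].
  rewrite /per /= => h7.
  have hF' : rectD F l r u v by apply: rectDS hF.
  pose q := e * (((r - l) + (v - u)) / 2) ^+ 2.
  have : 4 * q < nrm (loop F l r u v).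
    by apply: le_lt_trans h7; rewrite /q le_eqVlt; apply/orP; left; apply/eqP; field.
  move=> /(loop_quarter h1 h2 hF') /or4P[] hq.
  - have okQ : ok (Rect l ((l + r) / 2) u ((u + v) / 2)).
      split => /=; rewrite ?/per /=; [by clear -h1; lra|by clear -h2; lra|by clear -h1 h3 h4; lra|by clear -h2 h5 h6; lra|].
      by apply: le_lt_trans hq; rewrite /q le_eqVlt; apply/orP; left; apply/eqP; field.
    by exists (exist _ _ okQ); clear -h1 h2; split => /=; lra.
  - have okQ : ok (Rect ((l + r) / 2) r u ((u + v) / 2)).
      split => /=; rewrite ?/per /=; [by clear -h1; lra|by clear -h2; lra|by clear -h1 h3 h4; lra|by clear -h2 h5 h6; lra|].
      by apply: le_lt_trans hq; rewrite /q le_eqVlt; apply/orP; left; apply/eqP; field.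
    by exists (exist _ _ okQ); clear -h1 h2; split => /=; lra.
  - have okQ : ok (Rect l ((l + r) / 2) ((u + v) / 2) v).
      split => /=; rewrite ?/per /=; [by clear -h1; lra|by clear -h2; lra|by clear -h1 h3 h4; lra|by clear -h2 h5 h6; lra|].
      by apply: le_lt_trans hq; rewrite /q le_eqVlt; apply/orP; left; apply/eqP; field.
    by exists (exist _ _ okQ); clear -h1 h2; split => /=; lra.
  have okQ : ok (Rect ((l + r) / 2) r ((u + v) / 2) v).
    split => /=; rewrite ?/per /=; [by clear -h1; lra|by clear -h2; lra|by clear -h1 h3 h4; lra|by clear -h2 h5 h6; lra|].
    by apply: le_lt_trans hq; rewrite /q le_eqVlt; apply/orP; left; apply/eqP; field.
  by exists (exist _ _ okQ); clear -h1 h2; split => /=; lra.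
have ok0 : ok (Rect a b c d) by split => //=; rewrite ?lexx.
have [Q [Q0 hQ]] := dependent_choice step (exist _ _ ok0).
pose l n := rxl (sval (Q n)); pose r n := rxr (sval (Q n)).
pose u n := ryl (sval (Q n)); pose v n := ryr (sval (Q n)).
have rl n : r n - l n = (b - a) * 2^-1 ^+ n.
  elim: n => [|n IH]; first by rewrite /r /l Q0 /= expr0 mulr1.
  by have [h _ _ _] := hQ n; rewrite /r /l h -/(r n) -/(l n) IH exprS mulrA mulrAC.
have vu n : v n - u n = (d - c) * 2^-1 ^+ n.
  elim: n => [|n IH]; first by rewrite /v /u Q0 /= expr0 mulr1.
  by have [_ h _ _] := hQ n; rewrite /v /u h -/(v n) -/(u n) IH exprS mulrA mulrAC.
have okn n : ok (sval (Q n)) by case: (Q n).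
have [x hx] : exists x, forall n, `|x - l n| <= 2 * (b - a) * 2^-1 ^+ n.
  apply: real_geometric_limit => n; rewrite -rl.
  by have [_ _ /andP[h1 h2] _] := hQ n; rewrite ger0_norm; rewrite /l /r; lra.
have [y hy] : exists y, forall n, `|y - u n| <= 2 * (d - c) * 2^-1 ^+ n.
  apply: real_geometric_limit => n; rewrite -vu.
  by have [_ _ _ /andP[h1 h2]] := hQ n; rewrite ger0_norm; rewrite /u /v; lra.
have xab : a <= x <= b.
  apply/andP; split; rewrite leNgt; apply/negP => h.
    have [N hN] := @exp_half_small R (2 * (b - a)) (a - x) ltac:(lra).
    have := hN N (leqnn _); have := hx N; have [_ _ /andP[h1 _] _ _] := okn N.
    by rewrite ler_norml -/(l N) in h1 * => /andP[]; lra.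
  have [N hN] := @exp_half_small R (2 * (b - a)) (x - b) ltac:(lra).
  have := hN N (leqnn _); have := hx N; have [h2 _ /andP[_ h1] _ _] := okn N.
  by rewrite ler_norml -/(l N) -/(r N) in h1 h2 * => /andP[]; lra.
have ycd : c <= y <= d.
  apply/andP; split; rewrite leNgt; apply/negP => h.
    have [N hN] := @exp_half_small R (2 * (d - c)) (c - y) ltac:(lra).
    have := hN N (leqnn _); have := hy N; have [_ _ _ /andP[h1 _] _] := okn N.
    by rewrite ler_norml -/(u N) in h1 * => /andP[]; lra.
  have [N hN] := @exp_half_small R (2 * (d - c)) (y - d) ltac:(lra).
  have := hN N (leqnn _); have := hy N; have [_ h2 _ /andP[_ h1] _] := okn N.
  by rewrite ler_norml -/(u N) -/(v N) in h1 h2 * => /andP[]; lra.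
have dF := hF x y xab ycd; set z0 := cpl C x y in dF.
(* Boundary points of the N-th rectangle are within [3 * sN] of [z0], and [loop_bound] contributes a
   factor 4: together they turn [e / 12] into [e]. *)
have [|del del0 hdel] := differentiable_eps dF (e := e / 12); first by rewrite divr_gt0.
have [N hN] := @exp_half_small R (3 * s) del del0.
have {}hN := hN N (leqnn _).
have [lr uv /andP[al rb] /andP[cu vd]] := okn N; rewrite -/(l N) -/(r N) -/(u N) -/(v N) in lr uv al rb cu vd *.
apply/negP; rewrite -leNgt /per -/(l N) -/(r N) -/(u N) -/(v N).
set sN := (r N - l N + (v N - u N)).
have sNE : sN = s * 2^-1 ^+ N by rewrite /sN rl vu /s; ring.
pose A : C := F z0 - z0 * 'd F z0 1; pose B : C := 'd F z0 1.
pose Rm (z : C) : C := F z - (A + B * z).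
have dz h : 'd F z0 h = h * B.
  by rewrite /B -[in LHS](mulr1 h) -[h * 1]/(h *: (1 : C)) linearZ.
have near_z0 z : bdry (l N) (r N) (u N) (v N) z -> nrm (z - z0) <= 3 * sN.
  case=> /andP[h1 h2] /andP[h3 h4] _.
  have := hx N; have := hy N; rewrite !ler_norml => /andP[h5 h6] /andP[h7 h8].
  apply: le_trans (nrm_le_ReIm _) _; rewrite creB cimB /z0 cre_cpl cim_cpl.
  have := rl N; have := vu N => e1 e2.
  have n1 : `|cre z - x| <= 3 * (r N - l N) by clear -h1 h2 h7 h8 e2; rewrite ler_norml; apply/andP; split; lra.
  have n2 : `|cim z - y| <= 3 * (v N - u N) by clear -h3 h4 h5 h6 e1; rewrite ler_norml; apply/andP; split; lra.
  by clear -n1 n2; rewrite /sN; lra.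
have dFb z : bdry (l N) (r N) (u N) (v N) z -> differentiable F z.
  by move=> /bdry_rect[zE [/andP[h1 h2] /andP[h3 h4]]]; rewrite zE; apply: hF; clear -h1 h2 h3 h4 al rb cu vd; apply/andP; split; lra.
rewrite (@loop_sub_affine F A B _ _ _ _ lr uv dFb) -/Rm.
have -> : e * sN ^+ 2 = 4 * (e / 12 * (3 * sN)) * sN by field.
have dRm z : bdry (l N) (r N) (u N) (v N) z -> differentiable Rm z.
  by move=> hz; apply: differentiableB; [exact: dFb|exact: differentiable_affine].
apply: (loop_bound lr uv dRm) => z hz.
have hz' := near_z0 _ hz.
have hlt : nrm (z - z0) < del by apply: le_lt_trans hz' _; rewrite sNE mulrA.
have := hdel _ hlt; rewrite dz (addrC z0) subrK => h.
have -> : Rm z = F z - F z0 - (z - z0) * B by rewrite /Rm /A -/B; ring.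
apply: le_trans h _; by rewrite ler_wpM2l // divr_ge0 // ltW.
Qed.

End Goursat.

Section CauchyEstimate.
Context {R : realType} {C : cxType R}.
Local Notation mu := (@lebesgue_measure R).
Implicit Types (F g : C -> C) (a b c d r : R).
Local Notation i := (cpl C 0 1 : C).

(** Deformation of the contour: the region between the squares is cut into a bottom and a top strip
    of full width and two side pieces, and Goursat's theorem applies to each of the four
    rectangles. *)
Lemma loop_ring F r s : 0 < r -> r <= s ->
  (forall x y, - s <= x <= s -> - s <= y <= s -> (r <= `|x|) || (r <= `|y|) ->
     differentiable F (cpl C x y)) ->
  loop F (- s) s (- s) s = loop F (- r) r (- r) r.
Proof.
move=> r0 rs hF.
have sr : - s <= - r by rewrite lerN2.
have rr : - r <= r by lra.
have ss : - s <= s by lra.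
have Nr : `|- r| = r by rewrite normrN gtr0_norm.
have n1 y : (y == r) || (y == - r) -> r <= `|y|.
  by case/orP => /eqP ->; rewrite ?Nr // gtr0_norm.
have n2 (y : R) : y <= - r -> r <= `|y|.
  by move=> h; rewrite -normrN; apply: le_trans (ler_norm _); rewrite lerNr.
have n3 (y : R) : r <= y -> r <= `|y| by move=> h; apply: le_trans (ler_norm _).
have L1 : loop F (- s) s (- s) (- r) = 0.
  apply: goursat => // x y hx /andP[h1 h2]; apply: hF; rewrite ?(n2 y) ?orbT //.
  by rewrite h1 (le_trans h2) //; lra.
have L2 : loop F (- s) s r s = 0.
  apply: goursat => // x y hx /andP[h1 h2]; apply: hF; rewrite ?(n3 y) ?orbT //.
  by rewrite h2 (le_trans _ h1) //; lra.
have L3 : loop F (- s) (- r) (- r) r = 0.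
  apply: goursat => // x y /andP[h1 h2] /andP[h3 h4]; apply: hF; rewrite ?(n2 x) ?orbT //.
    by rewrite h1 (le_trans h2) //; lra.
  by apply/andP; split; lra.
have L4 : loop F r s (- r) r = 0.
  apply: goursat => // x y /andP[h1 h2] /andP[h3 h4]; apply: hF; rewrite ?(n3 x) ?orbT //.
    by rewrite h2 (le_trans _ h1) //; lra.
  by apply/andP; split; lra.
have hsp y : (y == r) || (y == - r) -> cint (- s) s (fun t => F (cpl C t y)) =
   cint (- s) (- r) (fun t => F (cpl C t y)) + cint (- r) r (fun t => F (cpl C t y))
   + cint r s (fun t => F (cpl C t y)).
  move=> hy.
  have hc t : - s <= t <= s -> rcont (fun s => F (cpl C s y)) t.
    move=> ht; apply: hcont; apply: hF => //; last by rewrite (n1 y hy) orbT.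
    by case/orP: hy => /eqP ->; apply/andP; split; lra.
  rewrite (@cint_split _ _ (- s) (- r) s) //; last by lra.
  rewrite (@cint_split _ _ (- r) r s) //; first by rewrite addrA.
  by move=> t /andP[h1 h2]; apply: hc; rewrite h2 (le_trans _ h1).
have vsp x : (x == s) || (x == - s) -> cint (- s) s (fun t => F (cpl C x t)) =
   cint (- s) (- r) (fun t => F (cpl C x t)) + cint (- r) r (fun t => F (cpl C x t))
   + cint r s (fun t => F (cpl C x t)).
  move=> hy.
  have hc t : - s <= t <= s -> rcont (fun s => F (cpl C x s)) t.
    move=> ht; apply: vcont; apply: hF => //.
      by case/orP: hy => /eqP ->; rewrite lexx ?andbT.
    by apply/orP; left; case/orP: hy => /eqP ->; rewrite ?normrN (gtr0_norm (lt_le_trans r0 rs)).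
  rewrite (@cint_split _ _ (- s) (- r) s) //; last by lra.
  rewrite (@cint_split _ _ (- r) r s) //; first by rewrite addrA.
  by move=> t /andP[h1 h2]; apply: hc; rewrite h2 (le_trans _ h1).
apply/eqP; rewrite -subr_eq0 -[X in _ == X](addr0 0) -[X in _ == X + _](addr0 0).
rewrite -[X in _ == X + _ + _](addr0 0) -{1}L1 -{1}L2 -{1}L3 -L4 /loop.
rewrite (hsp r) ?eqxx // (hsp (- r)) ?eqxx ?orbT //.
rewrite (vsp s) ?eqxx // (vsp (- s)) ?eqxx ?orbT //.
apply/eqP; ring.
Qed.

Lemma Rintegral_itv_lower a b (f : R -> R) (m : R) : a <= b ->
  (forall t, a <= t <= b -> {for t, continuous f}) ->
  (forall t, a <= t <= b -> m <= f t) -> m * (b - a) <= Rintegral mu `[a, b] f.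
Proof.
move=> ab cf hm; apply: (@le_trans _ _ (Rintegral mu `[a, b] (cst m))).
  rewrite Rintegral_cst //= lebesgue_measure_itv /= lte_fin.
  case: ltP => h; first by rewrite -EFinB.
  have -> : b = a by apply/eqP; rewrite eq_le ab h.
  by rewrite subrr.
apply: le_Rintegral => //; last exact: itv_integrable.
by apply: itv_integrable => t ht; exact: cvg_cst.
Qed.

Lemma bdry_sq_ge r (z : C) : 0 < r -> bdry (- r) r (- r) r z -> r <= nrm z.
Proof.
move=> r0 [_ _] /or4P[] /eqP h.
- by apply: le_trans (cre_le _); rewrite h normrN gtr0_norm.
- by apply: le_trans (cre_le _); rewrite h gtr0_norm.
- by apply: le_trans (cim_le _); rewrite h normrN gtr0_norm.
- by apply: le_trans (cim_le _); rewrite h gtr0_norm.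
Qed.

Lemma bdry_sq_le r (z : C) : bdry (- r) r (- r) r z -> nrm z <= 2 * r.
Proof. by case=> h1 h2 _; apply: nrm_le_max; rewrite ler_norml. Qed.

Lemma bdry_sq_neq0 r (z : C) : 0 < r -> bdry (- r) r (- r) r z -> z != 0.
Proof.
move=> r0 /(bdry_sq_ge r0) h; apply/eqP => z0; move: h.
by rewrite z0 nrm0 leNgt r0.
Qed.

Lemma differentiable_inv (z : C) : z != 0 -> differentiable (fun z : C => z^-1) z.
Proof. by move=> z0; apply: differentiableV => //; exact: ex_diff. Qed.

(** A lower bound replaces the exact value 2 pi i. Each side contributes the integral of r / (t^2 +
    r^2), which is at least 1: the integrand is at least 1 / (2 r) on an interval of length 2 r. *)
Lemma loop_inv_ge r : 0 < r -> 4 <= cim (loop (fun z : C => z^-1) (- r) r (- r) r).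
Proof.
move=> r0.
have rr : - r <= r by lra.
have diffb z : bdry (- r) r (- r) r z -> differentiable (fun z : C => z^-1) z.
  by move=> /(bdry_sq_neq0 r0); exact: differentiable_inv.
have B1 y t := @bdry_h R C (- r) r (- r) r y t rr.
have B2 x t := @bdry_v R C (- r) r (- r) r x t rr.
have low (f : R -> R) : (forall t, - r <= t <= r -> {for t, continuous f}) ->
    (forall t, - r <= t <= r -> f t = r / (t ^+ 2 + r ^+ 2)) ->
    1 <= Rintegral mu `[- r, r] f.
  move=> cf hf; have -> : 1 = (2 * r)^-1 * (r - - r) by field; rewrite gt_eqF.
  apply: Rintegral_itv_lower => // t ht; rewrite hf //.
  have t2 : t ^+ 2 <= r ^+ 2 by rewrite -(real_normK (num_real t)) lerXn2r ?nnegrE ?ler_norml // ltW.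
  have r2 : 0 < r ^+ 2 by rewrite exprn_gt0.
  rewrite ler_pdivlMr; last by have := sqr_ge0 t; lra.
  apply: (@le_trans _ _ ((2 * r)^-1 * (2 * r ^+ 2))); last first.
    by rewrite le_eqVlt; apply/orP; left; apply/eqP; field; rewrite gt_eqF.
  rewrite ler_pM2l ?invr_gt0 ?mulr_gt0 //; lra.
rewrite /loop !(cimD, cimN, cimM) !(cre_cpl C 0 1) !(cim_cpl C 0 1) !mul0r !mul1r !add0r.
have e1 : 1 <= cim (cint (- r) r (fun t => (cpl C t (- r))^-1)).
  rewrite /cint cim_cpl; apply: low => t ht.
    by have [] := hcont (diffb _ (B1 (- r) t ltac:(by rewrite eqxx) ht)).
  by rewrite cimV cre_cpl cim_cpl opprK sqrrN.
have e2 : 1 <= cre (cint (- r) r (fun t => (cpl C r t)^-1)).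
  rewrite /cint cre_cpl; apply: low => t ht.
    by have [] := vcont (diffb _ (B2 r t ltac:(by rewrite eqxx orbT) ht)).
  by rewrite creV cre_cpl cim_cpl addrC.
have e3 : 1 <= - cim (cint (- r) r (fun t => (cpl C t r)^-1)).
  have cc t : - r <= t <= r -> rcont (fun t => (cpl C t r)^-1) t.
    by move=> ht; exact: (hcont (diffb _ (B1 r t ltac:(by rewrite eqxx orbT) ht))).
  rewrite -cimN -cintN // /cint cim_cpl; apply: low => t ht.
    by have [] := rcontN (cc t ht).
  by rewrite cimN cimV cre_cpl cim_cpl mulNr opprK.
have e4 : 1 <= - cre (cint (- r) r (fun t => (cpl C (- r) t)^-1)).
  have cc t : - r <= t <= r -> rcont (fun t => (cpl C (- r) t)^-1) t.
    by move=> ht; exact: (vcont (diffb _ (B2 (- r) t ltac:(by rewrite eqxx) ht))).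
  rewrite -creN -cintN // /cint cre_cpl; apply: low => t ht.
    by have [] := rcontN (cc t ht).
  by rewrite creN creV cre_cpl cim_cpl mulNr opprK sqrrN addrC.
apply: (@le_trans _ _ (1 + 1 + 1 + 1)); first by lra.
by do 3! apply: lerD => //.
Qed.

Lemma loop_inv2 r : 0 < r -> loop (fun z : C => (z^-1 * z^-1)) (- r) r (- r) r = 0.
Proof.
move=> r0; have rr : - r <= r by lra.
apply: (@loop_primitive R C _ (fun z : C => - z^-1) _ _ _ _ rr rr) => z /(bdry_sq_neq0 r0) z0.
  by apply: differentiableM; exact: differentiable_inv.
apply: is_derive_eq.
  apply: is_deriveN; split; first by apply: derivableV => //; exact: derivable_id.
  by rewrite deriveV //; exact: derivable_id.
by rewrite derive_id /GRing.scale /=; field.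
Qed.

(** The integral of g(z) / z^2 is moved to a tiny square, where g is its affine part plus a
    remainder. The term g(0) / z^2 integrates to 0 and g'(0) / z gives at least [4 * nrm g1], so
    g'(0) is bounded without an integral formula for g. *)
Lemma cauchy_square g s (M : R) : 0 < s ->
  (forall x y, - s <= x <= s -> - s <= y <= s -> differentiable g (cpl C x y)) ->
  (forall z, nrm z <= 2 * s -> nrm (g z) <= M) ->
  nrm ('d g 0 1) <= 4 * M / s.
Proof.
move=> s0 hg hM; apply/ler_addgt0Pr => e0 e0gt.
(* The remainder will contribute at most [16 * e], that is [4 * e0]; division by the lower bound 4
   of [loop_inv_ge] leaves [e0]. *)
pose e := e0 / 4; have e_gt0 : 0 < e by rewrite divr_gt0.
have d0 : differentiable g 0.
  have -> : (0 : C) = cpl C 0 0.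
    by apply: complex_ext; rewrite ?cre_cpl ?cim_cpl ?cre0 ?cim0.
  by apply: hg; apply/andP; split; lra.
have [d dgt hd] := differentiable_eps d0 e_gt0.
(* Points of the small square have modulus at most [2 * r < d], so the remainder of [g] is there at
   most [e * nrm z]. *)
pose r := Num.min s (d / 3).
have r0 : 0 < r by rewrite lt_min s0 divr_gt0.
have rs : r <= s by rewrite ge_min lexx.
have rd : 2 * r < d.
  apply: (@le_lt_trans _ _ (2 * (d / 3))); last by lra.
  by rewrite ler_pM2l // ge_min lexx orbT.
have rr : - r <= r by lra.
have ss : - s <= s by lra.
pose F (z : C) := g z * (z^-1 * z^-1).
have dgb (t : R) (z : C) : 0 < t -> t <= s -> bdry (- t) t (- t) t z -> differentiable g z.
  move=> t0 ts /bdry_rect[zE [/andP[h1 h2] /andP[h3 h4]]].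
  by rewrite zE; apply: hg; apply/andP; split; lra.
have di2 (t : R) (z : C) : 0 < t -> bdry (- t) t (- t) t z -> differentiable (fun z : C => (z^-1 * z^-1)) z.
  by move=> t0 /(bdry_sq_neq0 t0) z0; apply: differentiableM; exact: differentiable_inv.
have di1 (t : R) (z : C) : 0 < t -> bdry (- t) t (- t) t z -> differentiable (fun z : C => z^-1) z.
  by move=> t0 /(bdry_sq_neq0 t0) z0; exact: differentiable_inv.
have dFb (t : R) (z : C) : 0 < t -> t <= s -> bdry (- t) t (- t) t z -> differentiable F z.
  by move=> t0 ts hz; apply: differentiableM; [exact: dgb hz|exact: di2 hz].
have ni2 (t : R) (z : C) : 0 < t -> bdry (- t) t (- t) t z -> nrm ((z^-1 * z^-1)) <= (t ^+ 2)^-1.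
  move=> t0 hz; rewrite nrmM nrmV -expr2 exprVn lef_pV2 ?posrE ?exprn_gt0 //.
    by rewrite lerXn2r ?nnegrE ?(ltW t0) ?nrm_ge0 // (bdry_sq_ge t0).
  by apply: lt_le_trans (bdry_sq_ge t0 hz).
have Ls : nrm (loop F (- s) s (- s) s) <= 16 * M / s.
  have -> : 16 * M / s = 4 * (M * (s ^+ 2)^-1) * ((s - - s) + (s - - s)).
    by field; rewrite gt_eqF.
  apply: (loop_bound ss ss (fun z hz => dFb s z s0 (lexx s) hz)) => z hz.
  rewrite nrmM; apply: ler_pM; rewrite ?nrm_ge0 //; last exact: ni2 hz.
  by apply: hM; exact: bdry_sq_le.
pose g0 := g 0; pose g1 : C := 'd g 0 1.
pose rem (z : C) : C := g z - (g0 + g1 * z).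
have drem z : bdry (- r) r (- r) r z -> differentiable rem z.
  by move=> hz; apply: differentiableB; [exact: dgb hz|exact: differentiable_affine].
have dz h : 'd g 0 h = h * g1.
  by rewrite /g1 -[in LHS](mulr1 h) -[h * 1]/(h *: (1 : C)) linearZ.
pose F3 (z : C) := rem z * (z^-1 * z^-1).
have dF3 z : bdry (- r) r (- r) r z -> differentiable F3 z.
  by move=> hz; apply: differentiableM; [exact: drem|exact: di2 hz].
have L3 : nrm (loop F3 (- r) r (- r) r) <= 16 * e.
  have -> : 16 * e = 4 * (e / r) * ((r - - r) + (r - - r)).
    by field; rewrite gt_eqF.
  apply: (loop_bound rr rr dF3) => z hz.
  have hz2 := bdry_sq_le hz.
  have := hd z (le_lt_trans hz2 rd); rewrite add0r dz => h.
  have zr := bdry_sq_ge r0 hz; have z0 : 0 < nrm z by exact: lt_le_trans zr.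
  rewrite nrmM /rem (_ : g z - (g0 + g1 * z) = g z - g 0 - z * g1); last by rewrite /g0; ring.
  apply: (@le_trans _ _ (e * nrm z * nrm ((z^-1 * z^-1)))).
    by rewrite ler_wpM2r // nrm_ge0.
  rewrite nrmM nrmV mulrA mulfK ?gt_eqF // ler_pM2l //.
  by rewrite lef_pV2 ?posrE.
have LF : loop F (- r) r (- r) r = g1 * loop (fun z : C => z^-1) (- r) r (- r) r
    + loop F3 (- r) r (- r) r.
  have -> : loop F (- r) r (- r) r =
     loop (fun z : C => (g0 * (z^-1 * z^-1) + g1 * z^-1) + F3 z) (- r) r (- r) r.
    apply: (eq_loop rr rr) => z /(bdry_sq_neq0 r0) z0; rewrite /F /F3 /rem; by field.
  have d1 z : bdry (- r) r (- r) r z -> differentiable (fun z : C => g0 * (z^-1 * z^-1)) z.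
    by move=> hz; apply: differentiableM; [exact: differentiable_cst|exact: di2 hz].
  have d2 z : bdry (- r) r (- r) r z -> differentiable (fun z : C => g1 * z^-1) z.
    by move=> hz; apply: differentiableM; [exact: differentiable_cst|exact: di1 hz].
  have d3 z : bdry (- r) r (- r) r z -> differentiable (fun z : C => g0 * (z^-1 * z^-1) + g1 * z^-1) z.
    by move=> hz; apply: differentiableD; [exact: d1|exact: d2].
  rewrite (loopD rr rr d3 dF3) (loopD rr rr d1 d2).
  rewrite (loopM g0 rr rr (fun z hz => di2 r z r0 hz)) (loopM g1 rr rr (fun z hz => di1 r z r0 hz)).
  by rewrite loop_inv2 // mulr0 add0r.
have LL : loop F (- s) s (- s) s = loop F (- r) r (- r) r.
  apply: (loop_ring r0 rs) => x y hx hy hr.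
  apply: differentiableM; first exact: hg.
  suff h0 : cpl C x y != 0 by apply: differentiableM; exact: differentiable_inv.
  apply/eqP => h.
  have hx0 : x = 0 by rewrite -(cre_cpl C x y) h cre0.
  have hy0 : y = 0 by rewrite -(cim_cpl C x y) h cim0.
  by move: hr; rewrite hx0 hy0 normr0 orbb leNgt r0.
have inv4 : 4 <= nrm (loop (fun z : C => z^-1) (- r) r (- r) r).
  by apply: le_trans (loop_inv_ge r0) (le_trans (ler_norm _) (cim_le _)).
have : nrm g1 * nrm (loop (fun z : C => z^-1) (- r) r (- r) r) <= 16 * M / s + 16 * e.
  rewrite -nrmM.
  have -> : g1 * loop (fun z : C => z^-1) (- r) r (- r) r =
     loop F (- s) s (- s) s - loop F3 (- r) r (- r) r by rewrite LL LF addrK.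
  by apply: le_trans (nrmB _ _) _; exact: lerD.
have : nrm g1 * 4 <= nrm g1 * nrm (loop (fun z : C => z^-1) (- r) r (- r) r).
  by rewrite ler_wpM2l // nrm_ge0.
rewrite -/g1 /e; clear; move: (nrm (loop _ _ _ _ _)) => L.
move=> h1 h2; have := le_trans h1 h2.
have -> : 16 * M / s = 4 * (4 * M / s) by ring.
move: (nrm g1) (4 * M / s) => u v; lra.
Qed.

End CauchyEstimate.

(** * Holomorphic functions on complex normed spaces *)

Section Limits.
Context {R : realType} {C : cxType R}.

Lemma le_half_limit (a b B : R) : (forall n, a <= b + B * 2^-1 ^+ n) -> a <= b.
Proof.
move=> h; rewrite leNgt; apply/negP => ba.
have [|N hN] := @exp_half_small R B (a - b); first by rewrite subr_gt0.
have := h N; have := hN N (leqnn _); lra.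
Qed.

Lemma nrm_half_limit (z : C) (B : R) :
  (forall n, nrm z <= B * 2^-1 ^+ n) -> z = 0.
Proof.
move=> h; apply: nrm_eq0; apply: le_anti; rewrite nrm_ge0 andbT.
by apply: (@le_half_limit _ _ B) => n; rewrite add0r.
Qed.

Lemma half_exp_gt0 n : 0 < (2^-1 : R) ^+ n.
Proof. by rewrite exprn_gt0 // invr_gt0. Qed.

Lemma half_exp_ge0 n : 0 <= (2^-1 : R) ^+ n.
Proof. by rewrite ltW // half_exp_gt0. Qed.

Lemma half_exp_le1 n : (2^-1 : R) ^+ n <= 1.
Proof. by rewrite exprn_ile1 // ?invr_ge0 // invf_le1 // ler1n. Qed.

End Limits.

Section MeanValue.
Context {R : realType} {C : cxType R}.

Lemma rderivD (F G : R -> C) t l m : rderiv F t l -> rderiv G t m ->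
  rderiv (fun t => F t + G t) t (l + m).
Proof.
move=> [h1 h2] [h3 h4]; split.
  by under eq_fun do rewrite creD; rewrite creD; exact: is_deriveD.
by under eq_fun do rewrite cimD; rewrite cimD; exact: is_deriveD.
Qed.

Lemma rderivM (F : R -> C) t l c : rderiv F t l -> rderiv (fun t => c * F t) t (c * l).
Proof.
move=> [h1 h2]; split.
  under eq_fun do rewrite creM; rewrite creM.
  by apply: is_deriveB; apply: is_deriveZ.
under eq_fun do rewrite cimM; rewrite cimM.
by apply: is_deriveD; apply: is_deriveZ.
Qed.

Lemma rderivN (F : R -> C) t l : rderiv F t l -> rderiv (fun t => - F t) t (- l).
Proof. by move=> /(rderivM (-1)); rewrite mulN1r; under eq_fun do rewrite mulN1r. Qed.

Lemma rderiv_ofR t : rderiv (fun t : R => ofR t : C) t 1.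
Proof.
apply: rderiv_eps => e e0; exists 1 => // h _.
by rewrite rmorphD mulr1 addrAC addrK subrr nrm0 mulr_ge0 // ltW.
Qed.

Lemma mvi (G G' : R -> C) (B : R) :
  (forall t, 0 <= t <= 1 -> rderiv G t (G' t)) ->
  (forall t, 0 <= t <= 1 -> nrm (G' t) <= B) ->
  nrm (G 1 - G 0) <= 2 * B.
Proof.
move=> dG hB.
have cG t : 0 <= t <= 1 -> rcont G t by move=> /dG; exact: rderiv_cont.
have itv (t : R) : t \in `]0, 1[ -> 0 <= t <= 1.
  by rewrite in_itv /= => /andP[/ltW -> /ltW ->].
have itvc (t : R) : t \in `[0, 1] -> 0 <= t <= 1 by rewrite in_itv /=.
apply: nrm_le_max; rewrite ?creB ?cimB.
  have [||c /itvc hc ->] := @MVT_segment R (fun t => cre (G t)) (fun t => cre (G' t)) 0 1 ler01.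
  - by move=> t /itv/dG[].
  - by apply: rcont_within => t /cG[].
  by rewrite subr0 mulr1; apply: le_trans (cre_le _) (hB _ hc).
have [||c /itvc hc ->] := @MVT_segment R (fun t => cim (G t)) (fun t => cim (G' t)) 0 1 ler01.
- by move=> t /itv/dG[].
- by apply: rcont_within => t /cG[].
by rewrite subr0 mulr1; apply: le_trans (cim_le _) (hB _ hc).
Qed.

End MeanValue.

Section Frechet.
Context {R : realType} {C : cxType R}.
Context {V : normedModType C}.
Implicit Types (F G : V -> C) (x y v u h : V) (r M : R).

Lemma differentiable_line (W : normedModType C) (F : V -> W) x v (t : C) : differentiable F (x + t *: v) ->
  differentiable (fun s : C => F (x + s *: v)) t /\
  'd (fun s : C => F (x + s *: v)) t 1 = 'd F (x + t *: v) v.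
Proof.
move=> dF.
have [dl dlE] : differentiable (fun s : C => x + s *: v) t /\
    'd (fun s : C => x + s *: v) t = (fun s : C => s *: v) :> (C -> V).
  apply: (@differentiable_intro R _ C V _ _ _ (nrm v)).
  - by move=> a s1 s2; rewrite scalerDl scalerA.
  - by move=> h; rewrite nrmZ mulrC.
  move=> e e0; exists 1 => // h _.
  by rewrite scalerDl addrA (addrAC (x + t *: v) (h *: v)) subrr add0r subrr nrm0 mulr_ge0 ?nrm_ge0 // ltW.
split; first exact: (differentiable_comp dl dF).
rewrite (_ : (fun s : C => F (x + s *: v)) = F \o (fun s : C => x + s *: v)) //.
by rewrite diff_comp //= dlE scale1r.
Qed.

(** The quantitative form of holomorphy: these data alone bound the first derivative, its Lipschitz
    constant and the Taylor remainder, uniformly over all functions that satisfy them. *)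
Definition holo_ball F x r M := [/\ 0 < r,
  (forall y, nrm (y - x) < r -> differentiable F y) &
  (forall y, nrm (y - x) < r -> nrm (F y) <= M)].

Lemma holo_ball_ge0 F x r M : holo_ball F x r M -> 0 <= M.
Proof.
by move=> [r0 _ /(_ x)]; rewrite subrr nrm0 => /(_ r0); apply: le_trans; exact: nrm_ge0.
Qed.

Lemma holo_ballS F x r M y s : 0 < s -> nrm (y - x) + s <= r ->
  holo_ball F x r M -> holo_ball F y s M.
Proof.
move=> s0 hs [r0 hd hb]; split => // z hz; [apply: hd|apply: hb];
  by apply: le_lt_trans (nrm_tri z y x) _; lra.
Qed.

(** Restriction to the complex line t |-> x + t v. The square of half side [r / (4 * nrm v)] keeps
    [t *: v] within r / 2. *)
Lemma cauchy_dir F x r M v : holo_ball F x r M ->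
  nrm ('d F x v) <= 16 * M / r * nrm v.
Proof.
move=> [r0 hd hb].
have [->|v0] := eqVneq v 0; first by rewrite linear0 !nrm0 mulr0.
have nv : 0 < nrm v.
  by rewrite lt_def nrm_ge0 andbT; apply: contra_neq v0; exact: nrm_eq0.
have inb (t : C) : nrm t <= 2 * (r / (4 * nrm v)) -> nrm (x + t *: v - x) < r.
  move=> ht; rewrite addrAC subrr add0r nrmZ.
  apply: (@le_lt_trans _ _ (2 * (r / (4 * nrm v)) * nrm v)).
    by rewrite ler_pM2r.
  have -> : 2 * (r / (4 * nrm v)) * nrm v = r / 2 by field; rewrite gt_eqF.
  lra.
have s0 : 0 < r / (4 * nrm v) by rewrite divr_gt0 // mulr_gt0.
have dx : differentiable F (x + (0 : C) *: v).
  by apply/hd/inb; rewrite nrm0 mulr_ge0 // ltW.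
have [_ e1] := differentiable_line dx.
move: e1; rewrite scale0r addr0 => <-.
have -> : 16 * M / r * nrm v = 4 * M / (r / (4 * nrm v)).
  by field; rewrite !gt_eqF.
apply: (cauchy_square s0) => [a b ha hb'|z hz].
  apply: (proj1 (differentiable_line _)); apply/hd/inb.
  by apply: nrm_le_max; rewrite ?cre_cpl ?cim_cpl ler_norml.
exact/hb/inb.
Qed.

Lemma mvi_segment F x h (B : R) :
  (forall t : R, 0 <= t <= 1 -> differentiable F (x + ofR t *: h)) ->
  (forall t : R, 0 <= t <= 1 -> nrm ('d F (x + ofR t *: h) h) <= B) ->
  nrm (F (x + h) - F x) <= 2 * B.
Proof.
move=> dF hB.
have := @mvi R C (fun t => F (x + ofR t *: h)) (fun t => 'd F (x + ofR t *: h) h) B.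
rewrite rmorph1 rmorph0 scale1r scale0r addr0; apply => // t ht.
exact/rderiv_line/dF.
Qed.

Lemma segment_ball x y h r (t : R) : nrm (y - x) < r -> nrm (y + h - x) < r ->
  0 <= t <= 1 -> nrm (y + ofR t *: h - x) < r.
Proof.
move=> h1 h2 /andP[t0 t1].
have -> : y + ofR t *: h - x = ofR (1 - t) *: (y - x) + ofR t *: (y + h - x).
  rewrite addrAC (addrAC y h) rmorphB rmorph1 scalerBl scale1r.
  by rewrite (scalerDr (ofR t) (y - x) h) addrA subrK.
apply: le_lt_trans (nrmD _ _) _; rewrite !nrmZ !nrm_ofR !ger0_norm ?subr_ge0 //.
have [->|t0'] := eqVneq t 0; first by rewrite subr0 mul1r mul0r addr0.
have : t * nrm (y + h - x) < t * r by rewrite ltr_pM2l // lt_def t0'.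
have : (1 - t) * nrm (y - x) <= (1 - t) * r by rewrite ler_wpM2l ?subr_ge0 // ltW.
lra.
Qed.

Lemma lipschitz_ball F x r M y h : holo_ball F x r M ->
  nrm (y - x) < r / 2 -> nrm (y + h - x) < r / 2 ->
  nrm (F (y + h) - F y) <= 64 * M / r * nrm h.
Proof.
move=> hF h1 h2; have [r0 hd _] := hF.
have -> : 64 * M / r * nrm h = 2 * (16 * M / (r / 2) * nrm h) by field; rewrite gt_eqF.
apply: mvi_segment => t ht.
  by apply: hd; apply: (lt_trans (segment_ball h1 h2 ht)); lra.
apply: cauchy_dir; apply: holo_ballS hF; first by rewrite divr_gt0.
by have := segment_ball h1 h2 ht; lra.
Qed.

(** Cauchy's estimate applied to the increment z |-> F (z + h) - F z, which [lipschitz_ball] bounds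
    by [64 * M / r * nrm h] on a ball of radius r / 4. Second derivatives do not enter. *)
Lemma diff_lipschitz F x r M h v : holo_ball F x r M -> nrm h < r / 4 ->
  nrm ('d F (x + h) v - 'd F x v) <= (64 * 64) * M / r ^+ 2 * nrm h * nrm v.
Proof.
move=> hF hh; have [r0 hd _] := hF.
have shift_d y : nrm (y - x) < r / 4 -> differentiable (fun z => F (z + h)) y /\
   'd (fun z => F (z + h)) y = 'd F (y + h) :> (V -> C).
  move=> hy; have dyh : differentiable F (y + h).
    by apply: hd; rewrite addrAC; apply: le_lt_trans (nrmD _ _) _; lra.
  have [dsh dshE] : differentiable (fun z : V => z + h) y /\
      'd (fun z : V => z + h) y = id :> (V -> V).
    apply: (@differentiable_intro R _ V V _ _ _ 1) => [//|k|e e0].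
      by rewrite mul1r.
    exists 1 => // k _.
    by rewrite addrAC (addrAC y) addrK subrr nrm0 mulr_ge0 ?nrm_ge0 // ltW.
  split; first exact: (differentiable_comp dsh dyh).
  rewrite (_ : (fun z => F (z + h)) = F \o (fun z : V => z + h)) // diff_comp //.
  by rewrite dshE.
have hG : holo_ball (fun z => F (z + h) - F z) x (r / 4) (64 * M / r * nrm h).
  split; first by rewrite divr_gt0.
    move=> y hy; apply: differentiableB; first exact: (proj1 (shift_d y hy)).
    by apply: hd; lra.
  move=> y hy; apply: (lipschitz_ball hF); first by lra.
  by rewrite addrAC; apply: le_lt_trans (nrmD _ _) _; lra.
have := cauchy_dir v hG.
have x0 : nrm (x - x) < r / 4 by rewrite subrr nrm0 divr_gt0.
have [dsx dsE] := shift_d x x0.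
rewrite (_ : (fun z => F (z + h) - F z) = (fun z => F (z + h)) - F) //.
have dx : differentiable F x by apply: hd; rewrite subrr nrm0.
rewrite (diffB dsx dx).
rewrite /= dsE => /le_trans; apply; rewrite le_eqVlt; apply/orP; left; apply/eqP.
by field; rewrite gt_eqF.
Qed.

Lemma taylor2 F x r M h : holo_ball F x r M -> nrm h < r / 4 ->
  nrm (F (x + h) - F x - 'd F x h) <= (2 * (64 * 64)) * M / r ^+ 2 * nrm h ^+ 2.
Proof.
move=> hF hh; have [r0 hd _] := hF; have M0 := holo_ball_ge0 hF.
have th (t : R) : 0 <= t <= 1 -> nrm (ofR t *: h) <= nrm h.
  move=> /andP[t0 t1]; rewrite nrmZ nrm_ofR ger0_norm //.
  by rewrite ler_piMl // nrm_ge0.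
have := @mvi R C (fun t => F (x + ofR t *: h) - 'd F x h * ofR t)
   (fun t => 'd F (x + ofR t *: h) h - 'd F x h * 1) ((64 * 64) * M / r ^+ 2 * nrm h ^+ 2).
rewrite rmorph1 rmorph0 scale1r scale0r addr0 mulr1 mulr0 subr0 addrAC.
have -> : (2 * (64 * 64)) * M / r ^+ 2 * nrm h ^+ 2 = 2 * ((64 * 64) * M / r ^+ 2 * nrm h ^+ 2).
  by rewrite !mulrA.
apply => t ht.
  apply: rderivD.
    apply: rderiv_line; apply: hd; rewrite addrAC subrr add0r.
    by apply: (le_lt_trans (th t ht)); have := nrm_ge0 h; lra.
  apply: rderivN; rewrite -[X in rderiv _ _ X]mulr1.
  by apply: rderivM; exact: rderiv_ofR.
rewrite expr2 mulrA; apply: le_trans (diff_lipschitz _ hF _) _.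
  exact: le_lt_trans (th t ht) hh.
rewrite ler_wpM2r ?nrm_ge0 // ler_wpM2l ?th //.
by rewrite !mulr_ge0 // invr_ge0 exprn_ge0 // ltW.
Qed.


Lemma holo_ball_at F x r M : holo_ball F x r M -> differentiable F x.
Proof. by case=> r0 hd _; apply: hd; rewrite subrr nrm0. Qed.

Lemma diff_sub (W : normedModType C) (F G : V -> W) x v :
  differentiable F x -> differentiable G x ->
  'd (fun z => F z - G z) x v = 'd F x v - 'd G x v.
Proof.
move=> dF dG; have -> : (fun z => F z - G z) = F - G by [].
by rewrite diffB.
Qed.

(** Weierstrass' theorem with a rate. By Cauchy's estimate the differentials of [Fn] at [x] converge
    geometrically; their limit is linear and bounded, and the remainder bound of [taylor2], which
    does not depend on n, passes to the limit. *)
Lemma holo_limit (Fn : nat -> V -> C) F x r M A :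
  (forall n, holo_ball (Fn n) x r M) ->
  (forall n y, nrm (y - x) < r -> nrm (F y - Fn n y) <= A * 2^-1 ^+ n) ->
  differentiable F x /\
  forall v n, nrm ('d F x v - 'd (Fn n) x v) <= 128 * A / r * nrm v * 2^-1 ^+ n.
Proof.
move=> hFn hA.
have [r0 _ _] := hFn 0%N; have M0 := holo_ball_ge0 (hFn 0%N).
have x0 : nrm (x - x) < r by rewrite subrr nrm0.
have A0 : 0 <= A.
  by have := le_trans (nrm_ge0 _) (hA 0%N x x0); rewrite expr0 mulr1.
have dFn n := holo_ball_at (hFn n).
have step v n : nrm ('d (Fn n.+1) x v - 'd (Fn n) x v) <= 32 * A / r * nrm v * 2^-1 ^+ n.
  have hd : holo_ball (fun y => Fn n.+1 y - Fn n y) x r (2 * A * 2^-1 ^+ n).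
    split=> // y hy.
      have [_ h1 _] := hFn n.+1; have [_ h2 _] := hFn n.
      by apply: differentiableB; [exact: h1|exact: h2].
    apply: le_trans (nrm_tri _ (F y) _) _; rewrite nrmBC.
    apply: le_trans (lerD (hA n.+1 y hy) (hA n y hy)) _.
    rewrite exprS; have : 0 <= A * 2^-1 ^+ n by rewrite mulr_ge0 // ltW // half_exp_gt0.
    lra.
  rewrite -diff_sub //; apply: le_trans (cauchy_dir v hd) _.
  by rewrite le_eqVlt; apply/orP; left; apply/eqP; field; rewrite gt_eqF.
have lim v : exists l, forall n, nrm (l - 'd (Fn n) x v) <= 4 * (32 * A / r * nrm v) * 2^-1 ^+ n.
  exact: (geometric_limit (step v)).
pose L v := sval (cid (lim v)).
have hL v n : nrm (L v - 'd (Fn n) x v) <= 128 * A / r * nrm v * 2^-1 ^+ n.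
  apply: le_trans (svalP (cid (lim v)) n) _.
  by rewrite le_eqVlt; apply/orP; left; apply/eqP; field; rewrite gt_eqF.
have linL : linear L.
  move=> c u v; apply/eqP; rewrite -subr_eq0; apply/eqP.
  apply: (@nrm_half_limit _ _ _ (128 * A / r * (nrm (c *: u + v) + nrm c * nrm u + nrm v))) => n.
  have -> : L (c *: u + v) - (c *: L u + L v) = (L (c *: u + v) - 'd (Fn n) x (c *: u + v))
     - (c *: (L u - 'd (Fn n) x u) + (L v - 'd (Fn n) x v)).
    have key (s s' a a' b b' : C) : s' = c * a' + b' ->
      s - (c * a + b) = s - s' - (c * (a - a') + (b - b')) by move=> ->; ring.
    by apply: key; exact: linearP.
  apply: le_trans (nrmB _ _) _; apply: le_trans (lerD (hL _ n) (nrmD _ _)) _.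
  rewrite nrmZ.
  have h1 := ler_wpM2l (nrm_ge0 c) (hL u n); have h2 := hL v n.
  apply: le_trans (lerD (lexx _) (lerD h1 h2)) _.
  by rewrite le_eqVlt; apply/orP; left; apply/eqP; ring.
have bL h : nrm (L h) <= (16 * M / r + 128 * A / r) * nrm h.
  rewrite -(subrK ('d (Fn 0%N) x h) (L h)) addrC; apply: le_trans (nrmD _ _) _.
  have := hL h 0%N; have := cauchy_dir h (hFn 0%N); rewrite expr0 mulr1 mulrDl; lra.
have taylorL h : nrm h < r / 4 ->
    nrm (F (x + h) - F x - L h) <= (2 * (64 * 64)) * M / r ^+ 2 * nrm h ^+ 2.
  move=> hh.
  apply: (@le_half_limit _ _ _ (A + A + 128 * A / r * nrm h)) => n.
  have hxh : nrm (x + h - x) < r.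
    by rewrite addrAC subrr add0r; have := nrm_ge0 h; lra.
  have -> : F (x + h) - F x - L h = (Fn n (x + h) - Fn n x - 'd (Fn n) x h)
     + ((F (x + h) - Fn n (x + h)) - (F x - Fn n x) - (L h - 'd (Fn n) x h)) by ring.
  apply: le_trans (nrmD _ _) _; rewrite lerD ?taylor2 //.
  apply: le_trans (nrmB _ _) _; apply: le_trans (lerD (nrmB _ _) (lexx _)) _.
  have := hA n _ hxh; have := hA n _ x0; have := hL h n.
  have E (a b p : R) : (a + a + b) * p = a * p + a * p + b * p by ring.
  move=> h1 h2 h3; rewrite E; exact: (lerD (lerD h3 h2) h1).
pose K := (2 * (64 * 64)) * M / r ^+ 2.
have torus_rate : 0 <= K by rewrite !mulr_ge0 // invr_ge0 exprn_ge0 // ltW.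
have [dF dFE] : differentiable F x /\ 'd F x = L :> (V -> C).
  apply: (differentiable_intro linL bL) => e e0.
  exists (Num.min (r / 4) (e / (K + 1))) => [|h].
    by rewrite lt_min !divr_gt0 //; lra.
  rewrite lt_min => /andP[h1 h2]; apply: le_trans (taylorL h h1) _.
  rewrite -/K expr2 mulrA ler_wpM2r ?nrm_ge0 //.
  have : nrm h * (K + 1) < e by rewrite -ltr_pdivlMr //; lra.
  by have := nrm_ge0 h; rewrite mulrDr mulr1 mulrC; lra.
by split => // v n; rewrite dFE.
Qed.

Definition holo F x := \forall y \near x, differentiable F y.

(** Continuity at [x] alone supplies the bound: near [x] the modulus stays below [nrm (F x) + 1]. *)
Lemma holoP F x : holo F x -> exists r M, holo_ball F x r M.
Proof.
move=> hF; have dx : differentiable F x by exact: nbhs_singleton hF.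
have [d d0 hd] := differentiable_eps dx ltr01.
move/nbhs_nrmP: hF => [r r0 hr].
have cv : \forall y \near x, nrm (F y) < nrm (F x) + 1.
  have /nbhs_nrmP [e e0 he] : \forall w \near F x, nrm w < nrm (F x) + 1.
    apply/nbhs_nrmP; exists 1 => // w hw.
    by rewrite -(subrK (F x) w); apply: le_lt_trans (nrmD _ _) _; lra.
  have /cvgrPdist_lt : {for x, continuous F} by exact: differentiable_continuous.
  move=> /(_ (ofR e)); rewrite -(rmorph0 (ofR : R -> C)) ltr_ofR => /(_ e0).
  apply: filterS => y; rewrite distrC normE ltr_ofR; exact: he.
move/nbhs_nrmP: cv => [s s0 hs].
exists (Num.min r s), (nrm (F x) + 1); split; first by rewrite lt_min r0.
  by move=> y; rewrite lt_min => /andP[h _]; exact: hr.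
by move=> y; rewrite lt_min => /andP[_ h]; apply: ltW; exact: hs.
Qed.

Lemma holo_ball_holo F x r M y : holo_ball F x r M -> nrm (y - x) < r -> holo F y.
Proof.
move=> [r0 hd _] hy; apply/nbhs_nrmP; exists (r - nrm (y - x)); first by rewrite subr_gt0.
by move=> z hz; apply: hd; apply: le_lt_trans (nrm_tri z y x) _; lra.
Qed.

Lemma diff_quotient F x r M y v n : holo_ball F x r M -> nrm (y - x) < r / 4 ->
  2^-1 ^+ n * nrm v < r / 8 ->
  nrm ('d F y v - ofR (2 ^+ n) * (F (y + ofR (2^-1 ^+ n) *: v) - F y)) <=
  (8 * (64 * 64)) * M / r ^+ 2 * nrm v ^+ 2 * 2^-1 ^+ n.
Proof.
move=> hF hy hv; have [r0 _ _] := hF.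
have hFy : holo_ball F y (r / 2) M by apply: holo_ballS hF; lra.
set h := ofR (2^-1 ^+ n) *: v.
have nh : nrm h = 2^-1 ^+ n * nrm v.
  by rewrite nrmZ nrm_ofR ger0_norm // ltW // half_exp_gt0.
have hh : nrm h < r / 2 / 4 by rewrite nh; lra.
have t2 := taylor2 hFy hh.
have two : ofR (2 ^+ n) * ofR (2^-1 ^+ n) = 1 :> C.
  by rewrite -rmorphM -exprMn divff ?expr1n ?rmorph1 // pnatr_eq0.
have -> : 'd F y v - ofR (2 ^+ n) * (F (y + h) - F y) =
   - (ofR (2 ^+ n) * (F (y + h) - F y - 'd F y h)).
  have e : 'd F y h = ofR (2^-1 ^+ n) * 'd F y v by exact: linearZ.
  have key (P Q D s t : C) : P * Q = 1 -> D - P * (s - t) = - (P * (s - t - Q * D)).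
    move=> PQ; have h2 : P * (Q * D) = D by rewrite mulrA PQ mul1r.
    by rewrite -{1}h2; ring.
  by rewrite e; exact: key.
rewrite nrmN nrmM nrm_ofR ger0_norm; last by rewrite exprn_ge0.
apply: le_trans (ler_wpM2l _ t2) _; first by rewrite exprn_ge0.
have e1 : 2 ^+ n * 2^-1 ^+ n = 1 :> R by rewrite -exprMn divff ?expr1n // pnatr_eq0.
rewrite nh; move: (nrm v) (2 ^+ n) (2^-1 ^+ n) e1 => w P Q e1.
have -> : P * (2 * (64 * 64) * M / (r / 2) ^+ 2 * (Q * w) ^+ 2) =
   (P * Q) * (8 * (64 * 64) * M / r ^+ 2 * w ^+ 2 * Q) by field; rewrite gt_eqF.
by rewrite e1 mul1r.
Qed.

Lemma diff_shift F y h : differentiable F (y + h) ->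
  differentiable (fun z => F (z + h)) y /\
  'd (fun z => F (z + h)) y = 'd F (y + h) :> (V -> C).
Proof.
move=> dyh.
have [dsh dshE] : differentiable (fun z : V => z + h) y /\
    'd (fun z : V => z + h) y = id :> (V -> V).
  apply: (@differentiable_intro R _ V V _ _ _ 1) => [//|k|e e0].
    by rewrite mul1r.
  exists 1 => // k _.
  by rewrite addrAC (addrAC y) addrK subrr nrm0 mulr_ge0 ?nrm_ge0 // ltW.
split; first exact: (differentiable_comp dsh dyh).
rewrite (_ : (fun z => F (z + h)) = F \o (fun z : V => z + h)) // diff_comp //.
by rewrite dshE.
Qed.

(** The directional derivative is a limit of difference quotients with steps 2^-N, which converge
    geometrically, so [holo_limit] applies. The second part keeps the rate for [diff_sym]; the index
    N exceeds n because the step must first fit into the ball. *)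
Lemma holo_ball_derive F x r M v : holo_ball F x r M ->
  differentiable (fun y => 'd F y v) x /\
  forall u, exists B, forall n, exists2 N, (n <= N)%N &
    nrm ('d (fun y => 'd F y v) x u -
     ofR (2 ^+ N) * ('d F (x + ofR (2^-1 ^+ N) *: v) u - 'd F x u)) <= B * 2^-1 ^+ n.
Proof.
move=> hF; have [r0 hd _] := hF; have M0 := holo_ball_ge0 hF.
have [N0 hN0] := @exp_half_small R (nrm v) (r / 8) ltac:(lra).
pose Fn n y := ofR (2 ^+ (n + N0)) * (F (y + ofR (2^-1 ^+ (n + N0)) *: v) - F y).
have hv n : 2^-1 ^+ (n + N0) * nrm v < r / 8 by rewrite mulrC; apply: hN0; rewrite leq_addl.
have nv n : nrm (ofR (2^-1 ^+ (n + N0)) *: v) < r / 8.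
  by rewrite nrmZ nrm_ofR ger0_norm ?hv // ltW // half_exp_gt0.
have inb y n : nrm (y - x) < r / 4 -> nrm (y + ofR (2^-1 ^+ (n + N0)) *: v - x) < r / 2.
  by move=> hy; rewrite addrAC; apply: le_lt_trans (nrmD _ _) _; have := nv n; lra.
pose K := (8 * (64 * 64)) * M / r ^+ 2 * nrm v ^+ 2.
have torus_rate : 0 <= K.
  rewrite /K; apply: mulr_ge0; last exact: sqr_ge0.
  by apply: divr_ge0; [exact: mulr_ge0|rewrite exprn_ge0 // ltW].
have dq n y : nrm (y - x) < r / 4 -> nrm ('d F y v - Fn n y) <= K * 2^-1 ^+ n.
  move=> hy; apply: le_trans (diff_quotient hF hy (hv n)) _.
  rewrite ler_wpM2l // exprD ler_piMr ?half_exp_le1 //.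
have dFsh y n : nrm (y - x) < r / 4 -> differentiable F (y + ofR (2^-1 ^+ (n + N0)) *: v).
  by move=> hy; apply: hd; have := inb y n hy; lra.
have dFy y : nrm (y - x) < r / 4 -> differentiable F y by move=> hy; apply: hd; lra.
have dFnE n y u : nrm (y - x) < r / 4 -> differentiable (Fn n) y /\
   'd (Fn n) y u = ofR (2 ^+ (n + N0)) * ('d F (y + ofR (2^-1 ^+ (n + N0)) *: v) u - 'd F y u).
  move=> hy; have [d1 e1] := diff_shift (dFsh y n hy); have d2 := dFy y hy.
  have d3 : differentiable (fun z => F (z + ofR (2^-1 ^+ (n + N0)) *: v) - F z) y.
    exact: (differentiableB d1 d2).
  split; first exact: (@differentiableZ _ _ _ _ (ofR (2 ^+ (n + N0))) _ d3).
  have := @diffZ _ _ _ _ (ofR (2 ^+ (n + N0))) _ d3.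
  move=> /(congr1 (fun g => g u)) /= => E.
  have -> : 'd (Fn n) y u = ofR (2 ^+ (n + N0)) *: 'd (fun z => F (z + ofR (2^-1 ^+ (n + N0)) *: v) - F z) y u.
    exact: E.
  exact: (congr1 (fun c => ofR (2 ^+ (n + N0)) * c)
    (etrans (diff_sub u d1 d2) (congr1 (fun g : V -> C => g u - 'd F y u) e1))).
pose MM := 16 * M / (3 * r / 4) * nrm v + K.
have hFn n : holo_ball (Fn n) x (r / 4) MM.
  split; first by lra.
    by move=> y hy; exact: (proj1 (dFnE n y 0 hy)).
  move=> y hy; rewrite -(subrK ('d F y v) (Fn n y)).
  apply: le_trans (nrmD _ _) _; rewrite nrmBC addrC; apply: lerD.
    by apply: cauchy_dir; apply: holo_ballS hF; lra.
  by apply: le_trans (dq n y hy) _; rewrite ler_piMr // half_exp_le1.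
have [dG hG] := holo_limit hFn (fun n y hy => dq n y hy).
split => // u.
exists (128 * K / (r / 4) * nrm u) => n; exists (n + N0)%N; first by rewrite leq_addr.
have x0 : nrm (x - x) < r / 4 by rewrite subrr nrm0; lra.
exact: (eq_ind _ (fun c => nrm ('d (fun y => 'd F y v) x u - c) <= _) (hG u n) _
  (proj2 (dFnE n x u x0))).
Qed.

Lemma holo_derive F x v : holo F x -> holo (fun y => 'd F y v) x.
Proof.
move=> /holoP[r [M hF]]; have [r0 _ _] := hF.
apply/nbhs_nrmP; exists (r / 2); first by lra.
move=> y hy; apply: (proj1 (@holo_ball_derive F y (r / 2) M v _)).
by apply: holo_ballS hF; lra.
Qed.

(** Both sides are limits of 2^N (dF(x + 2^-N v) u - dF(x) u): the left one by [holo_ball_derive],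
    the right one because y |-> dF(y) u is differentiable at [x]. *)
Lemma diff_sym F x u v : holo F x ->
  'd (fun y => 'd F y v) x u = 'd (fun y => 'd F y u) x v.
Proof.
move=> /holoP[r [M hF]].
have [_ /(_ u) [B hB]] := holo_ball_derive v hF.
have [dG _] := holo_ball_derive u hF.
apply/eqP; rewrite -subr_eq0; apply/eqP; apply: nrm_eq0; apply: le_anti.
rewrite nrm_ge0 andbT; apply/ler_addgt0Pl => e e0; rewrite addr0.
have v1 : 0 < 2 * (nrm v + 1) by have := nrm_ge0 v; lra.
have [d d0 hd] := differentiable_eps dG (divr_gt0 e0 v1).
have [N1 hN1] := @exp_half_small R (nrm v) d d0.
have [N2 hN2] := @exp_half_small R B (e / 2) ltac:(lra).
have [N hN hq] := hB (maxn N1 N2).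
apply: le_trans (nrm_tri _ _ _) _.
have -> : e = e / 2 + e / 2 by field.
apply: lerD; first by apply: le_trans hq _; apply: ltW; apply: hN2; rewrite leq_maxr.
set h := ofR (2^-1 ^+ N) *: v.
have nh : nrm h = 2^-1 ^+ N * nrm v.
  by rewrite nrmZ nrm_ofR ger0_norm // ltW // half_exp_gt0.
have hh : nrm h < d.
  by rewrite nh mulrC; apply: hN1; rewrite (leq_trans _ hN) // leq_maxl.
have two : ofR (2 ^+ N) * ofR (2^-1 ^+ N) = 1 :> C.
  by rewrite -rmorphM -exprMn divff ?expr1n ?rmorph1 // pnatr_eq0.
have E : 'd (fun y => 'd F y u) x h = ofR (2^-1 ^+ N) * 'd (fun y => 'd F y u) x v by exact: linearZ.
have key (P Q D s : C) : P * Q = 1 -> P * s - D = P * (s - Q * D).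
  by move=> PQ; rewrite mulrBr mulrA PQ mul1r.
rewrite (key _ _ _ _ two) -E nrmM nrm_ofR ger0_norm ?exprn_ge0 //.
apply: le_trans (ler_wpM2l _ (hd h hh)) _; first by rewrite exprn_ge0.
rewrite nh.
have e1 : 2 ^+ N * 2^-1 ^+ N = 1 :> R by rewrite -exprMn divff ?expr1n // pnatr_eq0.
have -> : 2 ^+ N * (e / (2 * (nrm v + 1)) * (2^-1 ^+ N * nrm v)) =
   (2 ^+ N * 2^-1 ^+ N) * (e / (2 * (nrm v + 1)) * nrm v) by ring.
rewrite e1 mul1r mulrAC ler_pdivrMr //.
by have -> : e / 2 * (2 * (nrm v + 1)) = e * nrm v + e by [field]; rewrite lerDl ltW.
Qed.

End Frechet.

(** * The transport equation with exponential decay *)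

Section ExpDecay.
Context {R : realType}.

Lemma expRN_half n : expR (- n%:R) <= (2^-1 : R) ^+ n.
Proof.
rewrite -mulrN1 expRM_natl lerXn2r ?nnegrE ?expR_ge0 ?invr_ge0 //.
rewrite expRN lef_pV2 ?posrE ?expR_gt0 //.
by apply: le_trans (expR_ge1Dx _); rewrite -natr1 addrC.
Qed.

Lemma is_derive_expM (a t : R) :
  is_derive t 1 (fun s : R => expR (- a * s)) (- a * expR (- a * t)).
Proof.
have h : is_derive t 1 (fun s : R => - a * s) (- a).
  by apply: is_derive_eq; rewrite /GRing.scale /= mulr1.
have := @is_derive1_comp R expR (fun s : R => - a * s) t _ _ (is_derive_expR _) h.
by rewrite mulrC.
Qed.

(** g + (K / a) e^(-a t) is nonincreasing and is asymptotically nonnegative. The bound [B] serves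
    only to know this at infinity, which is why it disappears from the conclusion. *)
Lemma decay_lower (g g' : R -> R) (a K B : R) : 0 < a -> 0 <= K ->
  (forall t : R, 0 <= t -> is_derive t 1 g (g' t)) ->
  (forall t : R, 0 <= t -> g' t <= K * expR (- a * t)) ->
  (forall t : R, 0 <= t -> - (B * expR (- a * t)) <= g t) ->
  - (K / a) <= g 0.
Proof.
move=> a0 torus_rate dg hg' hg.
apply: (@le_half_limit _ _ _ `|B|) => n.
pose f t := g t + K / a * expR (- a * t).
have df (t : R) : 0 <= t -> is_derive t 1 f (g' t - K * expR (- a * t)).
  move=> t0; have h1 := dg t t0; have h2 := is_derive_expM a t.
  apply: is_derive_eq; rewrite /GRing.scale /=.
  by field; rewrite gt_eqF.
have T0 : 0 <= n%:R / a :> R by rewrite divr_ge0 // ltW.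
have : f (n%:R / a) <= f 0.
  apply: (@ler0_derive1_nincr _ f 0 (n%:R / a)) => //.
  - move=> t; rewrite in_itv /= => /andP[/ltW t0 _].
    by have := df t t0 => h; exact: ex_derive.
  - move=> t; rewrite in_itv /= => /andP[/ltW t0 _].
    have h := df t t0; rewrite derive1E derive_val subr_le0; exact: hg'.
  apply: rcont_within => t /andP[t0 _].
  by apply: differentiable_continuous; apply/derivable1_diffP; have h := df t t0; exact: ex_derive.
rewrite /f mulr0 expR0 mulr1 => h.
have h2 := hg _ T0.
have aE : - a * (n%:R / a) = - n%:R by field; rewrite gt_eqF.
rewrite aE in h h2.
have e0 := expR_gt0 (- n%:R : R); have e1 := expRN_half n.
have p1 : 0 <= K / a * expR (- n%:R) by rewrite mulr_ge0 ?expR_ge0 // divr_ge0 // ltW.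
have p2 : B * expR (- n%:R) <= `|B| * 2^-1 ^+ n.
  apply: le_trans (ler_wpM2r (ltW e0) (ler_norm B)) _.
  by rewrite ler_wpM2l.
lra.
Qed.

Lemma decay_real (g g' : R -> R) (a K B : R) : 0 < a -> 0 <= K ->
  (forall t : R, 0 <= t -> is_derive t 1 g (g' t)) ->
  (forall t : R, 0 <= t -> `|g' t| <= K * expR (- a * t)) ->
  (forall t : R, 0 <= t -> `|g t| <= B * expR (- a * t)) ->
  `|g 0| <= K / a.
Proof.
move=> a0 torus_rate dg hg' hg; rewrite ler_norml; apply/andP; split.
  apply: (@decay_lower g g' a K B) => // t t0.
    by apply: le_trans (ler_norm _) (hg' t t0).
  by have := hg t t0; rewrite ler_norml => /andP[].
have : - (K / a) <= - g 0; last by rewrite lerN2.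
apply: (@decay_lower (fun t => - g t) (fun t => - g' t) a K B) => // t t0.
- by have h := dg t t0; exact: is_deriveN.
- by apply: le_trans (ler_norm _) _; rewrite normrN; exact: hg'.
- by have := hg t t0; rewrite ler_norml lerN2 => /andP[].
Qed.

End ExpDecay.

Section Transport.
Context {R : realType} {C : cxType R} {V : normedModType C}.
Context (w : V) (xr : V -> R) (U : set V) (a : R).
Hypothesis a_gt0 : 0 < a.
Hypothesis xr_w : forall z s, xr (z + ofR s *: w) = xr z + s.
Hypothesis xr_lip : forall y z, `|xr y - xr z| <= nrm (y - z).
Hypothesis U_w : forall z (s : R), U z -> 0 <= s -> U (z + ofR s *: w).
Hypothesis U_open : forall z, U z -> exists2 r : R, 0 < r & forall y, nrm (y - z) < r -> U y.
Implicit Types (F G : V -> C) (z : V) (M : R).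

(** [xr] stands for Re xi. Moving by s along [w] multiplies the weight by e^(-a s), which makes
    decay stable under integration along rays. *)
Definition decays M F := forall z, U z -> nrm (F z) <= M * expR (- a * xr z).
Definition holoU F := forall z, U z -> differentiable F z.

Lemma holoU_holo F z : holoU F -> U z -> holo F z.
Proof.
move=> hF /U_open[r r0 hr]; apply/nbhs_nrmP; exists r => // y hy.
exact/hF/hr.
Qed.

Lemma decays_shift M F z s : decays M F -> U z -> 0 <= s ->
  nrm (F (z + ofR s *: w)) <= M * expR (- a * xr z) * expR (- a * s).
Proof.
move=> hF Uz s0; apply: le_trans (hF _ (U_w Uz s0)) _.
by rewrite xr_w mulrDr expRD mulrA.
Qed.

Lemma ray_deriv F z s : holoU F -> U z -> 0 <= s ->
  rderiv (fun t => F (z + ofR t *: w)) s ('d F (z + ofR s *: w) w).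
Proof. by move=> hF Uz s0; apply: rderiv_line; apply: hF; exact: U_w. Qed.

(** Any decay of [G], however large [B], improves to a constant governed by the right-hand side:
    [decay_real] on each ray, once for the real and once for the imaginary part. This gives
    uniqueness, the contraction of the iteration and clean constants. *)
Lemma transport_apriori G M B : 0 <= M -> holoU G -> decays B G ->
  (forall z, U z -> nrm ('d G z w) <= M * expR (- a * xr z)) ->
  decays (2 * (M / a)) G.
Proof.
move=> M0 hG hB hM z Uz.
pose g (t : R) := G (z + ofR t *: w).
have g0 : g 0 = G z by rewrite /g rmorph0 scale0r addr0.
have torus_rate : 0 <= M * expR (- a * xr z) by rewrite mulr_ge0 // expR_ge0.
have e1 : 2 * (M / a) * expR (- a * xr z) = 2 * (M * expR (- a * xr z) / a) by ring.
rewrite e1 -g0; apply: nrm_le_max.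
  apply: (@decay_real _ (fun t => cre (g t)) (fun t => cre ('d G (z + ofR t *: w) w)) a _
    (B * expR (- a * xr z))) => // t t0.
  - by have [] := ray_deriv hG Uz t0.
  - apply: le_trans (cre_le _) _; apply: le_trans (hM _ (U_w Uz t0)) _.
    by rewrite xr_w mulrDr expRD mulrA.
  - by apply: le_trans (cre_le _) _; exact: decays_shift.
apply: (@decay_real _ (fun t => cim (g t)) (fun t => cim ('d G (z + ofR t *: w) w)) a _
  (B * expR (- a * xr z))) => // t t0.
- by have [] := ray_deriv hG Uz t0.
- apply: le_trans (cim_le _) _; apply: le_trans (hM _ (U_w Uz t0)) _.
  by rewrite xr_w mulrDr expRD mulrA.
- by apply: le_trans (cim_le _) _; exact: decays_shift.
Qed.

Lemma transport_unique G B : holoU G -> decays B G ->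
  (forall z, U z -> 'd G z w = 0) -> forall z, U z -> G z = 0.
Proof.
move=> hG hB hw z Uz; apply: nrm_eq0; apply: le_anti; rewrite nrm_ge0 andbT.
have := @transport_apriori G 0 B (lexx _) hG hB _ z Uz.
by rewrite !(mul0r, mulr0); apply => y Uy; rewrite hw // nrm0 mul0r.
Qed.

Definition ray_int F (T : R) z := cint 0 T (fun s => F (z + ofR s *: w)).

Lemma ball_ray z r s : 0 <= s -> (forall y, nrm (y - z) < r -> U y) ->
  forall y, nrm (y - (z + ofR s *: w)) < r -> U y.
Proof.
move=> s0 hr y hy; rewrite -(subrK (ofR s *: w) y); apply: U_w => //.
by apply: hr; rewrite -addrA -opprD [_ *: _ + z]addrC.
Qed.

Lemma ray_cont F z s : holoU F -> U z -> 0 <= s -> rcont (fun s => F (z + ofR s *: w)) s.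
Proof. by move=> hF Uz s0; apply: rderiv_cont; exact: ray_deriv. Qed.

Lemma holoU_derive F v : holoU F -> holoU (fun z => 'd F z v).
Proof. by move=> hF z Uz; exact: (nbhs_singleton (holo_derive v (holoU_holo hF Uz))). Qed.

(** One radius and one bound for all points of the ray: the Taylor remainder is then uniform in s,
    which justifies differentiation under the integral sign. *)
Lemma ray_ball F M z r : holoU F -> decays M F -> 0 <= M -> 0 < r ->
  (forall y, nrm (y - z) < r -> U y) -> forall s, 0 <= s ->
  holo_ball F (z + ofR s *: w) r (M * expR (- a * (xr z - r))).
Proof.
move=> hF hM M0 r0 hr s s0; split=> // y hy.
  by apply: hF; exact: (ball_ray s0 hr hy).
have Uy := ball_ray s0 hr hy.
apply: le_trans (hM y Uy) _; rewrite ler_wpM2l // ler_expR !mulNr lerN2 ler_wpM2l ?ltW //.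
have := xr_lip y (z + ofR s *: w); rewrite xr_w ler_norml => /andP[h _]; lra.
Qed.

Lemma ray_int_diff F M T z : 0 <= M -> 0 <= T -> holoU F -> decays M F -> U z ->
  differentiable (ray_int F T) z /\
  forall h, 'd (ray_int F T) z h = cint 0 T (fun s => 'd F (z + ofR s *: w) h).
Proof.
move=> M0 T0 hF hM Uz; have [r r0 hr] := U_open Uz.
pose N := M * expR (- a * (xr z - r)).
have N0 : 0 <= N by rewrite mulr_ge0 // expR_ge0.
have hb s : 0 <= s -> holo_ball F (z + ofR s *: w) r N by exact: ray_ball.
have ge0 (t : R) : 0 <= t <= T -> 0 <= t by case/andP.
have cF' h (t : R) : 0 <= t <= T -> rcont (fun s => 'd F (z + ofR s *: w) h) t.
  by move=> /ge0 t0; exact: (@ray_cont (fun z => 'd F z h) z t (holoU_derive h hF) Uz t0).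
suff [] : differentiable (ray_int F T) z /\
    'd (ray_int F T) z = (fun h => cint 0 T (fun s => 'd F (z + ofR s *: w) h)) :> (V -> C).
  by move=> h1 h2; split=> // h; rewrite h2.
apply: (@differentiable_intro _ _ _ _ _ _ _ (2 * (16 * N / r * T))).
- move=> c u v.
  transitivity (c * cint 0 T (fun s => 'd F (z + ofR s *: w) u) +
    cint 0 T (fun s => 'd F (z + ofR s *: w) v)); last by [].
  rewrite -cintM; last exact: cF'.
  rewrite -cintD; [|by move=> t ht; apply: rcontM; exact: cF'|exact: cF'].
  by apply: eq_cint => t _; exact: linearP.
- move=> h; apply: le_trans (@cint_bound _ _ _ _ _ (16 * N / r * nrm h) T0 (cF' h) _) _.
    by move=> t /ge0 t0; apply: cauchy_dir; exact: hb.
  by rewrite subr0 le_eqVlt; apply/orP; left; apply/eqP; ring.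
move=> e e0; pose K := (2 * (64 * 64)) * N / r ^+ 2.
have torus_rate : 0 <= K.
  by apply: divr_ge0; [rewrite mulr_ge0|rewrite exprn_ge0 // ltW].
exists (Num.min (r / 4) (e / (2 * (K * T) + 1))) => [|h].
  have : 0 <= K * T by rewrite mulr_ge0.
  move: (K * T) => kt kt0; rewrite lt_min; apply/andP; split; first by lra.
  by apply: divr_gt0 => //; lra.
rewrite lt_min => /andP[h1 h2].
have inr (t : R) : 0 <= t -> rcont (fun s => F (z + h + ofR s *: w)) t.
  move=> t0; apply: ray_cont => //; apply: hr; rewrite addrAC subrr add0r; lra.
have c1 (t : R) : 0 <= t <= T -> rcont (fun s => F (z + h + ofR s *: w)) t by move=> /ge0; exact: inr.
have c2 (t : R) : 0 <= t <= T -> rcont (fun s => F (z + ofR s *: w)) t.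
  by move=> /ge0 t0; exact: ray_cont.
have c3 (t : R) : 0 <= t <= T -> rcont (fun s => F (z + h + ofR s *: w) - F (z + ofR s *: w)) t.
  by move=> ht; apply: rcontD; [exact: c1|apply: rcontN; exact: c2].
rewrite /ray_int -cintB // -cintB //; last exact: cF'.
apply: le_trans (@cint_bound _ _ _ _ _ (K * nrm h ^+ 2) T0 _ _) _.
- by move=> t ht; apply: rcontD; [exact: c3|apply: rcontN; exact: cF'].
- by move=> t /ge0 t0; rewrite (addrAC z h); apply: taylor2 => //; exact: hb.
rewrite subr0 expr2.
have -> : 2 * (K * (nrm h * nrm h) * T) = (2 * (K * T) * nrm h) * nrm h by ring.
rewrite ler_wpM2r ?nrm_ge0 //.
have KT : 0 <= K * T by rewrite mulr_ge0.
have : nrm h * (2 * (K * T) + 1) < e by rewrite -ltr_pdivlMr //; lra.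
have := nrm_ge0 h; rewrite mulrDr mulr1 => hh1 hh2.
have -> : 2 * (K * T) * nrm h = nrm h * (2 * (K * T)) by ring.
lra.
Qed.

(** [G] is the integral of [F] over the whole ray, obtained as a limit of truncations. By the
    fundamental theorem the truncation at T has w-derivative F (z + T w) - F z, whose first term
    decays. *)
Lemma transport_exists F M : 0 <= M -> holoU F -> decays M F ->
  exists G, [/\ holoU G, (forall z, U z -> 'd G z w = - F z) & decays (2 * (M / a)) G].
Proof.
move=> M0 hF hM.
(* Each further stretch of length 1 / a gains a factor e^-1 <= 1 / 2, the rate required by
   [geometric_limit] and [holo_limit]. *)
pose T n : R := n%:R / a.
have T0 n : 0 <= T n by rewrite divr_ge0 // ltW.
pose N z := M * expR (- a * xr z).
have N0 z : 0 <= N z by rewrite mulr_ge0 // expR_ge0.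
have expT n : expR (- a * T n) <= 2^-1 ^+ n.
  have -> : - a * T n = - n%:R by rewrite /T; field; rewrite gt_eqF.
  exact: expRN_half.
have step z n : U z -> nrm (ray_int F (T n.+1) z - ray_int F (T n) z) <= 2 * (N z / a) * 2^-1 ^+ n.
  move=> Uz.
  have TT : T n <= T n.+1 by rewrite /T ler_pM2r ?invr_gt0 // ler_nat.
  rewrite /ray_int (@cint_split _ _ 0 (T n) (T n.+1)) //; last first.
    by move=> t /andP[t0 _]; exact: ray_cont.
  rewrite addrAC subrr add0r.
  apply: le_trans (@cint_bound _ _ _ _ _ (N z * 2^-1 ^+ n) TT _ _) _.
  - by move=> t /andP[t0 _]; apply: ray_cont => //; exact: le_trans (T0 n) t0.
  - move=> t /andP[t0 _]; have t1 : 0 <= t by exact: le_trans (T0 n) t0.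
    apply: le_trans (decays_shift hM Uz t1) _; apply: ler_wpM2l; first exact: N0.
    apply: le_trans (expT n); rewrite ler_expR !mulNr lerN2 ler_wpM2l // ltW //.
  - have -> : T n.+1 - T n = a^-1 by rewrite /T -mulrBl -natr1 addrAC subrr add0r mul1r.
    by rewrite le_eqVlt; apply/orP; left; apply/eqP; ring.
have lim z : exists l, U z -> forall n, nrm (l - ray_int F (T n) z) <= 4 * (2 * (N z / a)) * 2^-1 ^+ n.
  have [Uz|nUz] := pselect (U z); last by exists 0.
  by have [l hl] := geometric_limit (fun n => step z n Uz); exists l.
pose G z := sval (cid (lim z)).
have hG z n : U z -> nrm (G z - ray_int F (T n) z) <= 8 * (N z / a) * 2^-1 ^+ n.
  move=> Uz; apply: le_trans (svalP (cid (lim z)) Uz n) _.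
  by rewrite le_eqVlt; apply/orP; left; apply/eqP; ring.
have S0 z : ray_int F (T 0%N) z = 0.
  rewrite /ray_int /T mul0r; apply: complex_ext; rewrite /cint ?cre_cpl ?cim_cpl ?cre0 ?cim0;
  by rewrite set_itv1 Rintegral_set1.
have Gb z : U z -> nrm (G z) <= 8 * (N z / a).
  by move=> Uz; have := hG z 0%N Uz; rewrite S0 subr0 expr0 mulr1.
have main z : U z -> differentiable G z /\ 'd G z w = - F z.
  move=> Uz; have [r r0 hr] := U_open Uz.
  pose N1 := M * expR (- a * (xr z - r)).
  have NN1 y : nrm (y - z) < r -> N y <= N1.
    move=> hy; rewrite /N /N1 ler_wpM2l // ler_expR !mulNr lerN2 ler_wpM2l ?ltW //.
    by have := xr_lip y z; rewrite ler_norml => /andP[]; lra.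
  have NN1a y : nrm (y - z) < r -> 8 * (N y / a) <= 8 * (N1 / a).
    by move=> /NN1 h; rewrite ler_pM2l // ler_pM2r ?invr_gt0.
  have hb n : holo_ball (ray_int F (T n)) z r (8 * (N1 / a) + 8 * (N1 / a)).
    split => // y hy; have Uy := hr y hy.
      by have [] := ray_int_diff M0 (T0 n) hF hM Uy.
    rewrite -(subrK (G y) (ray_int F (T n) y)); apply: le_trans (nrmD _ _) _.
    apply: lerD; last exact: le_trans (Gb y Uy) (NN1a y hy).
    rewrite nrmBC; apply: le_trans (hG y n Uy) _.
    apply: le_trans (NN1a y hy); rewrite ler_piMr ?half_exp_le1 //.
    by rewrite mulr_ge0 // divr_ge0 // ltW.
  have hl n y : nrm (y - z) < r -> nrm (G y - ray_int F (T n) y) <= 8 * (N1 / a) * 2^-1 ^+ n.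
    move=> hy; apply: le_trans (hG y n (hr y hy)) _.
    by rewrite ler_wpM2r ?NN1a // ltW // half_exp_gt0.
  have [dG dGE] := holo_limit hb hl; split => //.
  apply/eqP; rewrite -subr_eq0 opprK; apply/eqP.
  apply: (@nrm_half_limit _ _ _ (128 * (8 * (N1 / a)) / r * nrm w + N z)) => n.
  have [_ /(_ w) dS] := ray_int_diff M0 (T0 n) hF hM Uz.
  have dSE : 'd (ray_int F (T n)) z w = F (z + ofR (T n) *: w) - F z.
    rewrite dS (@cint_FTC _ _ _ _ _ (fun s => F (z + ofR s *: w))) //.
    - by rewrite rmorph0 scale0r addr0.
    - by move=> t /andP[t0 _]; exact: (@ray_cont (fun z => 'd F z w) z t (holoU_derive w hF) Uz t0).
    - by move=> t /andP[t0 _]; exact: ray_deriv.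
  have -> : 'd G z w + F z = ('d G z w - 'd (ray_int F (T n)) z w) + F (z + ofR (T n) *: w).
    by rewrite dSE; ring.
  apply: le_trans (nrmD _ _) _; rewrite [leRHS]mulrDl; apply: lerD; first exact: dGE.
  by apply: le_trans (decays_shift hM Uz (T0 n)) _; apply: ler_wpM2l; [exact: N0|exact: expT].
exists G; split; first by move=> z /main[].
  by move=> z /main[].
(* The limit process only gives the constant 8; the a priori bound lowers it to 2. *)
apply: (@transport_apriori G M (8 * (M / a))) => //.
- by move=> z /main[].
- by move=> z /Gb; rewrite /N mulrA; congr (_ <= _); ring.
- by move=> z Uz; rewrite (proj2 (main z Uz)) nrmN; exact: hM.
Qed.

(** Picard iteration for D_w v = Phi (z, v) among decaying functions. Along each ray this is an
    ordinary differential equation with data at infinity. [k] bounds both the source Phi (z, 0) and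
    the Lipschitz constant, [rho] is the radius in which [Phi] is under control, and [Per] holds the
    translations under which [Phi] is invariant. *)
Lemma asymptotic_solution (I : Type) (Phi : I -> V -> (I -> C) -> C)
    (Per : V -> Prop) (k E0 rho : R) :
  0 <= k -> 8 * k <= a -> 4 * k / a * E0 <= rho ->
  (forall z, U z -> expR (- a * xr z) <= E0) ->
  (forall t z, Per t -> U z -> [/\ U (z + t), xr (z + t) = xr z &
     forall l u, (forall i, nrm (u i) <= rho) -> Phi l (z + t) u = Phi l z u]) ->
  (forall v : I -> V -> C, (forall i, holoU (v i)) ->
     (forall i z, U z -> nrm (v i z) <= rho) ->
     forall l, holoU (fun z => Phi l z (fun i => v i z))) ->
  (forall l z, U z -> nrm (Phi l z (fun=> 0)) <= k * expR (- a * xr z)) ->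
  (forall l z (u u' : I -> C) d, U z -> (forall i, nrm (u i) <= rho) ->
     (forall i, nrm (u' i) <= rho) -> (forall i, nrm (u i - u' i) <= d) ->
     nrm (Phi l z u - Phi l z u') <= k * d) ->
  exists v : I -> V -> C, forall i, [/\ holoU (v i), decays (4 * k / a) (v i),
    (forall z, U z -> 'd (v i) z w = Phi i z (fun j => v j z)) &
    forall t z, Per t -> U z -> v i (z + t) = v i z].
Proof.
move=> k0 ka kr hE hPer hPhi h0 hL.
(* The constant closes up: [B <= 1] gives a right-hand side of size [2 * k], and solving the
   transport equation gives back [2 * (2 * k / a) = B]. *)
set B := 4 * k / a in kr *.
have B0 : 0 <= B by rewrite divr_ge0 ?mulr_ge0 // ltW.
have Bh : B <= 1 by rewrite /B ler_pdivrMr // mul1r; lra.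
have e_ge0 z : 0 <= expR (- a * xr z) by exact: expR_ge0.
pose good (v : I -> V -> C) := forall i, [/\ holoU (v i), decays B (v i) &
    forall t z, Per t -> U z -> v i (z + t) = v i z].
have rng v i z : good v -> U z -> nrm (v i z) <= rho.
  move=> gv Uz; have [_ h _] := gv i; apply: le_trans (h z Uz) _.
  by apply: le_trans kr; rewrite ler_wpM2l // hE.
have rho0 z : U z -> 0 <= rho.
  by move=> Uz; apply: le_trans kr; rewrite mulr_ge0 // (le_trans (e_ge0 z)) // hE.
have Phib v l : good v -> decays (2 * k) (fun z => Phi l z (fun i => v i z)).
  move=> gv z Uz.
  rewrite -(subrK (Phi l z (fun=> 0)) (Phi l z _)); apply: le_trans (nrmD _ _) _.
  have -> : 2 * k * expR (- a * xr z) = k * expR (- a * xr z) + k * expR (- a * xr z) by ring.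
  apply: lerD; last exact: h0.
  apply: (hL l z _ _ _ Uz).
  - by move=> i; exact: rng.
  - by move=> i; rewrite nrm0; exact: (rho0 z).
  move=> i; rewrite subr0; have [_ h _] := gv i; apply: le_trans (h z Uz) _.
  by rewrite ler_piMl.
have hPhiG v l : good v -> holoU (fun z => Phi l z (fun i => v i z)).
  by move=> gv; apply: hPhi => [i|i z Uz]; [have [] := gv i|exact: rng].
have step (v : {v | good v}) : {v' : {v | good v} | forall i z, U z ->
    'd (sval v' i) z w = Phi i z (fun j => sval v j z)}.
  apply: cid; case: v => v gv /=.
  have ex i : exists G, [/\ holoU G,
      (forall z, U z -> 'd G z w = Phi i z (fun j => v j z)) & decays B G].
    have hN : holoU (fun z => - Phi i z (fun j => v j z)).
      by move=> z Uz; exact: (differentiableN (hPhiG v i gv z Uz)).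
    have hM : decays (2 * k) (fun z => - Phi i z (fun j => v j z)).
      by move=> z Uz; rewrite nrmN; exact: Phib.
    have k2 : 0 <= 2 * k by rewrite mulr_ge0.
    have [G [G1 G2 G3]] := transport_exists k2 hN hM.
    exists G; split=> //; first by move=> z Uz; rewrite G2 // opprK.
    by have <- : 2 * (2 * k / a) = B by rewrite /B; ring.
  have [v' hv'] := choice ex.
  have gv' : good v'.
    move=> i; have [G1 G2 G3] := hv' i; split=> // t z Pt Uz.
    (* Periodicity of the new iterate comes from uniqueness: this difference decays and satisfies
       the homogeneous equation. *)
    pose D y := v' i (y + t) - v' i y.
    have shift y : U y -> differentiable (fun y => v' i (y + t)) y /\
        'd (fun y => v' i (y + t)) y = 'd (v' i) (y + t) :> (V -> C).
      by move=> Uy; apply: diff_shift; apply: G1; have [] := hPer t y Pt Uy.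
    apply/eqP; rewrite -subr_eq0; apply/eqP.
    apply: (@transport_unique D (B + B)) => //.
    - by move=> y Uy; have [d1 _] := shift y Uy; exact: (differentiableB d1 (G1 y Uy)).
    - move=> y Uy; rewrite mulrDl; apply: le_trans (nrmB _ _) _; apply: lerD; last exact: G3.
      by have [Uyt <- _] := hPer t y Pt Uy; exact: G3.
    move=> y Uy; have [d1 e1] := shift y Uy; have [Uyt _ e2] := hPer t y Pt Uy.
    have pe : (fun j => v j (y + t)) = (fun j => v j y).
      by apply/funext => j; have [_ _ ->] := gv j.
    rewrite (diff_sub w d1 (G1 y Uy)) e1 G2 // G2 // pe e2 ?subrr // => j.
    exact: rng.
  by exists (exist _ v' gv') => i z Uz /=; have [_ h _] := hv' i; exact: h.
have good0 : good (fun _ _ => 0).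
  move=> i; split; [by move=> z _; exact: differentiable_cst| |by []].
  by move=> z _; rewrite nrm0 mulr_ge0.
have [v [v0 hv]] := dependent_choice step (exist _ _ good0).
pose u m i := sval (v m) i.
have gu m : good (u m) by exact: (svalP (v m)).
have du m i z : U z -> 'd (u m.+1 i) z w = Phi i z (fun j => u m j z) by exact: hv.
have dif m i : decays (2 * B * 2^-1 ^+ m) (fun z => u m.+1 i z - u m i z).
  elim: m i => [|m IH] i.
    move=> z Uz; rewrite expr0 mulr1; apply: le_trans (nrmB _ _) _.
    have [_ h1 _] := gu 1%N i; have [_ h2 _] := gu 0%N i.
    have -> : 2 * B * expR (- a * xr z) = B * expR (- a * xr z) + B * expR (- a * xr z) by ring.
    by apply: lerD; [exact: h1|exact: h2].
  have [H1 D1 _] := gu m.+2 i; have [H2 D2 _] := gu m.+1 i.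
  (* The difference of two iterates solves a transport equation with right-hand side of this size;
     [8 * k <= a] makes the gain [2 * k / a] at most 1 / 4, below the required 1 / 2. *)
  pose M := k * (2 * B * 2^-1 ^+ m).
  have M0 : 0 <= M by rewrite /M; apply: mulr_ge0 => //; apply: mulr_ge0; rewrite ?half_exp_ge0 // mulr_ge0.
  have : decays (2 * (M / a)) (fun z => u m.+2 i z - u m.+1 i z).
    apply: (@transport_apriori _ _ (B + B)) => //.
    - by move=> z Uz; exact: (differentiableB (H1 z Uz) (H2 z Uz)).
    - move=> z Uz; rewrite mulrDl; apply: le_trans (nrmB _ _) _.
      by apply: lerD; [exact: D1|exact: D2].
    move=> z Uz; rewrite (diff_sub w (H1 z Uz) (H2 z Uz)) !du //.
    rewrite /M -mulrA; apply: (hL _ _ _ _ _ Uz).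
    - by move=> j; exact: rng.
    - by move=> j; exact: rng.
    by move=> j; exact: IH.
  move=> h z Uz; apply: le_trans (h z Uz) _; rewrite ler_wpM2r //.
  rewrite /M exprS.
  have -> : 2 * (k * (2 * B * 2^-1 ^+ m) / a) = (2 * k / a) * (2 * B * 2^-1 ^+ m) by ring.
  have -> : 2 * B * (2^-1 * 2^-1 ^+ m) = 2^-1 * (2 * B * 2^-1 ^+ m) by ring.
  apply: ler_wpM2r; first by apply: mulr_ge0; rewrite ?half_exp_ge0 // mulr_ge0.
  by rewrite ler_pdivrMr //; lra.
have lim i z : exists l, U z -> forall m, nrm (l - u m i z) <= 4 * (2 * B * expR (- a * xr z)) * 2^-1 ^+ m.
  have [Uz|nUz] := pselect (U z); last by exists 0.
  have st m : nrm (u m.+1 i z - u m i z) <= 2 * B * expR (- a * xr z) * 2^-1 ^+ m.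
    by apply: le_trans (dif m i z Uz) _; rewrite mulrAC.
  by have [l hl] := geometric_limit st; exists l.
pose x i z := sval (cid (lim i z)).
have hx m i z : U z -> nrm (x i z - u m i z) <= 8 * B * expR (- a * xr z) * 2^-1 ^+ m.
  move=> Uz; apply: le_trans (svalP (cid (lim i z)) Uz m) _.
  by rewrite le_eqVlt; apply/orP; left; apply/eqP; ring.
have xB i : decays B (x i).
  move=> z Uz; apply: (@le_half_limit _ _ _ (8 * B * expR (- a * xr z))) => m.
  rewrite -(subrK (u m i z) (x i z)) addrC; apply: le_trans (nrmD _ _) _.
  by apply: lerD; [have [_ h _] := gu m i; exact: h|exact: hx].
have main i z : U z -> differentiable (x i) z /\ 'd (x i) z w = Phi i z (fun j => x j z).
  move=> Uz; have [r r0 hr] := U_open Uz.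
  have hb m : holo_ball (u m i) z r (B * E0).
    have [h1 h2 _] := gu m i; split=> // y hy; first exact/h1/hr.
    by apply: le_trans (h2 y (hr y hy)) _; rewrite ler_wpM2l // hE //; exact: hr.
  have hl m y : nrm (y - z) < r -> nrm (x i y - u m i y) <= 8 * B * E0 * 2^-1 ^+ m.
    move=> hy; apply: le_trans (hx m i y (hr y hy)) _.
    rewrite ler_wpM2r ?half_exp_ge0 //; apply: ler_wpM2l; first by rewrite mulr_ge0.
    by apply: hE; exact: hr.
  have [dx dxE] := holo_limit hb hl; split=> //.
  apply/eqP; rewrite -subr_eq0; apply/eqP.
  apply: (@nrm_half_limit _ _ _ (128 * (8 * B * E0) / r * nrm w + k * (8 * B * expR (- a * xr z)))) => m.
  have -> : 'd (x i) z w - Phi i z (fun j => x j z) = ('d (x i) z w - 'd (u m.+1 i) z w) +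
     (Phi i z (fun j => u m j z) - Phi i z (fun j => x j z)) by rewrite du //; ring.
  apply: le_trans (nrmD _ _) _; rewrite [leRHS]mulrDl; apply: lerD.
    apply: le_trans (dxE w m.+1) _; rewrite exprS.
    apply: ler_wpM2l; last by rewrite ler_piMl ?half_exp_ge0 // invf_le1 // ler1n.
    have E00 : 0 <= E0 by apply: le_trans (hE z Uz).
    by rewrite !mulr_ge0 ?nrm_ge0 ?invr_ge0 // ltW.
  rewrite -mulrA; apply: (hL _ _ _ _ _ Uz).
  - by move=> j; exact: rng.
  - move=> j; apply: le_trans (xB j z Uz) _; apply: le_trans kr.
    by rewrite ler_wpM2l // hE.
  - by move=> j; rewrite nrmBC; exact: hx.
exists x => i; split.
- by move=> z /(main i)[].
- exact: xB.
- by move=> z /(main i)[].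
move=> t z Pt Uz; apply/eqP; rewrite -subr_eq0; apply/eqP.
apply: (@nrm_half_limit _ _ _ (8 * B * expR (- a * xr z) + 8 * B * expR (- a * xr z))) => m.
have [Uzt xt _] := hPer t z Pt Uz; have [_ _ pu] := gu m i.
have -> : x i (z + t) - x i z = (x i (z + t) - u m i (z + t)) - (x i z - u m i z).
  by rewrite pu //; ring.
apply: le_trans (nrmB _ _) _; rewrite [leRHS]mulrDl; apply: lerD; last exact: hx.
by have := hx m i (z + t) Uzt; rewrite xt.
Qed.

End Transport.

(** * Rules for differentials *)

Section Calculus.
Context {R : realType} {C : cxType R}.
Implicit Types (V W Y : normedModType C).

(** Differentiability and the formula for the differential travel together, so that each rule yields
    both; [L] is compared pointwise and need not be packed as a linear map. *)
Definition isD V W (F : V -> W) (x : V) (L : V -> W) :=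
  differentiable F x /\ forall v, 'd F x v = L v.

Lemma isD_diff V W (F : V -> W) x : differentiable F x -> isD F x ('d F x).
Proof. by []. Qed.

Lemma isD_ext V W (F : V -> W) x (L L' : V -> W) :
  isD F x L -> (forall v, L v = L' v) -> isD F x L'.
Proof. by case=> h1 h2 h; split=> // v; rewrite h2. Qed.

Lemma isD_cst V W (c : W) (x : V) : isD (fun=> c) x (fun=> 0).
Proof. by split=> [|v]; [exact: differentiable_cst|rewrite diff_cst]. Qed.

Lemma isD_intro V W (F L : V -> W) x (B : R) :
  linear L -> (forall h, nrm (L h) <= B * nrm h) ->
  (forall e : R, 0 < e -> exists2 d, 0 < d &
    forall h, nrm h < d -> nrm (F (x + h) - F x - L h) <= e * nrm h) ->
  isD F x L.
Proof. by move=> h1 h2 h3; have [d1 d2] := differentiable_intro h1 h2 h3; split=> // v; rewrite d2. Qed.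

Lemma isD_lin V W (L : V -> W) (B : R) x :
  linear L -> (forall h, nrm (L h) <= B * nrm h) -> isD L x L.
Proof.
move=> h1 h2; apply: (isD_intro h1 h2) => e e0; exists 1 => // h _.
have -> : L (x + h) = L x + L h by have := h1 1 x h; rewrite !scale1r.
by rewrite (addrAC (L x) (L h)) subrr add0r subrr nrm0 mulr_ge0 ?nrm_ge0 // ltW.
Qed.

Lemma diff_bounded V W (F : V -> W) x : differentiable F x ->
  exists2 B : R, 0 <= B & forall h, nrm ('d F x h) <= B * nrm h.
Proof.
move=> dF; have [k k0 hk] := linear_lipschitz (diff_continuous dF).
have [c kE] : exists c : R, k = ofR c by exists (cre k); exact: ge0_ofR (ltW k0).
exists c; first by rewrite -(ler_ofR (C := C)) rmorph0 -kE ltW.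
by move=> h; have := hk h; rewrite kE !normE -rmorphM ler_ofR.
Qed.

Lemma isD_near V W (F G : V -> W) x L : isD F x L ->
  (\forall y \near x, G y = F y) -> isD G x L.
Proof.
move=> [dF dE] /nbhs_nrmP[r r0 hr].
have [B _ hB] := diff_bounded dF.
apply: (fun h => isD_ext h dE).
apply: (isD_intro (B := B) _ hB); first exact: linearP.
move=> e e0; have [d d0 hd] := differentiable_eps dF e0.
exists (Num.min d r) => [|h]; first by rewrite lt_min d0.
rewrite lt_min => /andP[h1 h2].
rewrite !hr; first exact: hd; first by rewrite subrr nrm0.
by rewrite addrAC subrr add0r.
Qed.

Lemma isD_add V W (F G : V -> W) x L M : isD F x L -> isD G x M ->
  isD (fun z => F z + G z) x (fun v => L v + M v).
Proof.
move=> [d1 e1] [d2 e2]; split; first exact: (differentiableD d1 d2).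
move=> v; have := congr1 (fun g => g v) (diffD d1 d2) => /= E.
by rewrite -e1 -e2; exact: E.
Qed.

Lemma isD_opp V W (F : V -> W) x L : isD F x L -> isD (fun z => - F z) x (fun v => - L v).
Proof.
move=> [d1 e1]; split; first exact: (differentiableN d1).
move=> v; have := congr1 (fun g => g v) (diffN d1) => /= E.
by rewrite -e1; exact: E.
Qed.

Lemma isD_sub V W (F G : V -> W) x L M : isD F x L -> isD G x M ->
  isD (fun z => F z - G z) x (fun v => L v - M v).
Proof. by move=> h1 h2; apply: isD_add => //; exact: isD_opp. Qed.

Lemma isD_comp V W Y (F : V -> W) (G : W -> Y) x L M :
  isD F x L -> isD G (F x) M -> isD (fun z => G (F z)) x (fun v => M (L v)).
Proof.
move=> [d1 e1] [d2 e2]; split; first exact: (differentiable_comp d1 d2).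
move=> v; have := congr1 (fun g => g v) (diff_comp d1 d2) => /= E.
by rewrite -e1 -e2; exact: E.
Qed.

Lemma isD_mul V (F G : V -> C) x L M : isD F x L -> isD G x M ->
  isD (fun z => F z * G z) x (fun v => L v * G x + F x * M v).
Proof.
move=> [d1 e1] [d2 e2]; split; first exact: (differentiableM d1 d2).
move=> v; have := congr1 (fun g => g v) (diffM d1 d2) => /= E.
rewrite -e1 -e2; apply: etrans; first exact: E.
by rewrite /GRing.scale /= addrC mulrC.
Qed.

Lemma isD_cmul V (c : C) (F : V -> C) x L : isD F x L ->
  isD (fun z => c * F z) x (fun v => c * L v).
Proof.
move=> h; apply: isD_ext (isD_mul (isD_cst c x) h) _ => v.
by rewrite mul0r add0r.
Qed.

Lemma isD_sum V n (F : 'I_n -> V -> C) x (L : 'I_n -> V -> C) :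
  (forall i, isD (F i) x (L i)) ->
  isD (fun z => \sum_(i < n) F i z) x (fun v => \sum_(i < n) L i v).
Proof.
elim: n F L => [|n IH] F L hF.
  apply: (isD_near (F := fun=> 0)); last by apply: nearW => y; rewrite big_ord0.
  by apply: isD_ext (isD_cst _ _) _ => v; rewrite big_ord0.
apply: (isD_near (F := fun z => F ord0 z + \sum_(i < n) F (lift ord0 i) z)); last first.
  by apply: nearW => y; rewrite big_ord_recl.
apply: isD_ext; first exact: (isD_add (hF ord0) (IH _ _ (fun i => hF (lift ord0 i)))).
by move=> v; rewrite big_ord_recl.
Qed.

Lemma isD_pair V W Y (F : V -> W) (G : V -> Y) x L M : isD F x L -> isD G x M ->
  isD (fun z => (F z, G z)) x (fun v => (L v, M v)).
Proof.
move=> [d1 e1] [d2 e2]; split; first exact: differentiable_pair.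
move=> v; have := congr1 (fun g => g v) (diff_pair d1 d2) => /= E.
by rewrite -e1 -e2; exact: E.
Qed.

Lemma isD_col V n (F : V -> 'cV[C]_n) x (L : V -> 'cV[C]_n) :
  (forall i, isD (fun z => F z i 0) x (fun v => L v i 0)) -> isD F x L.
Proof.
move=> hF.
have [B B0 hB] : exists2 B : R, 0 <= B & forall i h, nrm (L h i 0) <= B * nrm h.
  have hb i : exists B : R, 0 <= B /\ forall h, nrm (L h i 0) <= B * nrm h.
    have [dF dE] := hF i; have [B B0 hB] := diff_bounded dF.
    by exists B; split=> // h; rewrite -dE.
  have [b hb'] := choice hb.
  exists (\sum_i b i); first by apply: sumr_ge0 => i _; have [] := hb' i.
  move=> i h; have [_ h1] := hb' i; apply: le_trans (h1 h) _.
  rewrite ler_wpM2r ?nrm_ge0 // (bigD1 i) //= lerDl.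
  by apply: sumr_ge0 => j _; have [] := hb' j.
apply: (isD_intro (B := B)).
- move=> c u v; apply/colP => i; have [dF dE] := hF i.
  by rewrite !mxE -!dE; exact: linearP.
- by move=> h; apply: nrm_col_le; rewrite ?mulr_ge0 ?nrm_ge0.
move=> e e0.
have H i : \forall h \near (0 : V), nrm ((F (x + h) - F x - L h) i 0) <= e * nrm h.
  have [dF dE] := hF i; have [d d0 hd] := differentiable_eps dF e0.
  apply/nbhs_nrmP; exists d => // h; rewrite subr0 => /hd.
  by rewrite !mxE dE.
have /nbhs_nrmP[d d0 hd] : \forall h \near (0 : V),
    forall i, nrm ((F (x + h) - F x - L h) i 0) <= e * nrm h by exact: filter_forall.
exists d => // h hh; apply: nrm_col_le; first by rewrite mulr_ge0 ?nrm_ge0 // ltW.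
by move=> i; apply: hd; rewrite subr0.
Qed.

Lemma isD_id V (x : V) : isD (fun z => z) x (fun v => v).
Proof. by apply: (@isD_lin V V _ 1) => // h; rewrite mul1r. Qed.

Lemma isD_fst V W (x : V * W) : isD (fun z : V * W => z.1) x (fun v => v.1).
Proof. by apply: (@isD_lin _ _ _ 1) => // h; rewrite mul1r nrm_fst. Qed.

Lemma isD_snd V W (x : V * W) : isD (fun z : V * W => z.2) x (fun v => v.2).
Proof. by apply: (@isD_lin _ _ _ 1) => // h; rewrite mul1r nrm_snd. Qed.

Lemma isD_coord n (x : 'cV[C]_n) i : isD (fun z : 'cV[C]_n => z i 0) x (fun v => v i 0).
Proof.
apply: (@isD_lin _ _ _ 1) => [c u v|h]; first by rewrite !mxE.
by rewrite mul1r nrm_col_ge.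
Qed.

Lemma isD_coordF V n (F : V -> 'cV[C]_n) x L i : isD F x L ->
  isD (fun z => F z i 0) x (fun v => L v i 0).
Proof. by move=> h; exact: (isD_comp h (isD_coord _ i)). Qed.

Lemma nrm_delta n (l : 'I_n) : nrm (delta_mx l 0 : 'cV[C]_n) <= 1.
Proof.
apply: nrm_col_le => // i; rewrite mxE eqxx andbT.
by case: (i == l); rewrite /= ?mulr1n ?mulr0n ?nrm1 ?nrm0.
Qed.

End Calculus.

(** * The invariant asymptotic torus *)

Lemma isD_eqf (R : realType) (C : cxType R) (V W : normedModType C) (F G : V -> W) x L :
  isD F x L -> (forall y, G y = F y) -> isD G x L.
Proof. by move=> h e; have -> : G = F by apply/funext. Qed.

Lemma nrm_sumC (R : realType) (C : cxType R) n (F : 'I_n -> C) :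
  nrm (\sum_(i < n) F i) <= \sum_(i < n) nrm (F i).
Proof.
elim: n F => [|n IH] F; first by rewrite !big_ord0 nrm0.
by rewrite !big_ord_recl; apply: le_trans (nrmD _ _) _; rewrite lerD2l; exact: IH.
Qed.

Section Balls.
Context {R : realType} {C : cxType R} {V : normedModType C}.

Lemma ball_forall (x : V) n (P : 'I_n -> V -> Prop) :
  (forall l, exists2 r : R, 0 < r & forall y, nrm (y - x) < r -> P l y) ->
  exists2 r : R, 0 < r & forall y, nrm (y - x) < r -> forall l, P l y.
Proof.
move=> h; apply/nbhs_nrmP.
have h1 l : nbhs x (P l) by apply/nbhs_nrmP; exact: h.
exact: filter_forall.
Qed.

Lemma ball_and (x : V) (P Q : V -> Prop) :
  (exists2 r : R, 0 < r & forall y, nrm (y - x) < r -> P y) ->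
  (exists2 r : R, 0 < r & forall y, nrm (y - x) < r -> Q y) ->
  exists2 r : R, 0 < r & forall y, nrm (y - x) < r -> P y /\ Q y.
Proof.
by move=> /nbhs_nrmP h1 /nbhs_nrmP h2; apply/nbhs_nrmP; exact: filterI.
Qed.

Lemma isD_ball (W : normedModType C) (F G : V -> W) x L (r : R) : isD F x L -> 0 < r ->
  (forall y, nrm (y - x) < r -> G y = F y) -> isD G x L.
Proof. by move=> h r0 hr; apply: isD_near h _; apply/nbhs_nrmP; exists r. Qed.

Lemma isD_shift (F : V -> C) (x t : V) : differentiable F (x + t) ->
  isD (fun y => F (y + t)) x ('d F (x + t)).
Proof. by move=> h; have [h1 h2] := diff_shift h; split=> // v; rewrite h2. Qed.

Lemma diff_periodic (F : V -> C) (x t : V) (r : R) : 0 < r ->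
  differentiable F (x + t) -> differentiable F x ->
  (forall y, nrm (y - x) < r -> F (y + t) = F y) -> forall v, 'd F (x + t) v = 'd F x v.
Proof.
move=> r0 h1 h2 h v; have [_ <-] := isD_shift h1.
by have [_ ->] := isD_ball (isD_diff h2) r0 h.
Qed.

End Balls.

(** * Complex domains and embedded tori *)

Section Geometry.
Context {R : realType} {C : cxType R} {n : nat}.
Local Notation E := ('cV[C]_n * C)%type.
Local Notation X := ('cV[C]_n * 'cV[C]_n * C)%type.
Implicit Types (s r : R).

(** Points are (q, xi), without the momenta. Here [s] bounds |Im q_l| itself, without the factor 2
    that [Dom] puts in front of sigma. *)
Definition baseU (s zt : R) : set E :=
  [set y : E | [/\ forall l : 'I_n, `|cim (y.1 l 0)| < s, - zt < cre y.2 & `|cim y.2| < zt]].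

Definition domX (s rho zt : R) : set X :=
  [set y : X | [/\ forall l : 'I_n, `|cim (y.1.1 l 0)| < s, nrm y.1.2 < rho,
               - zt < cre y.2 & `|cim y.2| < zt]].

Definition xre (z : E) : R := cre z.2.

Definition wvec (omega : 'cV[R]_n) : E := (map_mx ofR omega, 1).

Definition per (l : 'I_n) : 'cV[C]_n := ofR (2 * pi) *: delta_mx l 0.

Lemma cim_near (u v : C) s : `|cim u| < s -> nrm (v - u) < s - `|cim u| -> `|cim v| < s.
Proof.
move=> h1 h2; rewrite -(subrK u v) cimD; apply: le_lt_trans (ler_normD _ _) _.
by have := cim_le (v - u); lra.
Qed.

Lemma baseU_open s zt z : baseU s zt z ->
  exists2 r, 0 < r & forall y, nrm (y - z) < r -> baseU s zt y.
Proof.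
move=> [h1 h2 h3].
have H1 : exists2 r, 0 < r & forall y : E, nrm (y - z) < r -> forall l, `|cim (y.1 l 0)| < s.
  apply: (ball_forall (P := fun (l : 'I_n) (y : E) => `|cim (y.1 l 0)| < s)) => l.
  exists (s - `|cim (z.1 l 0)|); first by rewrite subr_gt0.
  move=> y hy; apply: cim_near (h1 l) _; apply: le_lt_trans hy.
  apply: le_trans (nrm_fst _); apply: le_trans (nrm_col_ge _ l).
  by rewrite !mxE.
have H2 : exists2 r, 0 < r & forall y : E, nrm (y - z) < r -> - zt < cre y.2.
  exists (cre z.2 + zt); first by lra.
  move=> y hy; have := cre_le ((y - z).2); rewrite /= creB ler_norml => /andP[h _].
  by have := nrm_snd (y - z); lra.
have H3 : exists2 r, 0 < r & forall y : E, nrm (y - z) < r -> `|cim y.2| < zt.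
  exists (zt - `|cim z.2|); first by rewrite subr_gt0.
  move=> y hy; apply: cim_near h3 _; apply: le_lt_trans hy; exact: (nrm_snd (y - z)).
have [r r0 hr] := ball_and H1 (ball_and H2 H3).
by exists r => // y /hr[? [? ?]]; split.
Qed.

Lemma baseU_grow s zt z y r : baseU s zt z -> nrm (y - z) <= r -> baseU (s + r) (zt + r) y.
Proof.
move=> [h1 h2 h3] hr; have g1 := nrm_fst (y - z); have g2 := nrm_snd (y - z).
split=> [l||].
- rewrite -(subrK (z.1 l 0) (y.1 l 0)) cimD; apply: le_lt_trans (ler_normD _ _) _.
  have := cim_le (y.1 l 0 - z.1 l 0); have := nrm_col_ge ((y - z).1) l; rewrite !mxE.
  by have := h1 l; lra.
- have := cre_le ((y - z).2); rewrite /= creB ler_norml => /andP[h _]; lra.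
- rewrite -(subrK z.2 y.2) cimD; apply: le_lt_trans (ler_normD _ _) _.
  by have := cim_le ((y - z).2); rewrite /=; lra.
Qed.

Lemma domX_grow s rho zt z y r : domX s rho zt z -> nrm (y - z) <= r ->
  domX (s + r) (rho + r) (zt + r) y.
Proof.
move=> [h1 h0 h2 h3] hr; have g1 := nrm_fst (y - z); have g2 := nrm_snd (y - z).
have g3 := nrm_fst ((y - z).1); have g4 := nrm_snd ((y - z).1).
split=> [l|||].
- rewrite -(subrK (z.1.1 l 0) (y.1.1 l 0)) cimD; apply: le_lt_trans (ler_normD _ _) _.
  have := cim_le (y.1.1 l 0 - z.1.1 l 0); have := nrm_col_ge ((y - z).1.1) l; rewrite !mxE.
  by have := h1 l; lra.
- rewrite -(subrK z.1.2 y.1.2); apply: le_lt_trans (nrmD _ _) _.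
  by move: g4 => /=; lra.
- have := cre_le ((y - z).2); rewrite /= creB ler_norml => /andP[h _]; lra.
- rewrite -(subrK z.2 y.2) cimD; apply: le_lt_trans (ler_normD _ _) _.
  by have := cim_le ((y - z).2); rewrite /=; lra.
Qed.

Lemma domXS s rho zt s' rho' zt' y : s <= s' -> rho <= rho' -> zt <= zt' ->
  domX s rho zt y -> domX s' rho' zt' y.
Proof. by move=> h1 h2 h3 [e1 e2 e3 e4]; split=> [l|||]; [have := e1 l|..]; lra. Qed.

Lemma baseUS s zt s' zt' y : s <= s' -> zt <= zt' -> baseU s zt y -> baseU s' zt' y.
Proof. by move=> h1 h2 [e1 e3 e4]; split=> [l||]; [have := e1 l|..]; lra. Qed.

(** As [omega] is real, the flow of w leaves all imaginary parts alone and only increases Re xi: the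
    domain is forward invariant without shrinking. *)
Lemma baseU_w omega s zt z (t : R) : baseU s zt z -> 0 <= t ->
  baseU s zt (z + ofR t *: wvec omega).
Proof.
move=> [h1 h2 h3] t0; split=> [l||].
- rewrite /= !mxE cimD cimM !cim_ofR mulr0 mul0r !addr0; exact: h1.
- rewrite /= creD creM cim_ofR mul0r cre_ofR cre1; lra.
- by rewrite /= cimD cimM cim_ofR cim1 mul0r mulr0 !addr0.
Qed.

Lemma xre_w omega z (t : R) : xre (z + ofR t *: wvec omega) = xre z + t.
Proof. by rewrite /xre /= creD creM cim_ofR mul0r subr0 cre_ofR cre1 mulr1. Qed.

Lemma xre_lip (y z : E) : `|xre y - xre z| <= nrm (y - z).
Proof. by rewrite /xre -creB; apply: le_trans (cre_le _) (nrm_snd (y - z)). Qed.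

Lemma cim_per (q : 'cV[C]_n) l i : cim ((q + per l) i 0) = cim (q i 0).
Proof.
rewrite !mxE cimD cimM cim_ofR mul0r addr0 eqxx andbT.
by case: (i == l); rewrite /= ?mulr1n ?mulr0n ?cim0 ?cim1 mulr0 addr0.
Qed.

Lemma baseU_per s zt z l : baseU s zt z -> baseU s zt (z + (per l, 0)).
Proof.
by move=> [h1 h2 h3]; split=> [i||]; rewrite /= ?cim_per ?addr0.
Qed.

Lemma xre_per z l : xre (z + (per l, 0)) = xre z.
Proof. by rewrite /xre /= addr0. Qed.

Lemma domX_per s rho zt y l : domX s rho zt y -> domX s rho zt (y + (per l, 0, 0)).
Proof.
by move=> [h1 h0 h2 h3]; split=> [i|||]; rewrite /= ?cim_per ?addr0.
Qed.

(** The embedding of the torus at (theta, xi): [x] displaces the angles and [y] is the momentum. *)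
Definition jmap (x y : 'I_n -> C) (z : E) : X := (z.1 + \col_l x l, \col_l y l, z.2).

Lemma nrm_colf (x : 'I_n -> C) (e : R) : 0 <= e -> (forall l, nrm (x l) <= e) ->
  nrm (\col_l x l) <= e.
Proof. by move=> e0 h; apply: nrm_col_le => // l; rewrite mxE. Qed.

Lemma jmap_dom x y s zt z r : 0 < r -> baseU s zt z -> (forall l, nrm (x l) <= r) ->
  (forall l, nrm (y l) <= r) -> domX (s + r) (r + r) (zt + r) (jmap x y z).
Proof.
move=> r0 [h1 h2 h3] hx hy; split=> [l|||] /=.
- rewrite !mxE cimD; apply: le_lt_trans (ler_normD _ _) _.
  by have := cim_le (x l); have := h1 l; have := hx l; lra.
- by apply: le_lt_trans (nrm_colf (ltW r0) hy) _; lra.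
- by lra.
- by lra.
Qed.

Lemma isD_jmap (x y : 'I_n -> E -> C) z : (forall l, differentiable (x l) z) ->
  (forall l, differentiable (y l) z) ->
  isD (fun z => jmap (fun l => x l z) (fun l => y l z) z) z
    (fun v : E => (v.1 + \col_l 'd (x l) z v, \col_l 'd (y l) z v, v.2)).
Proof.
move=> dx dy; apply: isD_pair; last exact: isD_snd.
apply: isD_pair.
  apply: isD_add; first exact: isD_fst.
  apply: isD_col => l; apply: (isD_eqf (F := x l)) => [|t]; last by rewrite mxE.
  by apply: isD_ext (isD_diff (dx l)) _ => v; rewrite mxE.
apply: isD_col => l; apply: (isD_eqf (F := y l)) => [|t]; last by rewrite mxE.
by apply: isD_ext (isD_diff (dy l)) _ => v; rewrite mxE.
Qed.

End Geometry.

Section Torus.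
Context {R : realType} {C : cxType R} {n : nat}.
Local Notation E := ('cV[C]_n * C)%type.
Local Notation X := ('cV[C]_n * 'cV[C]_n * C)%type.
Context (f : X -> C) (Gamma : 'M[C]_n) (omega : 'cV[R]_n) (s zt r Mf a g : R).
Hypotheses (r_gt0 : 0 < r) (a_gt0 : 0 < a) (zt_gt0 : 0 < zt)
  (Mf_ge0 : 0 <= Mf) (g_ge0 : 0 <= g).
Hypothesis f_holo : forall y, domX (s + 4 * r) (4 * r) (zt + 4 * r) y -> differentiable f y.
Hypothesis f_bound : forall y, domX (s + 4 * r) (4 * r) (zt + 4 * r) y ->
  nrm (f y) <= Mf * expR (- a * cre y.2).
Hypothesis f_per : forall y l, domX (s + 4 * r) (4 * r) (zt + 4 * r) y ->
  f (y + (per l, 0, 0)) = f y.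
Hypothesis Gamma_bound : forall l m, nrm (Gamma l m) <= g.

Local Notation U := (baseU s zt).
Local Notation w := (wvec (C := C) omega).

(** The exponential pays for the variation of the weight over a ball of radius 2 r, so that one
    constant serves the whole ball. *)
Definition fball := Mf * expR (2 * a * r).

Lemma fball_ge0 : 0 <= fball.
Proof. by rewrite mulr_ge0 ?expR_ge0. Qed.

Lemma f_holo_ball y : domX (s + 2 * r) (2 * r) (zt + 2 * r) y ->
  holo_ball f y (2 * r) (fball * expR (- a * cre y.2)).
Proof.
move=> hy; split; first by rewrite mulr_gt0.
  move=> t /ltW ht; apply: f_holo; apply: domXS (domX_grow hy ht); lra.
move=> t /ltW ht; apply: le_trans (f_bound _) _.
  by apply: domXS (domX_grow hy ht); lra.
rewrite /fball -mulrA -expRD ler_wpM2l // ler_expR.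
have := cre_le (t.2 - y.2); rewrite creB ler_norml => /andP[h _].
have h2 := nrm_snd (t - y); rewrite /= in h2.
have : a * (cre y.2 - 2 * r) <= a * cre t.2 by rewrite ler_pM2l //; lra.
rewrite !mulNr mulrBr; lra.
Qed.

Lemma fd_bound y v : domX (s + 2 * r) (2 * r) (zt + 2 * r) y -> nrm v <= 1 ->
  nrm ('d f y v) <= 8 * fball / r * expR (- a * cre y.2).
Proof.
move=> hy hv; apply: le_trans (cauchy_dir v (f_holo_ball hy)) _.
have -> : 16 * (fball * expR (- a * cre y.2)) / (2 * r) = 8 * fball / r * expR (- a * cre y.2).
  by field; rewrite gt_eqF.
rewrite ler_piMr // !mulr_ge0 ?expR_ge0 ?fball_ge0 // invr_ge0 ltW //.
Qed.

Lemma fd_per y v l : domX (s + 2 * r) (2 * r) (zt + 2 * r) y ->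
  'd f (y + (per l, 0, 0)) v = 'd f y v.
Proof.
move=> hy.
have hy' := domX_per l hy.
have dfp : differentiable f (y + (per l, 0, 0)).
  by apply: f_holo; have := r_gt0 => r0; apply: domXS hy'; lra.
have dfy : differentiable f y by apply: f_holo; have := r_gt0 => r0; apply: domXS hy; lra.
apply: (diff_periodic r_gt0 dfp dfy) => t /ltW ht.
by apply: f_per; move: r_gt0 => r0; apply: domXS (domX_grow hy ht); lra.
Qed.

Lemma fd_diff y v : domX (s + 2 * r) (2 * r) (zt + 2 * r) y ->
  differentiable (fun t => 'd f t v) y.
Proof.
move=> hy; have hb := f_holo_ball hy.
apply: (nbhs_singleton (holo_derive v _)); apply: (holo_ball_holo hb).
by rewrite subrr nrm0 mulr_gt0.
Qed.

Definition fLip := 64 * 64 * fball / (2 * r) ^+ 2.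

Lemma fd_lip y h v : domX (s + 2 * r) (2 * r) (zt + 2 * r) y -> nrm v <= 1 -> nrm h < r / 2 ->
  nrm ('d f (y + h) v - 'd f y v) <= fLip * expR (- a * cre y.2) * nrm h.
Proof.
move=> hy hv hh; apply: le_trans (diff_lipschitz v (f_holo_ball hy) _) _; first by lra.
have -> : 64 * 64 * (fball * expR (- a * cre y.2)) / (2 * r) ^+ 2 =
   fLip * expR (- a * cre y.2) by rewrite /fLip; ring.
rewrite ler_piMr // mulr_ge0 ?nrm_ge0 // mulr_ge0 ?expR_ge0 // /fLip.
by apply: divr_ge0; [rewrite mulr_ge0 ?fball_ge0|rewrite exprn_ge0 // ltW // mulr_gt0].
Qed.

Definition vq (l : 'I_n) : X := (delta_mx l 0, 0, 0).
Definition vp (l : 'I_n) : X := (0, delta_mx l 0, 0).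

Lemma nrm_vq l : nrm (vq l) <= 1.
Proof. by rewrite !nrm_pair_le !nrm0 nrm_delta ler01. Qed.
Lemma nrm_vp l : nrm (vp l) <= 1.
Proof. by rewrite !nrm_pair_le !nrm0 nrm_delta ler01. Qed.

(** The supremum of the weight e^(-a Re xi), approached at the left edge of the domain; it turns
    decay into a uniform bound. *)
Definition exp_edge := expR (a * zt).

Lemma exp_xre (z : E) : U z -> expR (- a * xre z) <= exp_edge.
Proof.
by move=> [_ h _]; rewrite /exp_edge ler_expR mulNr -mulrN ler_pM2l // /xre; lra.
Qed.

Definition jsc (d : R) (u : 'I_n + 'I_n -> C) z :=
  jmap (fun l => u (inl l)) (fun l => ofR d * u (inr l)) z.

(** The right-hand sides of the Hamilton equations with eps = d^2 and momentum d times [u (inr l)];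
    the momentum equation has been divided by d. Every term now carries a factor d. *)
Definition torus_rhs (d : R) (i : 'I_n + 'I_n) z (u : 'I_n + 'I_n -> C) : C :=
  match i with
  | inl l => ofR d * \sum_m Gamma l m * u (inr m) + ofR (d ^+ 2) * 'd f (jsc d u z) (vp l)
  | inr l => - (ofR d * 'd f (jsc d u z) (vq l))
  end.

(** After removal of the factor d, the middle term bounds the right-hand side at u = 0, and the
    other two are the Lipschitz constants of the terms in Gamma and in [f]. *)
Definition torus_rate := n%:R * g + 8 * fball / r + fLip * exp_edge.

Lemma torus_rate_ge0 : 0 <= torus_rate.
Proof.
rewrite /torus_rate; apply: addr_ge0; last first.
  apply: mulr_ge0; last exact: expR_ge0.
  by apply: divr_ge0; [rewrite mulr_ge0 ?fball_ge0|rewrite exprn_ge0 // ltW // mulr_gt0].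
apply: addr_ge0; first by rewrite mulr_ge0.
by apply: divr_ge0; rewrite ?(ltW r_gt0) // mulr_ge0 ?fball_ge0.
Qed.

Lemma jsc_dom d u z : 0 <= d <= 1 -> U z -> (forall i, nrm (u i) <= r) ->
  domX (s + 2 * r) (2 * r) (zt + 2 * r) (jsc d u z).
Proof.
move=> /andP[d0 d1] Uz hu.
have h : domX (s + r) (r + r) (zt + r) (jsc d u z).
  apply: jmap_dom => // l; rewrite nrmM nrm_ofR ger0_norm //.
  by apply: le_trans (hu (inr l)); rewrite ler_piMl ?nrm_ge0.
by have := r_gt0 => r0; apply: domXS h; lra.
Qed.

Lemma fLip_ge0 : 0 <= fLip.
Proof.
by apply: divr_ge0; [rewrite mulr_ge0 ?fball_ge0|rewrite exprn_ge0 // ltW // mulr_gt0].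
Qed.

Lemma exp_edge_ge0 : 0 <= exp_edge. Proof. exact: expR_ge0. Qed.

Lemma jsc_per d u z l : jsc d u (z + (per l, 0)) = jsc d u z + (per l, 0, 0).
Proof.
rewrite /jsc; apply: injective_projections => /=; last by rewrite !addr0.
by apply: injective_projections => /=; rewrite ?addr0 // addrAC.
Qed.

Lemma torus_rhs_per d i u z l : domX (s + 2 * r) (2 * r) (zt + 2 * r) (jsc d u z) ->
  torus_rhs d i (z + (per l, 0)) u = torus_rhs d i z u.
Proof.
move=> hj.
have e v : 'd f (jsc d u (z + (per l, 0))) v = 'd f (jsc d u z) v.
  by rewrite jsc_per; exact: fd_per.
case: i => i.
  exact: (congr1 (fun c => ofR d * \sum_m Gamma i m * u (inr m) + ofR (d ^+ 2) * c) (e (vp i))).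
exact: (congr1 (fun c => - (ofR d * c)) (e (vq i))).
Qed.

Lemma jsc_sub d u u' z : jsc d u z - jsc d u' z =
  (\col_l (u (inl l) - u' (inl l)), \col_l (ofR d * (u (inr l) - u' (inr l))), 0).
Proof.
apply: injective_projections => /=; last by rewrite subrr.
apply: injective_projections => /=; apply/colP => i; rewrite !mxE.
  by rewrite addrAC opprD addrA subrr sub0r addrC.
by rewrite mulrBr.
Qed.

Lemma jsc_lip d u u' z (c : R) : 0 <= d <= 1 -> 0 <= c -> (forall i, nrm (u i - u' i) <= c) ->
  nrm (jsc d u z - jsc d u' z) <= c.
Proof.
move=> /andP[d0 d1] c0 hc; rewrite jsc_sub !nrm_pair_le nrm0 c0 andbT.
apply/andP; split; apply: nrm_colf => // l.
rewrite nrmM nrm_ofR ger0_norm //; apply: le_trans (hc (inr l)).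
by rewrite ler_piMl ?nrm_ge0.
Qed.

Lemma fdj_lip (d : R) (u u' : _ -> C) z v (c : R) : 0 <= d <= 1 -> U z -> 0 <= c <= r / 4 ->
  (forall i, nrm (u i) <= r) -> (forall i, nrm (u' i) <= r) ->
  (forall i, nrm (u i - u' i) <= c) -> nrm v <= 1 ->
  nrm ('d f (jsc d u z) v - 'd f (jsc d u' z) v) <= fLip * exp_edge * c.
Proof.
move=> hd Uz /andP[c0 c1] hu hu' hc hv.
rewrite -(subrK (jsc d u' z) (jsc d u z)) (addrC (_ - _)).
have hl := jsc_lip z hd c0 hc.
apply: le_trans (fd_lip (jsc_dom hd Uz hu') hv _) _.
  by apply: le_lt_trans hl _; move: r_gt0 => r0; lra.
apply: ler_pM; [by rewrite mulr_ge0 ?fLip_ge0 ?expR_ge0|exact: nrm_ge0| |exact: hl].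
by apply: ler_wpM2l; [exact: fLip_ge0|exact: exp_xre].
Qed.

Lemma torus_rate_ge : (n%:R * g <= torus_rate) /\ (8 * fball / r <= torus_rate) /\ fLip * exp_edge <= torus_rate
  /\ n%:R * g + fLip * exp_edge <= torus_rate.
Proof.
have h1 : 0 <= n%:R * g by rewrite mulr_ge0.
have h2 : 0 <= 8 * fball / r by apply: divr_ge0; rewrite ?(ltW r_gt0) // mulr_ge0 ?fball_ge0.
have h3 : 0 <= fLip * exp_edge by rewrite mulr_ge0 ?fLip_ge0 ?exp_edge_ge0.
rewrite /torus_rate; move: (n%:R * g) (8 * fball / r) (fLip * exp_edge) h1 h2 h3 => A B D h1 h2 h3.
by repeat split; lra.
Qed.

Theorem torus_solution (d : R) : 0 <= d <= 1 -> 8 * (d * torus_rate) <= a ->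
  4 * (d * torus_rate) / a * exp_edge <= r / 8 ->
  exists x y : 'I_n -> E -> C,
    [/\ forall l, [/\ holoU U (x l), decays xre U a (4 * (d * torus_rate) / a) (x l),
          (forall z, U z -> 'd (x l) z w =
             \sum_m Gamma l m * y m z +
             ofR (d ^+ 2) * 'd f (jmap (x^~ z) (y^~ z) z) (vp l)) &
          forall m z, U z -> x l (z + (per m, 0)) = x l z],
        forall l, [/\ holoU U (y l), decays xre U a (4 * (d * torus_rate) / a) (y l),
          (forall z, U z -> 'd (y l) z w =
             - (ofR (d ^+ 2) * 'd f (jmap (x^~ z) (y^~ z) z) (vq l))) &
          forall m z, U z -> y l (z + (per m, 0)) = y l z] &
        forall l z, U z -> nrm (x l z) <= r / 8 /\ nrm (y l z) <= r / 8].
Proof.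
move=> hd ka kr; have /andP[d0 d1] := hd; have K00 := torus_rate_ge0.
have kk0 : 0 <= d * torus_rate by rewrite mulr_ge0.
have [hK1 [hK2 [hK3 hK4]]] := torus_rate_ge.
have r8 : r / 8 <= r by move: r_gt0 => r0; lra.
have r4 : r / 8 + r / 8 <= r / 4 by move: r_gt0 => r0; lra.
pose Per (t : E) := exists l, t = (per l, 0).
have [||||v hv] := @asymptotic_solution R C _ w xre U a a_gt0 (xre_w omega) xre_lip
   (fun z t => @baseU_w R C n omega s zt z t) (fun z => @baseU_open R C n s zt z)
   ('I_n + 'I_n)%type (torus_rhs d) Per (d * torus_rate) exp_edge (r / 8) kk0 ka kr exp_xre.
- move=> t z [l ->] Uz; split; [exact: baseU_per|exact: xre_per|].
  move=> l' u hu; have Uz' := baseU_per l Uz.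
  have hj : domX (s + 2 * r) (2 * r) (zt + 2 * r) (jsc d u z).
    by apply: jsc_dom => // i; apply: le_trans (hu i) r8.
  exact: torus_rhs_per.
- move=> v hv hr l z Uz.
  have dj : differentiable (fun z => jsc d (v^~ z) z) z.
    have [h _] := @isD_jmap R C n (fun l => v (inl l)) (fun l z => ofR d * v (inr l) z) z
       (fun l => hv (inl l) z Uz) (fun l => (isD_cmul (ofR d) (isD_diff (hv (inr l) z Uz))).1).
    exact: h.
  have hj : domX (s + 2 * r) (2 * r) (zt + 2 * r) (jsc d (v^~ z) z).
    by apply: jsc_dom => // i; apply: le_trans (hr i z Uz) r8.
  have dfj v' : isD (fun z => 'd f (jsc d (v^~ z) z) v') z _ :=
    isD_comp (isD_diff dj) (isD_diff (fd_diff v' hj)).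
  case: l => l.
    exact: (isD_add (isD_cmul (ofR d) (isD_sum (fun m =>
       isD_cmul (Gamma l m) (isD_diff (hv (inr m) z Uz))))) (isD_cmul (ofR (d ^+ 2)) (dfj _))).1.
  exact: (isD_opp (isD_cmul (ofR d) (dfj _))).1.
- move=> l z Uz.
  have hj : domX (s + 2 * r) (2 * r) (zt + 2 * r) (jsc d (fun=> 0) z).
    by apply: jsc_dom => // i; rewrite nrm0 ltW.
  have hb v' : nrm v' <= 1 -> nrm ('d f (jsc d (fun=> 0) z) v') <= torus_rate * expR (- a * xre z).
    move=> hv'; apply: le_trans (fd_bound hj hv') _.
    by apply: ler_wpM2r => //; exact: expR_ge0.
  have hee := expR_ge0 (- a * xre z).
  case: l => l; rewrite /torus_rhs; last first.
    rewrite nrmN nrmM nrm_ofR ger0_norm // -mulrA ler_wpM2l //.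
    exact/hb/nrm_vq.
  rewrite big1 => [|m _]; last by rewrite mulr0.
  rewrite mulr0 add0r nrmM nrm_ofR ger0_norm ?exprn_ge0 // -mulrA.
  apply: ler_pM; rewrite ?nrm_ge0 ?exprn_ge0 //; last exact/hb/nrm_vp.
  by rewrite expr2 ler_piMl.
- move=> l z u u' c Uz hu hu' hc.
  have c0 : 0 <= c.
    by apply: le_trans (hc l); exact: nrm_ge0.
  (* [fdj_lip] needs increments of at most r / 4. As [u] and [u'] are both bounded by r / 8,
     truncating [c] costs nothing. *)
  pose c' := Num.min c (r / 4).
  have c'0 : 0 <= c' <= r / 4.
    by rewrite /c' le_min c0 divr_ge0 ?(ltW r_gt0) //= ge_min lexx orbT.
  have hc' i : nrm (u i - u' i) <= c'.
    rewrite le_min hc /=; apply: le_trans (nrmB _ _) _; apply: le_trans (lerD (hu i) (hu' i)) r4.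
  have c'c : c' <= c by rewrite ge_min lexx.
  have hur i : nrm (u i) <= r by apply: le_trans (hu i) r8.
  have hur' i : nrm (u' i) <= r by apply: le_trans (hu' i) r8.
  have hf v' : nrm v' <= 1 ->
     nrm ('d f (jsc d u z) v' - 'd f (jsc d u' z) v') <= fLip * exp_edge * c.
    move=> hv'; apply: le_trans (fdj_lip hd Uz c'0 hur hur' hc' hv') _.
    by rewrite ler_wpM2l // mulr_ge0 ?fLip_ge0 ?exp_edge_ge0.
  case: l => l; rewrite /torus_rhs; last first.
    rewrite -opprD -mulrBr nrmN nrmM nrm_ofR ger0_norm // -mulrA ler_wpM2l //.
    apply: le_trans (hf _ (nrm_vq l)) _.
    by rewrite ler_wpM2r.
  rewrite opprD addrACA -!mulrBr -sumrB.
  have hS : nrm (\sum_(i < n) (Gamma l i * u (inr i) - Gamma l i * u' (inr i))) <= n%:R * g * c.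
    apply: le_trans (nrm_sumC _) _.
    have -> : n%:R * g * c = \sum_(i < n) (g * c).
      by rewrite sumr_const card_ord -mulrA mulr_natl.
    apply: ler_sum => i _; rewrite -mulrBr nrmM.
    by apply: ler_pM; rewrite ?nrm_ge0.
  apply: le_trans (nrmD _ _) _.
  rewrite !nrmM !nrm_ofR !ger0_norm ?exprn_ge0 // -mulrA.
  have h1 : d * nrm (\sum_(i < n) (Gamma l i * u (inr i) - Gamma l i * u' (inr i)))
      <= d * (n%:R * g * c) by rewrite ler_wpM2l.
  have h2 : d ^+ 2 * nrm ('d f (jsc d u z) (vp l) - 'd f (jsc d u' z) (vp l)) <=
      d * (fLip * exp_edge * c).
    apply: ler_pM; rewrite ?nrm_ge0 ?exprn_ge0 //; last exact/hf/nrm_vp.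
    by rewrite expr2 ler_piMl.
  apply: le_trans (lerD h1 h2) _.
  by rewrite -mulrDr -mulrDl; apply: ler_wpM2l => //; apply: ler_wpM2r.
have hr i z : U z -> nrm (v i z) <= r / 8.
  move=> Uz; have [_ h _ _] := hv i; apply: le_trans (h z Uz) _; apply: le_trans kr.
  apply: ler_wpM2l; last exact: exp_xre.
  by rewrite divr_ge0 ?(ltW a_gt0) // mulr_ge0.
have hd1 (c : C) : nrm (ofR d * c) <= nrm c.
  by rewrite nrmM nrm_ofR ger0_norm // ler_piMl ?nrm_ge0.
exists (fun l => v (inl l)), (fun l z => ofR d * v (inr l) z); split.
(* Undoing the scaling moves one factor d inside the sum over Gamma and gives the momentum equation
   its second factor d. *)
- move=> l; have [h1 h2 h3 h4] := hv (inl l); split => //; last by move=> m z Uz; apply: h4 => //; exists m.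
  move=> z Uz; rewrite (h3 z Uz) /torus_rhs; congr (_ + _).
  by rewrite mulr_sumr; apply: eq_bigr => m _; rewrite mulrCA.
- move=> l; have [h1 h2 h3 h4] := hv (inr l); split.
  + by move=> z Uz; exact: (isD_cmul (ofR d) (isD_diff (h1 z Uz))).1.
  + by move=> z Uz; apply: le_trans (hd1 _) (h2 z Uz).
  + move=> z Uz; have [_ ->] := isD_cmul (ofR d) (isD_diff (h1 z Uz)).
    by rewrite (h3 z Uz) /torus_rhs mulrN mulrA -rmorphM.
  + by move=> m z Uz; rewrite h4 //; exists m.
- move=> l z Uz; split; first exact: hr.
  by apply: le_trans (hd1 _) _; exact: hr.
Qed.

End Torus.

(** * Inversion of near-identity maps *)

Section NearIdentity.
Context {R : realType} {C : cxType R} {n : nat}.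
Local Notation E := ('cV[C]_n * C)%type.
Context (x : 'I_n -> E -> C) (s zt r B : R).
Hypotheses (r_gt0 : 0 < r) (B_ge0 : 0 <= B) (B_small : 128 * B <= r).
Hypothesis x_holo : forall l, holoU (baseU (s + r) (zt + r)) (x l).
Hypothesis x_bound : forall l z, baseU (s + r) (zt + r) z -> nrm (x l z) <= B.
Hypothesis x_per : forall l m z, baseU (s + r) (zt + r) z -> x l (z + (per m, 0)) = x l z.
Local Notation U := (baseU s zt).

Definition qshift (z : E) (h : 'I_n -> C) : E := (z.1 + \col_l h l, z.2).

Lemma coord_ball l z : U z -> holo_ball (x l) z r B.
Proof.
by move=> Uz; split=> // y /ltW hy; [apply: x_holo|apply: x_bound]; exact: baseU_grow Uz hy.
Qed.

Lemma nrm_qshift (z : E) h h' (c : R) : 0 <= c -> (forall l, nrm (h l - h' l) <= c) ->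
  nrm (qshift z h - qshift z h') <= c.
Proof.
move=> c0 hc.
have -> : qshift z h - qshift z h' = (\col_l (h l - h' l), 0).
  apply: injective_projections => /=; last by rewrite subrr.
  by apply/colP => i; rewrite !mxE opprD addrACA subrr add0r.
by rewrite nrm_pair_le nrm0 c0 andbT; exact: nrm_colf.
Qed.

Lemma qshift0 (z : E) : qshift z (fun=> 0) = z.
Proof.
by apply: injective_projections => //=; apply/colP => i; rewrite !mxE addr0.
Qed.

Lemma nrm_qshift0 (z : E) h (c : R) : 0 <= c -> (forall l, nrm (h l) <= c) ->
  nrm (qshift z h - z) <= c.
Proof.
by move=> c0 hc; rewrite -{2}(qshift0 z); apply: nrm_qshift => // l; rewrite subr0.
Qed.

(** This is what [B_small] is made for: the Lipschitz constant [64 * B / r] of [lipschitz_ball] is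
    at most 1 / 2. *)
Lemma coord_contract l (z : E) h h' (c : R) : U z -> (forall i, nrm (h i) <= r / 4) ->
  (forall i, nrm (h' i) <= r / 4) -> (forall i, nrm (h i - h' i) <= c) ->
  nrm (x l (qshift z h) - x l (qshift z h')) <= 2^-1 * c.
Proof.
move=> Uz h1 h2 hc; have c0 : 0 <= c by apply: le_trans (hc l); exact: nrm_ge0.
have r0 := r_gt0.
have r4 : 0 <= r / 4 by rewrite divr_ge0 // ltW.
have e : qshift z h' + (qshift z h - qshift z h') = qshift z h by rewrite addrC subrK.
rewrite -{1}e.
apply: le_trans (lipschitz_ball (coord_ball l Uz) _ _) _.
- by apply: le_lt_trans (nrm_qshift0 z r4 h2) _; lra.
- by rewrite e; apply: le_lt_trans (nrm_qshift0 z r4 h1) _; lra.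
apply: ler_pM; rewrite ?nrm_ge0 //.
- by rewrite divr_ge0 ?(ltW r0) // mulr_ge0.
- by move: B_small => b0; rewrite ler_pdivrMr //; lra.
exact: nrm_qshift.
Qed.

Lemma near_identity_unique (z : E) h h' : U z -> (forall i, nrm (h i) <= r / 4) ->
  (forall i, nrm (h' i) <= r / 4) -> (forall i, h i = - x i (qshift z h)) ->
  (forall i, h' i = - x i (qshift z h')) -> forall i, h i = h' i.
Proof.
move=> Uz h1 h2 e1 e2.
have key k : forall i, nrm (h i - h' i) <= (r / 2) * 2^-1 ^+ k.
  elim: k => [|k IH] i.
    rewrite expr0 mulr1; apply: le_trans (nrmB _ _) _.
    by have := h1 i; have := h2 i; lra.
  rewrite e1 (e2 i) -opprD nrmN; apply: le_trans (coord_contract i Uz h1 h2 IH) _.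
  by rewrite exprS mulrCA.
by move=> i; apply/eqP; rewrite -subr_eq0; apply/eqP; apply: (nrm_half_limit (B := r / 2)) => k.
Qed.

Fixpoint inv_iter k (l : 'I_n) (z : E) : C :=
  if k is k'.+1 then - x l (qshift z (fun m => inv_iter k' m z)) else 0.

Lemma B_le_r4 : B <= r / 4. Proof. by move: r_gt0 B_small => r0 b0; lra. Qed.

Lemma qshift_base z h : U z -> (forall i, nrm (h i) <= B) -> baseU (s + r) (zt + r) (qshift z h).
Proof.
move=> Uz hh; apply: baseU_grow Uz _; apply: le_trans (nrm_qshift0 z B_ge0 hh) _.
by move: r_gt0 B_small => r0 b0; lra.
Qed.

Lemma inv_iter_bound k l z : U z -> nrm (inv_iter k l z) <= B.
Proof.
elim: k l => [|k IH] l Uz /=; first by rewrite nrm0.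
by rewrite nrmN; apply: x_bound; apply: qshift_base => // i; exact: IH.
Qed.

Lemma isD_qshift (g : 'I_n -> E -> C) (z : E) : (forall l, differentiable (g l) z) ->
  isD (fun z => qshift z (fun l => g l z)) z
    (fun v : E => (v.1 + \col_l 'd (g l) z v, v.2)).
Proof.
move=> dg; apply: isD_pair; last exact: isD_snd.
apply: isD_add; first exact: isD_fst.
apply: isD_col => l; apply: (isD_eqf (F := g l)) => [|t]; last by rewrite mxE.
by apply: isD_ext (isD_diff (dg l)) _ => v; rewrite mxE.
Qed.

Lemma inv_iter_holo k l z : U z -> differentiable (inv_iter k l) z.
Proof.
elim: k l => [|k IH] l Uz; first exact: differentiable_cst.
have hd := isD_qshift (fun m => IH m Uz).
have hx : differentiable (x l) (qshift z (fun m => inv_iter k m z)).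
  by apply: x_holo; apply: qshift_base => // i; exact: inv_iter_bound.
exact: (isD_opp (isD_comp hd (isD_diff hx))).1.
Qed.

Lemma inv_iter_step k l z : U z ->
  nrm (inv_iter k.+1 l z - inv_iter k l z) <= B * 2^-1 ^+ k.
Proof.
move=> Uz; elim: k l => [|k IH] l.
  by rewrite subr0 expr0 mulr1; exact: inv_iter_bound.
have hb j i : nrm (inv_iter j i z) <= r / 4 by apply: le_trans (inv_iter_bound j i Uz) B_le_r4.
rewrite [X in nrm (X - _)]/= [X in nrm (_ - X)]/= -opprD nrmN.
by apply: le_trans (coord_contract l Uz (hb k.+1) (hb k) IH) _; rewrite exprS mulrCA.
Qed.

(** The inverse of theta |-> theta + x is q |-> q + g with g = - x (q + g), a fixed point of the
    contraction. The iterates are holomorphic and uniformly bounded, hence so is the limit by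
    [holo_limit]; periodicity follows from uniqueness of the fixed point. *)
Theorem near_identity_inverse : exists g : 'I_n -> E -> C,
  [/\ forall l, holoU U (g l), forall l z, U z -> nrm (g l z) <= B,
      forall l z, U z -> g l z = - x l (qshift z (fun m => g m z)) &
      forall l m z, U z -> g l (z + (per m, 0)) = g l z].
Proof.
have lim l z : exists c, U z -> forall k, nrm (c - inv_iter k l z) <= 4 * B * 2^-1 ^+ k.
  have [Uz|nUz] := pselect (U z); last by exists 0.
  by have [c hc] := geometric_limit (fun k => inv_iter_step k l Uz); exists c.
pose g l z := sval (cid (lim l z)).
have hg l z k : U z -> nrm (g l z - inv_iter k l z) <= 4 * B * 2^-1 ^+ k.
  by move=> Uz; exact: (svalP (cid (lim l z)) Uz).
have gB l z : U z -> nrm (g l z) <= B.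
  move=> Uz; apply: (@le_half_limit _ _ _ (4 * B)) => k.
  rewrite -(subrK (inv_iter k l z) (g l z)) addrC; apply: le_trans (nrmD _ _) _.
  by apply: lerD; [exact: inv_iter_bound|exact: hg].
have gE l z : U z -> g l z = - x l (qshift z (fun m => g m z)).
  move=> Uz; apply/eqP; rewrite -subr_eq0; apply/eqP.
  apply: (@nrm_half_limit _ _ _ (2 * B + 2 * B)) => k.
  have -> : g l z - - x l (qshift z (fun m => g m z)) = (g l z - inv_iter k.+1 l z) +
    (x l (qshift z (fun m => g m z)) - x l (qshift z (fun m => inv_iter k m z))).
    by rewrite /=; ring.
  apply: le_trans (nrmD _ _) _; rewrite [leRHS]mulrDl; apply: lerD.
    by apply: le_trans (hg l z k.+1 Uz) _; rewrite exprS le_eqVlt; apply/orP; left; apply/eqP; field.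
  have hb i : nrm (g i z) <= r / 4 by apply: le_trans (gB i z Uz) B_le_r4.
  have hb' i : nrm (inv_iter k i z) <= r / 4 by apply: le_trans (inv_iter_bound k i Uz) B_le_r4.
  apply: le_trans (coord_contract l Uz hb hb' (fun i => hg i z k Uz)) _.
  by rewrite le_eqVlt; apply/orP; left; apply/eqP; field.
exists g; split=> //.
- move=> l z Uz; have [e e0 he] := baseU_open Uz.
  have hb k : holo_ball (inv_iter k l) z e B.
    by split=> // y hy; [exact/inv_iter_holo/he|exact/inv_iter_bound/he].
  have hd k y : nrm (y - z) < e -> nrm (g l y - inv_iter k l y) <= 4 * B * 2^-1 ^+ k.
    by move=> hy; exact/hg/he.
  by have [h _] := holo_limit hb hd.
move=> l m z Uz; have Uz' := baseU_per m Uz.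
apply: (near_identity_unique (z := z) (h := fun i => g i (z + (per m, 0))) (h' := fun i => g i z) Uz).
- by move=> i; apply: le_trans (gB i _ Uz') B_le_r4.
- by move=> i; apply: le_trans (gB i _ Uz) B_le_r4.
- move=> i; rewrite {1}gE //; congr (- _).
  have -> : qshift (z + (per m, 0)) (fun i => g i (z + (per m, 0))) =
     qshift z (fun i => g i (z + (per m, 0))) + (per m, 0).
    apply: injective_projections => /=; rewrite ?addr0 //.
    by rewrite addrAC.
  by apply: x_per; apply: qshift_base => // j; exact: gB.
- by move=> i; exact: gE.
Qed.

End NearIdentity.

(** * Isotropy of the torus and its cotangent lift *)

Section CartanAlgebra.
Context {R : realType} {C : cxType R} {n : nat}.

(** Cartan's formula in coordinates. By the Hamilton equations w contracts to zero with d(y dphi - h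
    dxi), so the Lie derivative of the form along w is d of its value on w; [Aw] cancels it. For
    constant w this Lie derivative is D_w of the coefficients. *)
Lemma cartan_transport (y yw yv pw pv dw dv : 'I_n -> C) (hw hv c xv Aw : C) :
  (forall l, dw l = dv l) -> Aw = - (\sum_l (yv l * pw l + y l * dv l) - hv) ->
  hv = \sum_l (pw l * yv l - yw l * pv l) + c * xv -> hw = c ->
  \sum_l (yw l * pv l + y l * dw l) - hw * xv + Aw = 0.
Proof.
move=> /funext -> -> -> ->; rewrite !big_split /= sumrN.
have -> : \sum_i pw i * yv i = \sum_i yv i * pw i by apply: eq_bigr => i _; rewrite mulrC.
by ring.
Qed.

(** A form that is exact is closed: subtracting the derivatives of its two components cancels the
    symmetric second derivatives of phi and of A. *)
Lemma cartan_antisym (y yu yv pu pv duv dvu : 'I_n -> C) (hu hv xu xv Au Av : C) :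
  (forall l, duv l = dvu l) -> Au = Av ->
  \sum_l (yu l * pv l + y l * duv l) - hu * xv + Au = 0 ->
  \sum_l (yv l * pu l + y l * dvu l) - hv * xu + Av = 0 ->
  \sum_l (yu l * pv l - yv l * pu l) = hu * xv - hv * xu.
Proof.
move=> /funext -> ->; rewrite sumrB !big_split /=.
move: (\sum_i yu i * pv i) (\sum_i yv i * pu i) (\sum_i y i * dvu i) => A B D e1 e2.
have e : (A + D - hu * xv + Av) - (B + D - hv * xu + Av) = 0 by rewrite e1 e2 subrr.
by apply: subr0_eq; rewrite -[RHS]e; ring.
Qed.

End CartanAlgebra.

Section Isotropic.
Context {R : realType} {C : cxType R} {V : normedModType C} {n : nat}.
Context (w : V) (xr : V -> R) (U U' : set V) (a r : R) (xi : V -> C).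
Hypotheses (a_gt0 : 0 < a) (r_gt0 : 0 < r).
Hypothesis xr_w : forall z (s : R), xr (z + ofR s *: w) = xr z + s.
Hypothesis xr_lip : forall y z, `|xr y - xr z| <= nrm (y - z).
Hypothesis U_w : forall z (s : R), U z -> 0 <= s -> U (z + ofR s *: w).
Hypothesis U_open : forall z, U z -> exists2 d : R, 0 < d & forall y, nrm (y - z) < d -> U y.
Hypothesis U'_w : forall z (s : R), U' z -> 0 <= s -> U' (z + ofR s *: w).
Hypothesis U'_open : forall z, U' z -> exists2 d : R, 0 < d & forall y, nrm (y - z) < d -> U' y.
Hypothesis U_ball : forall z y, U' z -> nrm (y - z) < r -> U y.
Context (phi y : 'I_n -> V -> C) (h c : V -> C) (My Mh : R).
Hypothesis phi_holo : forall l, holoU U (phi l).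
Hypothesis y_holo : forall l, holoU U (y l).
Hypothesis h_holo : holoU U h.
Hypothesis y_decays : forall l, decays xr U a My (y l).
Hypothesis h_decays : decays xr U a Mh h.
Hypothesis phi_bounded : forall v, exists2 B : R, 0 <= B &
  forall l z, U z -> nrm ('d (phi l) z v) <= B.
Hypotheses (My_ge0 : 0 <= My) (Mh_ge0 : 0 <= Mh).
Hypothesis xi_w : xi w = 1.
Hypothesis hamilton : forall z v, U z ->
  'd h z v = \sum_(l < n) ('d (phi l) z w * 'd (y l) z v - 'd (y l) z w * 'd (phi l) z v)
             + c z * xi v.

(* The Poincare-Cartan form y dphi - h dxi. *)
Definition cartan v z := \sum_(l < n) y l z * 'd (phi l) z v - h z * xi v.

Lemma isD_cartan v z : U z -> isD (cartan v) z (fun u =>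
  \sum_(l < n) ('d (y l) z u * 'd (phi l) z v + y l z * 'd (fun t => 'd (phi l) t v) z u)
   - 'd h z u * xi v).
Proof.
move=> Uz.
have d2 l : isD (fun t => 'd (phi l) t v) z _ := isD_diff (holoU_derive U_open v (phi_holo l) Uz).
have h1 : isD (fun z => \sum_(l < n) y l z * 'd (phi l) z v) z _ :=
  isD_sum (fun l => isD_mul (isD_diff (y_holo l Uz)) (d2 l)).
have h2 : isD (fun z => h z * xi v) z _ := isD_mul (isD_diff (h_holo Uz)) (isD_cst (xi v) z).
apply: isD_ext; first exact: isD_sub h1 h2.
by move=> u /=; rewrite mulr0 addr0.
Qed.

Lemma cartan_decays v : exists2 M : R, 0 <= M & decays xr U a M (cartan v).
Proof.
have [B B0 hB] := phi_bounded v.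
exists (n%:R * (My * B) + Mh * nrm (xi v)).
  by apply: addr_ge0; rewrite !mulr_ge0 ?nrm_ge0.
move=> z Uz; apply: le_trans (nrmB _ _) _; rewrite mulrDl; apply: lerD; last first.
  rewrite nrmM mulrAC; apply: ler_wpM2r; [exact: nrm_ge0|exact: h_decays].
apply: le_trans (nrm_sumC _) _.
have -> : n%:R * (My * B) * expR (- a * xr z) = \sum_(l < n) (My * expR (- a * xr z) * B).
  by rewrite sumr_const card_ord -[RHS]mulr_natl; ring.
apply: ler_sum => l _; rewrite nrmM; apply: ler_pM; rewrite ?nrm_ge0 //; last exact: hB.
exact: y_decays.
Qed.

(** Cauchy's estimate on balls of radius [r] costs the passage from [U] to [U'] and the factor e^(a
    r) in the weight, but no rate of decay. *)
Lemma derive_decays A M v : 0 <= M -> holoU U A -> decays xr U a M A ->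
  exists2 M' : R, 0 <= M' & decays xr U' a M' (fun z => 'd A z v).
Proof.
move=> M0 hA dA; exists (16 * (M * expR (a * r)) / r * nrm v).
  by rewrite mulr_ge0 ?nrm_ge0 // divr_ge0 ?(ltW r_gt0) // !mulr_ge0 ?expR_ge0.
move=> z Uz.
have hb : holo_ball A z r (M * expR (a * r) * expR (- a * xr z)).
  split=> // t ht; first by apply: hA; exact: U_ball ht.
  apply: le_trans (dA t (U_ball Uz ht)) _; rewrite -mulrA -expRD ler_wpM2l // ler_expR.
  have := xr_lip t z; rewrite ler_norml => /andP[h1 _].
  have h2 : a * (xr z - xr t) <= a * r by rewrite ler_pM2l //; move: (ltW ht) => h3; lra.
  by move: h2; rewrite mulrBr !mulNr; lra.
apply: le_trans (cauchy_dir v hb) _.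
by rewrite le_eqVlt; apply/orP; left; apply/eqP; field; rewrite gt_eqF.
Qed.

Theorem isotropic u v z : U' z ->
  \sum_(l < n) ('d (y l) z u * 'd (phi l) z v - 'd (y l) z v * 'd (phi l) z u) =
  'd h z u * xi v - 'd h z v * xi u.
Proof.
move=> Uz'.
have U'U t : U' t -> U t by move=> h1; apply: U_ball h1 _; rewrite subrr nrm0.
have [M M0 hM] := cartan_decays w.
have hN : holoU U (cartan w) by move=> t Ut; exact: (isD_cartan w Ut).1.
(* [A] solves D_w A = - (value of the form on w); adding dA makes the form vanish on w and be
   constant along it. *)
have [A [A1 A2 A3]] := transport_exists a_gt0 xr_w xr_lip U_w U_open M0 hN hM.
have hA v' t : U t -> holo (fun t => 'd A t v') t.
  by move=> Ut; apply: (holoU_holo U_open _ Ut); exact: holoU_derive.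
pose G v' t := cartan v' t + 'd A t v'.
have isDG v' t : U t -> isD (G v') t (fun u' =>
  (\sum_(l < n) ('d (y l) t u' * 'd (phi l) t v' + y l t * 'd (fun t => 'd (phi l) t v') t u')
   - 'd h t u' * xi v') + 'd (fun t => 'd A t v') t u').
  move=> Ut; apply: isD_add; first exact: isD_cartan.
  exact/isD_diff/(holoU_derive U_open).
have symphi l t u' v' : U t ->
  'd (fun t => 'd (phi l) t v') t u' = 'd (fun t => 'd (phi l) t u') t v'.
  by move=> Ut; apply: diff_sym; exact: (holoU_holo U_open (phi_holo l) Ut).
have symA t u' v' : U t -> 'd (fun t => 'd A t v') t u' = 'd (fun t => 'd A t u') t v'.
  by move=> Ut; apply: diff_sym; exact: (holoU_holo U_open A1 Ut).
have Aw t v' : U t -> 'd (fun t => 'd A t w) t v' =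
  - (\sum_(l < n) ('d (y l) t v' * 'd (phi l) t w + y l t * 'd (fun t => 'd (phi l) t w) t v')
   - 'd h t v').
  move=> Ut; have [e e0 he] := U_open Ut.
  have := isD_ball (isD_opp (isD_cartan w Ut)) e0 (fun s hs => A2 s (he s hs)).
  move=> [_ /(_ v') H]; apply: etrans H _.
  exact: (congr1 (fun k => - (_ - k)) (etrans (congr1 _ xi_w) (mulr1 _))).
have hw t : U t -> 'd h t w = c t.
  move=> Ut; apply: etrans (hamilton w Ut) _; rewrite xi_w mulr1 big1 ?add0r // => l _.
  exact: (etrans (congr1 (fun k => k - _) (mulrC _ _)) (subrr _)).
(* Uniqueness is applied on [U'], which is forward invariant too, because the derivative of [A] is
   known to decay only there. *)
have G0 v' t : U' t -> G v' t = 0.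
  have [M1 M10 hM1] := cartan_decays v'.
  have M'0 : 0 <= 2 * (M / a) by rewrite mulr_ge0 // divr_ge0 // ltW.
  have [M2 M20 hM2] := derive_decays v' M'0 A1 A3.
  apply: (transport_unique a_gt0 xr_w U'_w (B := M1 + M2)).
  - by move=> s Us; exact: (isDG v' s (U'U s Us)).1.
  - move=> s Us; apply: le_trans (nrmD _ _) _; rewrite mulrDl.
    by apply: lerD; [exact/hM1/U'U|exact: hM2].
  move=> s /U'U Us; apply: etrans ((isDG v' s Us).2 w) _.
  apply: (cartan_transport (fun l => symphi l s w v' Us) _ (hamilton v' Us) (hw s Us)).
  exact: etrans (symA s w v' Us) (Aw s v' Us).
have [e e0 he] := U'_open Uz'.
have dG v' u' : 'd (G v') z u' = 0.
  exact: (isD_ball (isD_cst (0 : C) z) e0 (fun s hs => G0 v' s (he s hs))).2.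
have Uz := U'U z Uz'.
exact: (cartan_antisym (fun l => symphi l z u v Uz) (symA z u v Uz)
  (etrans (esym ((isDG v z Uz).2 u)) (dG v u)) (etrans (esym ((isDG u z Uz).2 v)) (dG u v))).
Qed.

End Isotropic.

Section LiftAlgebra.
Context {R : realType} {C : cxType R} {n : nat}.

(** Duality between D^T and D, with the xi-derivative [T] as an extra column: pairing the lifted
    momentum with a velocity equals pairing P with the image of the velocity. *)
Lemma sum_swap (P T a : 'I_n -> C) (D : 'I_n -> 'I_n -> C) (b : C) :
  \sum_l (\sum_m P m * D m l) * a l + (\sum_m P m * T m) * b =
  \sum_m P m * (\sum_l D m l * a l + T m * b).
Proof.
rewrite (eq_bigr (fun l => \sum_m P m * (D m l * a l))); last first.
  by move=> l _; rewrite mulr_suml; apply: eq_bigr => m _; rewrite mulrA.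
rewrite exchange_big /= mulr_suml -big_split /=; apply: eq_bigr => m _.
by rewrite mulrDr mulr_sumr mulrA.
Qed.

(** Three facts make the lift symplectic: isotropy cancels the terms in y and h, the derivative of
    psi o phi = id turns the terms linear in dP into dP paired with dtheta, and the symmetry of the
    second derivatives of psi cancels the terms with coefficient P. *)
Lemma symplectic_lift (Yu Yv au av Pu Pv P T Tu Tv tu tv : 'I_n -> C)
    (D Du Dv : 'I_n -> 'I_n -> C) (hu hv xu xv Eu Ev : C) :
  \sum_l (Yu l * av l - Yv l * au l) = hu * xv - hv * xu ->
  (forall m, \sum_l D m l * av l + T m * xv = tv m) ->
  (forall m, \sum_l D m l * au l + T m * xu = tu m) ->
  (forall m, \sum_l Du m l * av l + Tu m * xv = \sum_l Dv m l * au l + Tv m * xu) ->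
  \sum_l (Yu l + (\sum_m Pu m * D m l + \sum_m P m * Du m l)) * av l
  - \sum_l au l * (Yv l + (\sum_m Pv m * D m l + \sum_m P m * Dv m l))
  + ((Eu + (\sum_m Pu m * T m + \sum_m P m * Tu m) - hu) * xv
     - xu * (Ev + (\sum_m Pv m * T m + \sum_m P m * Tv m) - hv)) =
  \sum_m Pu m * tv m - \sum_m tu m * Pv m + (Eu * xv - xu * Ev).
Proof.
move=> iso cv cu sy.
have e1 := sum_swap Pu T av D xv; have e2 := sum_swap P Tu av Du xv.
have e3 := sum_swap Pv T au D xu; have e4 := sum_swap P Tv au Dv xu.
rewrite (eq_bigr _ (fun m _ => congr1 (fun c => Pu m * c) (cv m))) in e1.
rewrite (eq_bigr _ (fun m _ => congr1 (fun c => Pv m * c) (cu m))) in e3.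
have e5 : \sum_m P m * (\sum_l Du m l * av l + Tu m * xv) =
          \sum_m P m * (\sum_l Dv m l * au l + Tv m * xu).
  by apply: eq_bigr => m _; rewrite sy.
rewrite {}e5 -{}e4 in e2.
have f1 (Y Q Q' b : 'I_n -> C) : \sum_l (Y l + (Q l + Q' l)) * b l =
    \sum_l Y l * b l + (\sum_l Q l * b l + \sum_l Q' l * b l).
  by rewrite -!big_split /=; apply: eq_bigr => l _; ring.
have f2 (Y b : 'I_n -> C) : \sum_l b l * Y l = \sum_l Y l * b l.
  by apply: eq_bigr => l _; rewrite mulrC.
rewrite (f2 _ au) (f2 _ tu) !f1.
rewrite sumrB in iso.
move: e1 e2 e3 iso.
move: (\sum_l (\sum_m Pu m * D m l) * av l) (\sum_l (\sum_m P m * Du m l) * av l).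
move: (\sum_l (\sum_m Pv m * D m l) * au l) (\sum_l (\sum_m P m * Dv m l) * au l).
move: (\sum_m Pu m * T m) (\sum_m P m * Tu m) (\sum_m Pv m * T m) (\sum_m P m * Tv m).
move: (\sum_l Yu l * av l) (\sum_l Yv l * au l) (\sum_m Pu m * tv m) (\sum_m Pv m * tu m).
move=> A1 A2 A3 A4 A5 A6 A7 A8 A9 A10 A11 A12 <- e2 <- iso.
have {}e2 : A12 + A6 * xv - (A10 + A8 * xu) = 0 by rewrite e2 subrr.
have {}iso : A1 - A2 - (hu * xv - hv * xu) = 0 by rewrite iso subrr.
by apply: subr0_eq; rewrite -[RHS]addr0 -{1}e2 -iso; ring.
Qed.

End LiftAlgebra.

Section Lift.
Context {R : realType} {C : cxType R} {n : nat}.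
Local Notation E := ('cV[C]_n * C)%type.
Local Notation Z := ('cV[C]_n * 'cV[C]_n * C * C)%type.
Context (phi y psi : 'I_n -> E -> C) (h : E -> C) (U U' W : set E).

Definition hat (g : 'I_n -> E -> C) (z : E) : E := (\col_l g l z, z.2).
Definition e_theta (l : 'I_n) : E := (delta_mx l 0, 0).
Definition e_xi : E := (0, 1).
Definition base (k : Z) : E := (k.1.1.1, k.1.2).

(** The cotangent lift of (theta, xi) |-> (phi, xi), translated fibrewise by (y, - h). The covector
    (P, E) is pulled back by the inverse map, hence the differentials of psi at the image point; the
    fibres are mapped affinely. *)
Definition cot_lift (k : Z) : Z :=
  (\col_l phi l (base k),
   \col_l (y l (base k) + \sum_m k.1.1.2 m 0 * 'd (psi m) (hat phi (base k)) (e_theta l)),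
   k.1.2,
   k.2 + \sum_m k.1.1.2 m 0 * 'd (psi m) (hat phi (base k)) e_xi - h (base k)).

(** The momentum relative to the torus, pulled back by dphi: this inverts the transposed
    differential of psi. *)
Definition unlift_p (k : Z) (m : 'I_n) : C :=
  \sum_l (k.1.1.2 l 0 - y l (hat psi (base k))) * 'd (phi l) (hat psi (base k)) (e_theta m).

Definition cot_unlift (k : Z) : Z :=
  (\col_m psi m (base k), \col_m unlift_p k m, k.1.2,
   k.2 - \sum_m unlift_p k m * 'd (psi m) (base k) e_xi + h (hat psi (base k))).

Hypothesis U_open : forall z, U z -> exists2 d : R, 0 < d & forall y, nrm (y - z) < d -> U y.
Hypothesis U'_open : forall z, U' z -> exists2 d : R, 0 < d & forall y, nrm (y - z) < d -> U' y.
Hypothesis W_open : forall z, W z -> exists2 d : R, 0 < d & forall y, nrm (y - z) < d -> W y.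
Hypothesis UU' : forall z, U z -> U' z.
Hypothesis phi_holo : forall l, holoU U' (phi l).
Hypothesis y_holo : forall l, holoU U' (y l).
Hypothesis h_holo : holoU U' h.
Hypothesis psi_holo : forall l, holoU W (psi l).
Hypothesis hat_phi : forall z, U z -> W (hat phi z).
Hypothesis hat_psi : forall z, W z -> U' (hat psi z).
Hypothesis psi_phi : forall m z, U z -> psi m (hat phi z) = z.1 m 0.

Lemma linE (L : {linear E -> C}) (v : E) :
  L v = \sum_l L (e_theta l) * v.1 l 0 + L e_xi * v.2.
Proof.
have {1}-> : v = \sum_l v.1 l 0 *: e_theta l + v.2 *: e_xi.
  have e1 : (\sum_l v.1 l 0 *: e_theta l : E) = (v.1, 0).
    have e (F : 'I_n -> E) : \sum_l F l = (\sum_l (F l).1, \sum_l (F l).2).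
      by apply: injective_projections; rewrite /= raddf_sum.
    apply: etrans (e _) _; congr (_, _); last by apply: big1 => i _; exact: mulr0.
    apply/colP => i; rewrite summxE (bigD1 i) //= !mxE !eqxx mulr1.
    rewrite big1 ?addr0 // => j ji; rewrite !mxE eqxx andbT eq_sym (negbTE ji).
    by rewrite mulr0.
  rewrite e1; apply: injective_projections => /=.
    by rewrite scaler0 addr0.
  by rewrite add0r /GRing.scale /= mulr1.
rewrite linearD linear_sum; congr (_ + _); last by rewrite linearZ mulrC.
by apply: eq_bigr => l _; rewrite linearZ mulrC.
Qed.

Lemma isD_hat (g : 'I_n -> E -> C) (z : E) : (forall l, differentiable (g l) z) ->
  isD (hat g) z (fun v : E => (\col_l 'd (g l) z v, v.2)).
Proof.
move=> dg; apply: isD_pair; last exact: isD_snd.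
apply: isD_col => l; apply: (isD_eqf (F := g l)) => [|t]; last by rewrite mxE.
by apply: isD_ext (isD_diff (dg l)) _ => v; rewrite mxE.
Qed.

(** The chain rule for psi o phi = id, an identity on the open set [U], split into angle and time
    components. *)
Lemma psi_chain m (z v : E) : U z ->
  \sum_l 'd (psi m) (hat phi z) (e_theta l) * 'd (phi l) z v + 'd (psi m) (hat phi z) e_xi * v.2
  = v.1 m 0.
Proof.
move=> Uz.
have h1 := isD_hat (fun l => phi_holo l (UU' Uz)).
have h2 := isD_comp h1 (isD_diff (psi_holo m (hat_phi Uz))).
have [e e0 he] := U_open Uz.
have h3 : isD (fun z : E => z.1 m 0) z (fun v => v.1 m 0) := isD_coordF m (isD_fst z).
have h4 := isD_ball h3 e0 (fun t ht => psi_phi m (he t ht)).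
have e3 := etrans (esym (h2.2 v)) (h4.2 v).
rewrite -e3; apply: etrans (esym (linE _ _)); congr (_ + _).
by apply: eq_bigr => l _; rewrite mxE.
Qed.

Lemma cot_liftK (k : Z) : U (base k) -> cot_unlift (cot_lift k) = k.
Proof.
move=> Uk; set z := base k in Uk.
have bK : base (cot_lift k) = hat phi z by [].
have hz : hat psi (hat phi z) = z.
  apply: injective_projections => //=; apply/colP => i.
  by rewrite mxE psi_phi.
have PE m : unlift_p (cot_lift k) m = k.1.1.2 m 0.
  rewrite /unlift_p bK hz.
  rewrite (eq_bigr (fun l => (\sum_j k.1.1.2 j 0 * 'd (psi j) (hat phi z) (e_theta l)) * 'd (phi l) z (e_theta m))); last first.
    by move=> l _; rewrite mxE addrC addKr.
  have := sum_swap (fun j => k.1.1.2 j 0) (fun j => 'd (psi j) (hat phi z) e_xi)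
    (fun l => 'd (phi l) z (e_theta m)) (fun j l => 'd (psi j) (hat phi z) (e_theta l)) 0.
  rewrite mulr0 addr0 => ->.
  rewrite (eq_bigr (fun j => k.1.1.2 j 0 * (e_theta m).1 j 0)); last first.
    by move=> j _; rewrite psi_chain.
  rewrite (bigD1 m) //= mxE !eqxx mulr1 big1 ?addr0 // => j ji.
  by rewrite mxE (negbTE ji) mulr0.
rewrite /cot_unlift bK hz.
apply: injective_projections => /=.
  apply: injective_projections => //=; apply: injective_projections => /=; apply/colP => i.
    by rewrite mxE psi_phi.
  by rewrite mxE PE.
have -> : \sum_m unlift_p (cot_lift k) m * 'd (psi m) (hat phi z) e_xi =
  \sum_m k.1.1.2 m 0 * 'd (psi m) (hat phi z) e_xi by apply: eq_bigr => m _; rewrite PE.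
by rewrite -/z; move: (\sum_m _) (h z) => S q; ring.
Qed.

Lemma isD_base (k : Z) : isD base k (fun v => base v).
Proof.
have h1 := isD_comp (isD_fst k) (isD_fst k.1).
apply: isD_pair; first exact: (isD_comp h1 (isD_fst _)).
exact: (isD_comp (isD_fst k) (isD_snd k.1)).
Qed.

Lemma isD_P (k : Z) m : isD (fun k : Z => k.1.1.2 m 0) k (fun v => v.1.1.2 m 0).
Proof.
have h1 := isD_comp (isD_fst k) (isD_fst k.1).
exact: (isD_coordF m (isD_comp h1 (isD_snd _))).
Qed.

Lemma isD_baseF (F : E -> C) (k : Z) : differentiable F (base k) ->
  isD (fun k => F (base k)) k (fun v => 'd F (base k) (base v)).
Proof. by move=> dF; exact: (isD_comp (isD_base k) (isD_diff dF)). Qed.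

Lemma isD_dpsi (b : E) m (z : E) : U z ->
  isD (fun z => 'd (psi m) (hat phi z) b) z
    (fun v => 'd (fun t => 'd (psi m) t b) (hat phi z) (\col_l 'd (phi l) z v, v.2)).
Proof.
move=> Uz; have h1 := isD_hat (fun l => phi_holo l (UU' Uz)).
exact: (isD_comp h1 (isD_diff (holoU_derive W_open b (psi_holo m) (hat_phi Uz)))).
Qed.

Lemma isD_moment (b : E) (k : Z) : U (base k) ->
  isD (fun k : Z => \sum_m k.1.1.2 m 0 * 'd (psi m) (hat phi (base k)) b) k
    (fun v => \sum_m v.1.1.2 m 0 * 'd (psi m) (hat phi (base k)) b +
      \sum_m k.1.1.2 m 0 * 'd (fun t => 'd (psi m) t b) (hat phi (base k))
         (\col_l 'd (phi l) (base k) (base v), v.1.2)).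
Proof.
move=> Uk.
have h1 m := isD_mul (isD_P k m) (isD_comp (isD_base k) (isD_dpsi b m Uk)).
apply: isD_ext (isD_sum h1) _ => v.
by rewrite -big_split.
Qed.

Lemma isD_cot_lift (k : Z) : U (base k) -> isD cot_lift k (fun v =>
  (\col_l 'd (phi l) (base k) (base v),
   \col_l ('d (y l) (base k) (base v) +
     (\sum_m v.1.1.2 m 0 * 'd (psi m) (hat phi (base k)) (e_theta l) +
      \sum_m k.1.1.2 m 0 * 'd (fun t => 'd (psi m) t (e_theta l)) (hat phi (base k))
         (\col_l 'd (phi l) (base k) (base v), v.1.2))),
   v.1.2,
   v.2 + (\sum_m v.1.1.2 m 0 * 'd (psi m) (hat phi (base k)) e_xi +
      \sum_m k.1.1.2 m 0 * 'd (fun t => 'd (psi m) t e_xi) (hat phi (base k))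
         (\col_l 'd (phi l) (base k) (base v), v.1.2))
     - 'd h (base k) (base v))).
Proof.
move=> Uk; have Uk' := UU' Uk.
have h1 : isD (fun k => \col_l phi l (base k)) k (fun v => \col_l 'd (phi l) (base k) (base v)).
  apply: isD_col => l; apply: (isD_eqf (F := fun k => phi l (base k))) => [|t]; last by rewrite mxE.
  by apply: isD_ext (isD_baseF (phi_holo l Uk')) _ => v; rewrite mxE.
have h2 : isD (fun k : Z => \col_l (y l (base k) +
    \sum_m k.1.1.2 m 0 * 'd (psi m) (hat phi (base k)) (e_theta l))) k (fun v =>
    \col_l ('d (y l) (base k) (base v) +
     (\sum_m v.1.1.2 m 0 * 'd (psi m) (hat phi (base k)) (e_theta l) +
      \sum_m k.1.1.2 m 0 * 'd (fun t => 'd (psi m) t (e_theta l)) (hat phi (base k))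
         (\col_l 'd (phi l) (base k) (base v), v.1.2)))).
  apply: isD_col => l.
  apply: (isD_eqf (F := fun k : Z => y l (base k) +
    \sum_m k.1.1.2 m 0 * 'd (psi m) (hat phi (base k)) (e_theta l))) => [|t]; last by rewrite mxE.
  by apply: isD_ext (isD_add (isD_baseF (y_holo l Uk')) (isD_moment (e_theta l) Uk)) _ => v; rewrite mxE.
have h3 : isD (fun k : Z => k.1.2) k (fun v => v.1.2) := isD_comp (isD_fst k) (isD_snd _).
have h4 := isD_sub (isD_add (isD_snd k) (isD_moment e_xi Uk)) (isD_baseF (h_holo Uk')).
exact: (isD_pair (isD_pair (isD_pair h1 h2) h3) h4).
Qed.

(** Expands the second differential of psi in the direction [b] along the coordinate vectors, the
    only directions that occur in [cot_lift], so that [diff_sym] can be used for arbitrary pairs of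
    directions. *)
Lemma d2psi_lin m (t b u : E) : W t ->
  'd (fun t => 'd (psi m) t b) t u =
  \sum_l 'd (fun t => 'd (psi m) t (e_theta l)) t u * b.1 l 0
  + 'd (fun t => 'd (psi m) t e_xi) t u * b.2.
Proof.
move=> Wt.
have hd c : isD (fun t => 'd (psi m) t c) t _ := isD_diff (holoU_derive W_open c (psi_holo m) Wt).
have h1 := isD_add (isD_sum (fun l => isD_mul (hd (e_theta l)) (isD_cst (b.1 l 0) t)))
  (isD_mul (hd e_xi) (isD_cst b.2 t)).
have h2 := isD_eqf h1 (fun t => linE ('d (psi m) t) b).
apply: etrans (h2.2 u) _; rewrite mulr0 addr0; congr (_ + _).
by apply: eq_bigr => l _; rewrite mulr0 addr0.
Qed.

Lemma d2psi_sym m (t b c : E) : W t ->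
  'd (fun t => 'd (psi m) t b) t c = 'd (fun t => 'd (psi m) t c) t b.
Proof. by move=> Wt; apply: diff_sym; exact: (holoU_holo W_open (psi_holo m) Wt). Qed.

Hypothesis isotropy : forall z u v, U z ->
  \sum_(l < n) ('d (y l) z u * 'd (phi l) z v - 'd (y l) z v * 'd (phi l) z u) =
  'd h z u * v.2 - 'd h z v * u.2.

Definition sympl (u v : Z) : C :=
  \sum_l u.1.1.2 l 0 * v.1.1.1 l 0 - \sum_l u.1.1.1 l 0 * v.1.1.2 l 0
  + (u.2 * v.1.2 - u.1.2 * v.2).

Theorem cot_lift_symplectic (k u v : Z) : U (base k) ->
  sympl ('d cot_lift k u) ('d cot_lift k v) = sympl u v.
Proof.
move=> Uk; have [_ e] := isD_cot_lift Uk; have Wk := hat_phi Uk.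
pose dhat (v : Z) : E := (\col_l 'd (phi l) (base k) (base v), v.1.2).
have := @symplectic_lift R C n
  (fun l => 'd (y l) (base k) (base u)) (fun l => 'd (y l) (base k) (base v))
  (fun l => 'd (phi l) (base k) (base u)) (fun l => 'd (phi l) (base k) (base v))
  (fun m => u.1.1.2 m 0) (fun m => v.1.1.2 m 0) (fun m => k.1.1.2 m 0)
  (fun m => 'd (psi m) (hat phi (base k)) e_xi)
  (fun m => 'd (fun t => 'd (psi m) t e_xi) (hat phi (base k)) (dhat u))
  (fun m => 'd (fun t => 'd (psi m) t e_xi) (hat phi (base k)) (dhat v))
  (fun m => u.1.1.1 m 0) (fun m => v.1.1.1 m 0)
  (fun m l => 'd (psi m) (hat phi (base k)) (e_theta l))
  (fun m l => 'd (fun t => 'd (psi m) t (e_theta l)) (hat phi (base k)) (dhat u))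
  (fun m l => 'd (fun t => 'd (psi m) t (e_theta l)) (hat phi (base k)) (dhat v))
  ('d h (base k) (base u)) ('d h (base k) (base v)) u.1.2 v.1.2 u.2 v.2
  (isotropy (base u) (base v) Uk) (fun m => psi_chain m (base v) Uk)
  (fun m => psi_chain m (base u) Uk).
move=> H; apply: etrans (H _).
  apply: etrans (congr2 sympl (e u) (e v)) _; rewrite /sympl /=.
  congr (_ - _ + _); apply: eq_bigr => l _; by rewrite !mxE.
move=> m.
(* The last premise of [symplectic_lift] is the symmetry of the second differential of psi in the
   directions [dhat u] and [dhat v], the images of u and v under the base map. *)
have h1 b := d2psi_lin m b (dhat u) Wk; have h2 b := d2psi_lin m b (dhat v) Wk.
have := etrans (esym (h1 (dhat v))) (etrans (d2psi_sym m (dhat v) (dhat u) Wk) (h2 (dhat u))).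
move=> h3; apply: etrans (etrans h3 _); congr (_ + _); apply: eq_bigr => l _; by rewrite mxE.
Qed.

Lemma cot_unlift_diff (k : Z) : W (base k) -> differentiable cot_unlift k.
Proof.
move=> Wk; have Uk := hat_psi Wk.
have hh := isD_hat (fun l => psi_holo l Wk).
have hF (F : E -> C) : holoU U' F -> isD (fun k : Z => F (hat psi (base k))) k _ :=
  fun hF => isD_comp (isD_base k) (isD_comp hh (isD_diff (hF _ Uk))).
have hP m : isD (fun k => unlift_p k m) k _ := isD_sum (fun l =>
  isD_mul (isD_sub (isD_P k l) (hF _ (y_holo l)))
    (hF _ (holoU_derive U'_open (e_theta m) (phi_holo l)))).
have h1 : isD (fun k => \col_m psi m (base k)) k (fun v => \col_m 'd (psi m) (base k) (base v)).
  apply: isD_col => l; apply: (isD_eqf (F := fun k => psi l (base k))) => [|t]; last by rewrite mxE.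
  by apply: isD_ext (isD_baseF (psi_holo l Wk)) _ => v; rewrite mxE.
have h2 : isD (fun k => \col_m unlift_p k m) k (fun v => \col_m 'd (fun k => unlift_p k m) k v).
  apply: isD_col => l; apply: (isD_eqf (F := fun k => unlift_p k l)) => [|t]; last by rewrite mxE.
  by apply: isD_ext (isD_diff (hP l).1) _ => v; rewrite mxE.
have h3 : isD (fun k : Z => k.1.2) k (fun v => v.1.2) := isD_comp (isD_fst k) (isD_snd _).
have h5 := isD_sum (fun m => isD_mul (hP m)
   (isD_comp (isD_base k) (isD_diff (holoU_derive W_open e_xi (psi_holo m) Wk)))).
have h4 := isD_add (isD_sub (isD_snd k) h5) (hF _ h_holo).
exact: (isD_pair (isD_pair (isD_pair h1 h2) h3) h4).1.
Qed.

Lemma base_near (k k' : Z) : nrm (base k' - base k) <= nrm (k' - k).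
Proof.
rewrite nrm_pair_le; apply/andP; split.
  apply: le_trans (nrm_fst (k' - k)); apply: le_trans (nrm_fst (k' - k).1).
  exact: (nrm_fst (k' - k).1.1).
apply: le_trans (nrm_fst (k' - k)); exact: (nrm_snd (k' - k).1).
Qed.

Lemma cot_lift_per (k : Z) (t : 'cV[C]_n) :
  (forall l, phi l (base k + (t, 0)) = phi l (base k) + t l 0) ->
  (forall l, y l (base k + (t, 0)) = y l (base k)) -> h (base k + (t, 0)) = h (base k) ->
  (forall m b, 'd (psi m) (hat phi (base k) + (t, 0)) b = 'd (psi m) (hat phi (base k)) b) ->
  cot_lift (k + (t, 0, 0, 0)) = cot_lift k + (t, 0, 0, 0).
Proof.
move=> h1 h2 h3 h4.
have hb : base (k + (t, 0, 0, 0)) = base k + (t, 0) by [].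
have hh : hat phi (base k + (t, 0)) = hat phi (base k) + (t, 0).
  apply: injective_projections => /=; last by rewrite addr0.
  by apply/colP => i; rewrite !mxE h1.
have hS b : \sum_m (k.1.1.2 + 0) m 0 * 'd (psi m) (hat phi (base k) + (t, 0)) b =
    \sum_m k.1.1.2 m 0 * 'd (psi m) (hat phi (base k)) b.
  rewrite addr0; apply: eq_bigr => m _.
  exact: (congr1 (fun c => k.1.1.2 m 0 * c) (h4 m b)).
rewrite /cot_lift hb hh; apply: injective_projections => /=; last first.
  apply: etrans (congr2 (fun b c => k.2 + 0 + b - c) (hS e_xi) h3) _.
  by rewrite !addr0.
apply: injective_projections => /=; last by rewrite addr0.
apply: injective_projections => /=; apply/colP => i; rewrite !mxE; first by rewrite h1.
by apply: etrans (congr2 (fun b c => b + c) (h2 i) (hS (e_theta i))) _; rewrite addr0.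
Qed.

End Lift.

(** * The normal form *)

Section Quadratic.
Context {R : realType} {C : cxType R} {n : nat}.
Local Notation X := ('cV[C]_n * 'cV[C]_n * C)%type.

Definition bil (c : 'M[C]_n) (p p' : 'cV[C]_n) : C := \sum_l (\sum_m c l m * p m 0) * p' l 0.

Lemma bilDl c p p' t : bil c (p + p') t = bil c p t + bil c p' t.
Proof.
rewrite /bil -big_split; apply: eq_bigr => l _ /=; rewrite -mulrDl -big_split.
by congr (_ * _); apply: eq_bigr => m _; rewrite mxE mulrDr.
Qed.

Lemma bilDr c p p' t : bil c t (p + p') = bil c t p + bil c t p'.
Proof. by rewrite /bil -big_split; apply: eq_bigr => l _ /=; rewrite mxE mulrDr. Qed.

Lemma bil_sym (c : 'M[C]_n) p p' : (forall l m, c l m = c m l) -> bil c p p' = bil c p' p.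
Proof.
move=> hc; rewrite /bil.
under eq_bigr do rewrite mulr_suml; rewrite exchange_big /=.
apply: eq_bigr => l _; rewrite mulr_suml; apply: eq_bigr => m _.
by rewrite hc mulrAC.
Qed.

Lemma isD_bil (c : 'M[C]_n) (p : 'cV[C]_n) :
  isD (fun p => bil c p p) p (fun v => bil c v p + bil c p v).
Proof.
have h l := isD_mul (isD_sum (fun m => isD_cmul (c l m) (isD_coord p m))) (isD_coord p l).
by apply: isD_ext (isD_sum h) _ => v; rewrite /bil -big_split.
Qed.

(** For a polynomial of degree at most 2 the second-order expansion is exact. [c2] need not be
    symmetric: differentiation produces both mixed terms. *)
Lemma taylor_quadratic (f : X -> C) (rho : R) (q p t : 'cV[C]_n) (xi c0 : C)
    (c1 : 'cV[C]_n) (c2 : 'M[C]_n) :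
  (forall p', nrm p' < rho -> f (q, p', xi) = c0 + \sum_l c1 l 0 * p' l 0 + bil c2 p' p') ->
  nrm p < rho -> nrm (p + t) < rho -> differentiable f (q, p, xi) ->
  f (q, p + t, xi) = f (q, p, xi) + 'd f (q, p, xi) (0, t, 0) + bil c2 t t.
Proof.
move=> hf hp hpt df.
have h1 := isD_add (isD_add (isD_cst c0 p)
  (isD_sum (fun l => isD_cmul (c1 l 0) (isD_coord p l)))) (isD_bil c2 p).
have rp : 0 < rho - nrm p by rewrite subr_gt0.
have hb p' : nrm (p' - p) < rho - nrm p -> nrm p' < rho.
  by move=> hp'; rewrite -(subrK p p'); apply: le_lt_trans (nrmD _ _) _; rewrite -ltrBrDr.
have h2 : isD (fun p' => f (q, p', xi)) p _ :=
  isD_ball h1 rp (fun p' hp' => hf p' (hb p' hp')).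
have h3 := isD_comp (isD_pair (isD_pair (isD_cst q p) (isD_id p)) (isD_cst xi p)) (isD_diff df).
have h4 := etrans (esym (h3.2 t)) (h2.2 t).
apply: etrans (esym (congr1 (fun c => f (q, p, xi) + c + bil c2 t t) h4)).
rewrite (hf _ hpt) (hf _ hp) bilDl !bilDr add0r.
rewrite (eq_bigr (fun l => c1 l 0 * p l 0 + c1 l 0 * t l 0)); last first.
  by move=> l _; rewrite mxE mulrDr.
rewrite big_split /=; move: (\sum_l c1 l 0 * p l 0) (\sum_l c1 l 0 * t l 0) => A B.
by move: (bil c2 p p) (bil c2 p t) (bil c2 t p) (bil c2 t t) => a b c d; ring.
Qed.

Lemma linXE (L : {linear X -> C}) (v : X) :
  L v = \sum_l L (vq l) * v.1.1 l 0 + \sum_l L (vp l) * v.1.2 l 0 + L (0, 0, 1) * v.2.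
Proof.
have e (F : 'I_n -> X) : \sum_l F l = (\sum_l (F l).1.1, \sum_l (F l).1.2, \sum_l (F l).2).
  apply: injective_projections; rewrite /= ?raddf_sum //.
  by apply: injective_projections; rewrite /= !raddf_sum.
have es (u : 'cV[C]_n) : \sum_l u l 0 *: delta_mx l 0 = u.
  apply/colP => i; rewrite summxE (bigD1 i) //= !mxE !eqxx mulr1.
  rewrite big1 ?addr0 // => j ji; rewrite !mxE eqxx andbT eq_sym (negbTE ji).
  by rewrite mulr0.
have {1}-> : v = \sum_l v.1.1 l 0 *: vq l + \sum_l v.1.2 l 0 *: vp l + v.2 *: (0, 0, 1).
  rewrite (e (fun l => v.1.1 l 0 *: vq l)) (e (fun l => v.1.2 l 0 *: vp l)).
  apply: injective_projections => /=.
    apply: injective_projections => /=; rewrite scaler0 addr0 es.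
      by rewrite big1 ?addr0 // => l _; exact: scaler0.
    by rewrite big1 ?add0r // => l _; exact: scaler0.
  rewrite !big1 ?add0r => [|l _|l _]; [exact: esym (mulr1 _)|exact: mulr0|exact: mulr0].
rewrite !linearD !linear_sum; congr (_ + _ + _).
- by apply: eq_bigr => l _; rewrite linearZ mulrC.
- by apply: eq_bigr => l _; rewrite linearZ mulrC.
by rewrite linearZ mulrC.
Qed.

End Quadratic.

Section Hamiltonian.
Context {R : realType} {C : cxType R} {n : nat}.
Local Notation E := ('cV[C]_n * C)%type.
Local Notation X := ('cV[C]_n * 'cV[C]_n * C)%type.
Context (f : X -> C) (Gamma : 'M[C]_n) (omega : 'cV[R]_n) (eps : C).
Hypothesis Gamma_sym : forall l m, Gamma l m = Gamma m l.

Definition ham0 (v : X) : C :=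
  \sum_l ofR (omega l 0) * v.1.2 l 0 + 2^-1 * bil Gamma v.1.2 v.1.2 + eps * f v.

Lemma isD_ham0 (z : X) : differentiable f z -> isD ham0 z (fun v =>
  \sum_l ofR (omega l 0) * v.1.2 l 0 + bil Gamma z.1.2 v.1.2 + eps * 'd f z v).
Proof.
move=> df.
have hp : isD (fun z : X => z.1.2) z (fun v => v.1.2) := isD_comp (isD_fst z) (isD_snd _).
have h1 := isD_sum (fun l => isD_cmul (ofR (omega l 0)) (isD_coordF l hp)).
have h2 := isD_cmul 2^-1 (isD_comp hp (isD_bil Gamma z.1.2)).
apply: isD_ext (isD_add (isD_add h1 h2) (isD_cmul eps (isD_diff df))) _ => v.
congr (_ + _ + _); rewrite (bil_sym v.1.2 z.1.2 Gamma_sym).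
by move: (bil _ _ _) => b; field.
Qed.

Lemma hamilton_algebra (om G p q Y F : 'I_n -> C) (c xv : C) :
  \sum_l om l * Y l + \sum_l G l * Y l
    + eps * (\sum_l q l * F l + \sum_l p l * Y l + c * xv) =
  \sum_l ((om l + (G l + eps * p l)) * Y l - (- (eps * q l)) * F l) + eps * c * xv.
Proof.
rewrite !mulrDr !mulr_sumr !mulrA [in LHS]addrA -!big_split /=; congr (_ + _).
by apply: eq_bigr => l _; ring.
Qed.

End Hamiltonian.

Section BilinearPullback.
Context {R : realType} {C : cxType R} {n : nat}.

Lemma bilE (c : 'M[C]_n) p p' : bil c p p' = (p'^T *m (c *m p)) 0 0.
Proof. by rewrite mxE; apply: eq_bigr => l _; rewrite !mxE mulrC. Qed.

Lemma bil_pullback (D c : 'M[C]_n) (P : 'cV[C]_n) :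
  bil (D *m c *m D^T) P P = bil c (D^T *m P) (D^T *m P).
Proof. by rewrite !bilE trmx_mul trmxK !mulmxA. Qed.

Lemma bil_lin (c c' : 'M[C]_n) (b b' : C) p p' :
  bil (b *: c + b' *: c') p p' = b * bil c p p' + b' * bil c' p p'.
Proof. by rewrite !bilE mulmxDl mulmxDr -!scalemxAl -!scalemxAr !mxE. Qed.

(** The constant terms cancel against the energy - h in the lift. The terms linear in [rh] form the
    pairing of [rh] with dH/dp, which on the torus is the velocity [dw] of phi; with the term P . T
    of the lifted energy and the chain rule they sum to omega . P. *)
Lemma normal_form_algebra (om rh fp G dw yv P T : 'I_n -> C) (D : 'I_n -> 'I_n -> C)
    (e byy byr brr fJ frr E0 : C) :
  (forall l, rh l = \sum_m P m * D m l) ->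
  (forall m, \sum_l D m l * dw l + T m = om m) ->
  (forall l, dw l = om l + (G l + e * fp l)) -> byr = \sum_l G l * rh l ->
  \sum_l om l * (yv l + rh l) + 2^-1 * (byy + byr + (byr + brr))
    + e * (fJ + \sum_l fp l * rh l + frr)
    + (E0 + \sum_m P m * T m - (\sum_l om l * yv l + 2^-1 * byy + e * fJ)) =
  \sum_l om l * P l + E0 + (2^-1 * brr + e * frr).
Proof.
move=> hr hD hdw ->.
have h1 := sum_swap P T dw D 1; rewrite mulr1 in h1.
have e1 : \sum_m P m * (\sum_l D m l * dw l + T m * 1) = \sum_l om l * P l.
  by apply: eq_bigr => m _; rewrite mulr1 hD mulrC.
have e2 : \sum_l (\sum_m P m * D m l) * dw l =
    \sum_l om l * rh l + \sum_l G l * rh l + e * \sum_l fp l * rh l.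
  by rewrite mulr_sumr -!big_split; apply: eq_bigr => l _ /=; rewrite -hr hdw; ring.
have e3 : \sum_l om l * (yv l + rh l) = \sum_l om l * yv l + \sum_l om l * rh l.
  by rewrite -big_split; apply: eq_bigr => l _ /=; rewrite mulrDr.
rewrite -e1 -h1 e2 e3.
move: (\sum_l om l * yv l) (\sum_l om l * rh l) (\sum_l G l * rh l) (\sum_l fp l * rh l).
by move: (\sum_m P m * T m) => A1 A2 A3 A4 A5; field.
Qed.

End BilinearPullback.

Section NormalForm.
Context {R : realType} {C : cxType R} {n : nat}.
Local Notation E := ('cV[C]_n * C)%type.
Local Notation X := ('cV[C]_n * 'cV[C]_n * C)%type.
Local Notation Z := ('cV[C]_n * 'cV[C]_n * C * C)%type.
Context (f : X -> C) (Gamma : 'M[C]_n) (omega : 'cV[R]_n) (s zt r Mf a g om d B : R).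
Context (x y : 'I_n -> E -> C).
(** Each domain is one [r] wider than the next. [T] carries the torus; on [U'] the derivatives of
    phi are bounded by Cauchy's estimate; [W] carries the isotropy and psi; the normal form lives on
    [U]. phi maps [U] into [W] and psi maps [W] into [U']. *)
Local Notation T := (baseU (C := C) (n := n) (s + r + r + r) (zt + r + r + r)).
Local Notation U' := (baseU (C := C) (n := n) (s + r + r) (zt + r + r)).
Local Notation W := (baseU (C := C) (n := n) (s + r) (zt + r)).
Local Notation U := (baseU (C := C) (n := n) s zt).
Local Notation DX := (domX (C := C) (n := n) (s + r + r + r + 2 * r) (2 * r) (zt + r + r + r + 2 * r)).
Local Notation w := (wvec (C := C) omega).
Local Notation eps := (ofR (d ^+ 2) : C).
Local Notation J z := (jmap (x^~ z) (y^~ z) z).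
Hypotheses (r_gt0 : 0 < r) (r_le1 : r <= 1) (a_gt0 : 0 < a) (zt_gt0 : 0 < zt)
  (Mf_ge0 : 0 <= Mf) (g_ge0 : 0 <= g) (om_ge0 : 0 <= om) (d_ge0 : 0 <= d) (d_le1 : d <= 1)
  (B_ge0 : 0 <= B).
Hypothesis Gamma_sym : forall l m, Gamma l m = Gamma m l.
Hypothesis Gamma_bound : forall l m, nrm (Gamma l m) <= g.
Hypothesis omega_bound : forall l, `|omega l 0| <= om.
Hypothesis f_holo : forall y, DX y -> differentiable f y.
Hypothesis f_bound : forall y, DX y -> nrm (f y) <= Mf * expR (- a * cre y.2).
Hypothesis f_per : forall y l, DX y -> f (y + (per l, 0, 0)) = f y.
Hypothesis x_holo : forall l, holoU T (x l).
Hypothesis y_holo : forall l, holoU T (y l).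
Hypothesis x_decays : forall l, decays xre T a B (x l).
Hypothesis y_decays : forall l, decays xre T a B (y l).
Hypothesis x_per : forall l m z, T z -> x l (z + (per m, 0)) = x l z.
Hypothesis y_per : forall l m z, T z -> y l (z + (per m, 0)) = y l z.
Hypothesis x_eq : forall l z, T z -> 'd (x l) z w =
  \sum_m Gamma l m * y m z + eps * 'd f (J z) (vp l).
Hypothesis y_eq : forall l z, T z -> 'd (y l) z w = - (eps * 'd f (J z) (vq l)).
Hypothesis B_small : 128 * (B * exp_edge (zt + r + r + r) a) <= r.

Local Notation B' := (B * exp_edge (zt + r + r + r) a).

Definition phi l (z : E) : C := z.1 l 0 + x l z.
Definition h0 (z : E) : C := ham0 f Gamma omega eps (J z).

Lemma B'_ge0 : 0 <= B'. Proof. by rewrite mulr_ge0 ?expR_ge0. Qed.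

Lemma B'_le : B' <= r / 8 /\ B' <= r / 4 /\ B' <= r /\ B' <= 1.
Proof.
have b0 := B'_ge0; move: r_gt0 r_le1 B_small b0; move: B' => b r0 r1 h1 h0.
by repeat split; lra.
Qed.

Lemma xb l z : T z -> nrm (x l z) <= B'.
Proof.
move=> Tz; apply: le_trans (x_decays l Tz) _; apply: ler_wpM2l => //.
exact: exp_xre Tz.
Qed.

Lemma yb l z : T z -> nrm (y l z) <= B'.
Proof.
move=> Tz; apply: le_trans (y_decays l Tz) _; apply: ler_wpM2l => //.
exact: exp_xre Tz.
Qed.

Lemma J_dom z : T z -> DX (J z).
Proof.
move=> Tz; have [_ [_ [br _]]] := B'_le; have r0 := r_gt0.
have h : domX (s + r + r + r + r) (r + r) (zt + r + r + r + r) (J z).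
  by apply: jmap_dom => // l; [apply: le_trans (xb l Tz) br|apply: le_trans (yb l Tz) br].
by apply: domXS h; lra.
Qed.

Lemma T_ball z e : T z -> e <= r -> forall t, nrm (t - z) <= e ->
   baseU (s + r + r + r + r) (zt + r + r + r + r) t.
Proof. by move=> Tz er t ht; apply: baseU_grow Tz _; apply: le_trans ht er. Qed.

Lemma phi_holo l : holoU T (phi l).
Proof.
move=> z Tz; exact: (isD_add (isD_coordF l (isD_fst z)) (isD_diff (x_holo l Tz))).1.
Qed.

Lemma dphiE l z v : T z -> 'd (phi l) z v = v.1 l 0 + 'd (x l) z v.
Proof.
by move=> Tz; exact: (isD_add (isD_coordF l (isD_fst z)) (isD_diff (x_holo l Tz))).2.
Qed.

Lemma isD_J z : T z -> isD (fun z => J z) z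
  (fun v => (\col_l 'd (phi l) z v, \col_l 'd (y l) z v, v.2)).
Proof.
move=> Tz; apply: isD_ext (isD_jmap (fun l => x_holo l Tz) (fun l => y_holo l Tz)) _ => v.
congr (_, _, _); apply/colP => l.
rewrite mxE [X in _ + X]mxE [RHS]mxE; exact: esym (dphiE l v Tz).
Qed.

Lemma isD_h0 z : T z -> isD h0 z (fun v =>
  \sum_l ofR (omega l 0) * 'd (y l) z v + \sum_l (\sum_m Gamma l m * y m z) * 'd (y l) z v
  + eps * (\sum_l 'd f (J z) (vq l) * 'd (phi l) z v + \sum_l 'd f (J z) (vp l) * 'd (y l) z v
           + 'd f (J z) (0, 0, 1) * v.2)).
Proof.
move=> Tz.
apply: isD_ext (isD_comp (isD_J Tz) (isD_ham0 omega eps Gamma_sym (f_holo (J_dom Tz)))) _ => v.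
congr (_ + _ + _ * _).
- by apply: eq_bigr => l _; rewrite mxE.
- apply: eq_bigr => l _; rewrite mxE; congr (_ * _).
  by apply: eq_bigr => m _; rewrite mxE.
apply: etrans (linXE _ _) _; congr (_ + _ + _); apply: eq_bigr => l _; by rewrite mxE.
Qed.

Lemma dphi_w l z : T z -> 'd (phi l) z w =
  ofR (omega l 0) + (\sum_m Gamma l m * y m z + eps * 'd f (J z) (vp l)).
Proof.
move=> Tz; apply: etrans (dphiE l w Tz) _; congr (_ + _); last exact: x_eq.
by rewrite mxE.
Qed.

(** Invariance of the torus in infinitesimal form: dH/dp and - dH/dq at the torus are the
    w-derivatives of phi and y, so dh is the contraction required by [isotropic], up to the explicit
    time derivative. *)
Lemma h0_hamilton z v : T z -> 'd h0 z v =
  \sum_(l < n) ('d (phi l) z w * 'd (y l) z v - 'd (y l) z w * 'd (phi l) z v)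
  + eps * 'd f (J z) (0, 0, 1) * v.2.
Proof.
move=> Tz; apply: etrans ((isD_h0 Tz).2 v) _.
apply: etrans (hamilton_algebra eps (fun l => ofR (omega l 0)) (fun l => \sum_m Gamma l m * y m z)
  (fun l => 'd f (J z) (vp l)) (fun l => 'd f (J z) (vq l)) (fun l => 'd (y l) z v)
  (fun l => 'd (phi l) z v) ('d f (J z) (0, 0, 1)) v.2) _; congr (_ + _).
apply: eq_bigr => l _; congr (_ * _ - _ * _); first exact: esym (dphi_w l Tz).
exact: esym (y_eq l Tz).
Qed.

(** The last term uses d^2 <= d: since [B] will be proportional to d, so is the whole constant. *)
Definition Mh := n%:R * (om * B) + n%:R * (n%:R * g * B) + d * Mf.

Lemma Mh_ge0 : 0 <= Mh.
Proof. by rewrite !addr_ge0 ?mulr_ge0 // mulr_ge0. Qed.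

Lemma h0_decays : decays xre T a Mh h0.
Proof.
move=> z Tz; have [_ [_ [_ b1]]] := B'_le.
have e0 : 0 <= expR (- a * xre z) by exact: expR_ge0.
have hy l : nrm (y l z) <= B * expR (- a * xre z) by exact: y_decays.
have nB : 0 <= B * expR (- a * xre z) by rewrite mulr_ge0.
apply: le_trans (nrmD _ _) _; rewrite mulrDl; apply: lerD; last first.
  rewrite nrmM nrm_ofR ger0_norm ?exprn_ge0 // -mulrA.
  apply: ler_pM; rewrite ?exprn_ge0 ?nrm_ge0 //; first by rewrite expr2 ler_piMl.
  exact: (f_bound (J_dom Tz)).
apply: le_trans (nrmD _ _) _; rewrite mulrDl; apply: lerD.
  apply: le_trans (nrm_sumC _) _.
  have -> : n%:R * (om * B) * expR (- a * xre z) = \sum_(l < n) (om * (B * expR (- a * xre z))).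
    by rewrite sumr_const card_ord -[RHS]mulr_natl; ring.
  apply: ler_sum => l _; rewrite nrmM nrm_ofR mxE.
  by apply: ler_pM; rewrite ?nrm_ge0.
rewrite nrmM; apply: (@le_trans _ _ (1 * nrm (bil Gamma (J z).1.2 (J z).1.2))).
  apply: ler_wpM2r; first exact: nrm_ge0.
  have -> : (2^-1 : C) = ofR 2^-1 by rewrite fmorphV rmorph_nat.
  by rewrite nrm_ofR ger0_norm ?invr_ge0 // invf_le1 // ler1n.
rewrite mul1r; apply: le_trans (nrm_sumC _) _.
have -> : n%:R * (n%:R * g * B) * expR (- a * xre z) =
    \sum_(l < n) (n%:R * g * (B * expR (- a * xre z))).
  by rewrite sumr_const card_ord -[RHS]mulr_natl; ring.
apply: ler_sum => l _; rewrite nrmM mxE.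
apply: ler_pM; rewrite ?nrm_ge0 //.
apply: le_trans (nrm_sumC _) _.
have -> : n%:R * g = \sum_(m < n) g by rewrite sumr_const card_ord mulr_natl.
apply: ler_sum => m _; rewrite nrmM mxE; apply: le_trans (_ : g * 1 <= _); last by rewrite mulr1.
apply: ler_pM; rewrite ?nrm_ge0 //.
by apply: le_trans (yb m Tz) b1.
Qed.

Lemma U'T z : U' z -> T z.
Proof. by move: r_gt0 => r0; apply: baseUS; lra. Qed.

Lemma isotropy z u v : W z ->
  \sum_(l < n) ('d (y l) z u * 'd (phi l) z v - 'd (y l) z v * 'd (phi l) z u) =
  'd h0 z u * v.2 - 'd h0 z v * u.2.
Proof.
have T_ball z' t : U' z' -> nrm (t - z') < r -> T t.
  by move=> Uz /ltW ht; exact: baseU_grow Uz ht.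
have U'_ball z' t : W z' -> nrm (t - z') < r -> U' t.
  by move=> Uz /ltW ht; exact: baseU_grow Uz ht.
apply: (@isotropic R C E n w xre U' W a r (fun v => v.2) a_gt0 r_gt0 (xre_w omega) xre_lip
  (fun z t => @baseU_w R C n omega _ _ z t) (fun z => @baseU_open R C n _ _ z)
  (fun z t => @baseU_w R C n omega _ _ z t) (fun z => @baseU_open R C n _ _ z) U'_ball
  phi y h0 (fun z => eps * 'd f (J z) (0, 0, 1)) B Mh).
- by move=> l t /U'T; exact: phi_holo.
- by move=> l t /U'T; exact: y_holo.
- by move=> t /U'T Tt; exact: (isD_h0 Tt).1.
- by move=> l t /U'T; exact: y_decays.
- by move=> t /U'T; exact: h0_decays.
- move=> b; exists (nrm b + 16 * B' / r * nrm b).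
    apply: addr_ge0; first exact: nrm_ge0.
    apply: mulr_ge0; last exact: nrm_ge0.
    by apply: divr_ge0; [rewrite mulr_ge0 ?B'_ge0|exact: ltW r_gt0].
  move=> l t Ut; have hb : holo_ball (x l) t r B'.
    by split=> // t' /(T_ball _ _ Ut) ht; [exact: x_holo|exact: xb].
  apply: (@le_trans _ _ (nrm (b.1 l 0 + 'd (x l) t b))).
    by rewrite le_eqVlt; apply/orP; left; apply/eqP; congr nrm; exact: (dphiE l b (U'T Ut)).
  apply: le_trans (nrmD _ _) _; apply: lerD; last exact: cauchy_dir hb.
  by apply: le_trans (nrm_fst b); exact: nrm_col_ge.
- exact: B_ge0.
- exact: Mh_ge0.
- by [].
- by move=> t b /U'T; exact: h0_hamilton.
Qed.

Context (gg : 'I_n -> E -> C).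
Hypothesis gg_holo : forall l, holoU W (gg l).
Hypothesis gg_bound : forall l z, W z -> nrm (gg l z) <= B'.
Hypothesis gg_eq : forall l z, W z -> gg l z = - x l (qshift z (fun m => gg m z)).
Hypothesis gg_per : forall l m z, W z -> gg l (z + (per m, 0)) = gg l z.

Definition psi l (z : E) : C := z.1 l 0 + gg l z.

Lemma UW z : U z -> W z.
Proof. by move: r_gt0 => r0; apply: baseUS; lra. Qed.
Lemma WU' z : W z -> U' z.
Proof. by move: r_gt0 => r0; apply: baseUS; lra. Qed.
Lemma UU' z : U z -> U' z. Proof. by move=> /UW /WU'. Qed.
Lemma UT z : U z -> T z. Proof. by move=> /UU' /U'T. Qed.

Lemma psi_holo l : holoU W (psi l).
Proof.
move=> z Wz; exact: (isD_add (isD_coordF l (isD_fst z)) (isD_diff (gg_holo l Wz))).1.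
Qed.

Lemma dpsiE l z v : W z -> 'd (psi l) z v = v.1 l 0 + 'd (gg l) z v.
Proof.
by move=> Wz; exact: (isD_add (isD_coordF l (isD_fst z)) (isD_diff (gg_holo l Wz))).2.
Qed.

Lemma hatE (F : 'I_n -> E -> C) z :
  hat (fun l (z : E) => z.1 l 0 + F l z) z = qshift z (fun l => F l z).
Proof.
by apply: injective_projections => //=; apply/colP => i; rewrite !mxE.
Qed.

Lemma hat_phi_near z : U z -> nrm (hat phi z - z) <= r / 8.
Proof.
move=> Uz; have [b8 _] := B'_le; apply: le_trans b8.
by rewrite hatE; apply: nrm_qshift0 => [|l]; [exact: B'_ge0|exact/xb/UT].
Qed.

Lemma hat_phi_W z : U z -> W (hat phi z).
Proof.
move=> Uz; apply: (baseU_grow Uz); apply: le_trans (hat_phi_near Uz) _.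
by move: r_gt0 => r0; lra.
Qed.

Lemma hat_psi_U' z : W z -> U' (hat psi z).
Proof.
move=> Wz; apply: (baseU_grow Wz); have [_ [_ [br _]]] := B'_le; apply: le_trans br.
by rewrite hatE; apply: nrm_qshift0 => [|l]; [exact: B'_ge0|exact: gg_bound].
Qed.

(** At the point [hat phi z], both [gg] and the values of - x at [z] are small solutions of the
    fixed-point equation, hence equal. This left inverse is what [cot_liftK] and [psi_chain] rest
    on. *)
Lemma psi_phi m z : U z -> psi m (hat phi z) = z.1 m 0.
Proof.
move=> Uz; have Wz := hat_phi_W Uz; have [_ [b4 _]] := B'_le.
have e : qshift (hat phi z) (fun l => - x l z) = z.
  apply: injective_projections => //=; apply/colP => i; rewrite !mxE /phi; exact: addrK.
have h := @near_identity_unique R C n x (s + r) (zt + r) r B' r_gt0 B'_ge0 B_small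
  (fun l z Uz => x_holo l (U'T Uz)) (fun l z Uz => xb l (U'T Uz)) (hat phi z)
  (fun l => gg l (hat phi z)) (fun l => - x l z) Wz.
rewrite /psi h ?mxE.
- exact: addrK.
- by move=> i; apply: le_trans (gg_bound i Wz) b4.
- by move=> i; rewrite nrmN; apply: le_trans (xb i (UT Uz)) b4.
- by move=> i; exact: gg_eq.
- by move=> i; rewrite e.
Qed.

Definition nf_map := cot_lift phi y psi h0.
Definition nf_inv := cot_unlift phi y psi h0.

Let U_open z := @baseU_open R C n s zt z.
Let W_open z := @baseU_open R C n (s + r) (zt + r) z.
Let U'_open z := @baseU_open R C n (s + r + r) (zt + r + r) z.
Let phi_holo' l : holoU U' (phi l). Proof. by move=> z /U'T; exact: phi_holo. Qed.
Let y_holo' l : holoU U' (y l). Proof. by move=> z /U'T; exact: y_holo. Qed.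
Let h0_holo' : holoU U' h0. Proof. by move=> z /U'T Tz; exact: (isD_h0 Tz).1. Qed.

Lemma nf_map_diff k : U (base k) -> differentiable nf_map k.
Proof. by move=> Uk; exact: (isD_cot_lift W_open UU' phi_holo' y_holo' h0_holo' psi_holo hat_phi_W Uk).1. Qed.

Lemma nf_map_symplectic k u v : U (base k) -> sympl ('d nf_map k u) ('d nf_map k v) = sympl u v.
Proof.
exact: (cot_lift_symplectic U_open W_open UU' phi_holo' y_holo' h0_holo' psi_holo hat_phi_W psi_phi
  (fun z u v Uz => isotropy u v (UW Uz))).
Qed.

Lemma nf_mapK k : U (base k) -> nf_inv (nf_map k) = k.
Proof. exact: (cot_liftK y h0 U_open UU' phi_holo' psi_holo hat_phi_W psi_phi). Qed.

Lemma nf_inv_diff k : W (base k) -> differentiable nf_inv k.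
Proof. exact: (cot_unlift_diff U'_open W_open phi_holo' y_holo' h0_holo' psi_holo hat_psi_U'). Qed.

Lemma J_per z m : T z -> J (z + (per m, 0)) = J z + (per m, 0, 0).
Proof.
move=> Tz; apply: injective_projections => /=; last by rewrite addr0.
apply: injective_projections => /=; apply/colP => i; rewrite !mxE.
  by rewrite x_per // addrAC.
by rewrite y_per // addr0.
Qed.

Lemma h0_per z m : T z -> h0 (z + (per m, 0)) = h0 z.
Proof.
move=> Tz; rewrite /h0 J_per // /ham0 /= addr0; congr (_ + _ * _).
by apply: f_per; exact: J_dom.
Qed.

Lemma dpsi_per m b l z : U z ->
  'd (psi m) (hat phi z + (per l, 0)) b = 'd (psi m) (hat phi z) b.
Proof.
move=> Uz; have Wz := hat_phi_W Uz; have Wz' := baseU_per l Wz.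
have [e e0 he] := W_open Wz.
have H : 'd (gg m) (hat phi z + (per l, 0)) b = 'd (gg m) (hat phi z) b.
  by apply: (diff_periodic e0 (gg_holo m Wz') (gg_holo m Wz)) => t /he Wt; exact: gg_per.
exact: (etrans (dpsiE m b Wz') (etrans (congr1 (fun c => b.1 m 0 + c) H) (esym (dpsiE m b Wz)))).
Qed.

Lemma phi_per l i z : T z -> phi i (z + (per l, 0)) = phi i z + per l i 0.
Proof.
move=> Tz; have e : (z + (per l, 0)).1 i 0 = z.1 i 0 + per l i 0 by rewrite !mxE.
by apply: etrans (congr2 +%R e (x_per i l Tz)) _; exact: addrAC.
Qed.

Lemma nf_map_per k l : U (base k) -> nf_map (k + (per l, 0, 0, 0)) = nf_map k + (per l, 0, 0, 0).
Proof.
move=> Uk; apply: cot_lift_per.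
- by move=> i; exact/phi_per/UT.
- by move=> i; exact: y_per (UT Uk).
- by apply: h0_per; exact: UT.
- by move=> m b; exact: dpsi_per.
Qed.

Lemma dgg_bound m z b : U z -> nrm ('d (gg m) (hat phi z) b) <= 32 * B' / r * nrm b.
Proof.
move=> Uz; have r0 := r_gt0.
have hb : holo_ball (gg m) (hat phi z) (r / 2) B'.
  have hW t : nrm (t - hat phi z) < r / 2 -> W t.
    move=> /ltW ht; apply: (baseU_grow Uz); apply: le_trans (nrm_tri t (hat phi z) z) _.
    by have := hat_phi_near Uz; lra.
  by split=> [|t /hW|t /hW]; [rewrite divr_gt0|exact: gg_holo|exact: gg_bound].
apply: le_trans (cauchy_dir b hb) _.
by rewrite le_eqVlt; apply/orP; left; apply/eqP; field; rewrite gt_eqF.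
Qed.

(** The three terms come from x or y, from P paired with the derivative of [gg], and from the
    energy. P is bounded because the lift multiplies it by that derivative. *)
Lemma nf_map_near k : U (base k) -> nrm k.1.1.2 <= 1 ->
  nrm (nf_map k - k) <= B' + n%:R * (32 * B' / r) + Mh * exp_edge (zt + r + r + r) a.
Proof.
move=> Uk hP; have b0 := B'_ge0; have Tk := UT Uk; have r0 := r_gt0.
have c0 : 0 <= 32 * B' / r by apply: divr_ge0; [exact: mulr_ge0|exact: ltW].
have n0 : 0 <= n%:R * (32 * B' / r) by rewrite mulr_ge0.
have m0 : 0 <= Mh * exp_edge (zt + r + r + r) a by rewrite mulr_ge0 ?Mh_ge0 ?expR_ge0.
have hg m b : nrm b <= 1 -> nrm (k.1.1.2 m 0 * 'd (gg m) (hat phi (base k)) b) <= 32 * B' / r.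
  move=> hb; rewrite nrmM -[leRHS]mul1r; apply: ler_pM; rewrite ?nrm_ge0 //.
    by apply: le_trans hP; exact: nrm_col_ge.
  by apply: le_trans (dgg_bound m b Uk) _; rewrite ler_piMr.
have hS b : nrm b <= 1 ->
    nrm (\sum_m k.1.1.2 m 0 * 'd (gg m) (hat phi (base k)) b) <= n%:R * (32 * B' / r).
  move=> hb; apply: le_trans (nrm_sumC _) _.
  have -> : n%:R * (32 * B' / r) = \sum_(m < n) (32 * B' / r).
    by rewrite sumr_const card_ord mulr_natl.
  by apply: ler_sum => m _; exact: hg.
have eS b : \sum_m k.1.1.2 m 0 * 'd (psi m) (hat phi (base k)) b =
    \sum_m k.1.1.2 m 0 * b.1 m 0 + \sum_m k.1.1.2 m 0 * 'd (gg m) (hat phi (base k)) b.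
  rewrite -big_split; apply: eq_bigr => m _.
  apply: etrans (congr1 (fun c => k.1.1.2 m 0 * c) (dpsiE m b (hat_phi_W Uk))) _.
  exact: mulrDr.
have hh : nrm (h0 (base k)) <= Mh * exp_edge (zt + r + r + r) a.
  apply: le_trans (h0_decays Tk) _; apply: ler_wpM2l; first exact: Mh_ge0.
  exact: exp_xre Tk.
rewrite nrm_pair_le; apply/andP; split; last first.
  have -> : (nf_map k).2 - k.2 = \sum_m k.1.1.2 m 0 * 'd (gg m) (hat phi (base k)) e_xi - h0 (base k).
    apply: etrans (congr1 (fun c => k.2 + c - h0 (base k) - k.2) (eS e_xi)) _.
    rewrite big1 ?add0r => [|m _]; last by rewrite mxE mulr0.
    by move: (\sum_m _) (h0 _) => A D; ring.
  apply: le_trans (nrmB _ _) _; have h1 := hS e_xi; rewrite nrm_pair_le nrm0 nrm1 ler01 lexx in h1.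
  by have := h1 isT; move: (nrm _) => A h2; lra.
rewrite nrm_pair_le; apply/andP; split; last first.
  by rewrite subrr nrm0; lra.
rewrite nrm_pair_le; apply/andP; split.
  apply: nrm_col_le => [|i]; first by lra.
  rewrite !mxE /phi [_ + x _ _]addrC addrK.
  by apply: le_trans (xb i Tk) _; lra.
apply: nrm_col_le => [|i]; first by lra.
rewrite !mxE.
have -> : y i (base k) + \sum_m k.1.1.2 m 0 * 'd (psi m) (hat phi (base k)) (e_theta i) - k.1.1.2 i 0
  = y i (base k) + \sum_m k.1.1.2 m 0 * 'd (gg m) (hat phi (base k)) (e_theta i).
  apply: etrans (congr1 (fun c => y i (base k) + c - k.1.1.2 i 0) (eS (e_theta i))) _.
  rewrite (bigD1 i) //= mxE !eqxx mulr1 big1 ?addr0 => [|m mi].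
    by move: (\sum_m _) => A; ring.
  by rewrite mxE (negbTE mi) mulr0.
apply: le_trans (nrmD _ _) _; have h2 := yb i Tk.
have h1 := hS (e_theta i); rewrite nrm_pair_le nrm_delta nrm0 ler01 in h1.
by have := h1 isT; move: (nrm (\sum_m _)) => A h3; lra.
Qed.

Context (rho : R) (f2 : E -> 'M[C]_n).
Local Notation DE := (baseU (C := C) (n := n) (s + r + r + r + 2 * r) (zt + r + r + r + 2 * r)).
Hypothesis r_rho : r < rho.
Hypothesis f_quad : forall z : E, DE z -> exists c0 (c1 : 'cV[C]_n), forall p, nrm p < rho ->
  f (z.1, p, z.2) = c0 + \sum_l c1 l 0 * p l 0 + bil (f2 z) p p.
Hypothesis f2_per : forall z l, DE z -> f2 (z + (per l, 0)) = f2 z.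

Definition dpsi_mx (z : E) : 'M[C]_n := \matrix_(m, l) 'd (psi m) (hat phi z) (e_theta l).

(** The part of the Hamiltonian quadratic in p, at the image angles, pulled back by P |-> dpsi^T
    P. *)
Definition Q2 (z : E) : 'M[C]_n :=
  dpsi_mx z *m (2^-1 *: Gamma + eps *: f2 (hat phi z)) *m (dpsi_mx z)^T.

Lemma WDE z : W z -> DE z.
Proof. by move: r_gt0 => r0; apply: baseUS; lra. Qed.

Lemma Q2_per z l : U z -> Q2 (z + (per l, 0)) = Q2 z.
Proof.
move=> Uz.
have hh : hat phi (z + (per l, 0)) = hat phi z + (per l, 0).
  apply: injective_projections => /=; last by rewrite addr0.
  apply/colP => i; rewrite mxE [RHS]mxE [X in _ = X + _]mxE; exact/phi_per/UT.
have hD : dpsi_mx (z + (per l, 0)) = dpsi_mx z.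
  by rewrite /dpsi_mx hh; apply/matrixP => i j; rewrite [LHS]mxE [RHS]mxE; exact: dpsi_per.
have hf : f2 (hat phi (z + (per l, 0))) = f2 (hat phi z).
  exact: (etrans (congr1 f2 hh) (f2_per l (WDE (hat_phi_W Uz)))).
exact: (congr2 (fun D F => D *m (2^-1 *: Gamma + eps *: F) *m D^T) hD hf).
Qed.

Lemma jmap_hat z : J z = ((hat phi z).1, \col_l y l z, (hat phi z).2).
Proof. by congr (_, _, _); apply/colP => i; rewrite !mxE. Qed.

(** The Hamiltonian is expanded in p at the torus, with increment [rh = dpsi^T P]. The bound on the
    image momentum is where the quadratic formula for [f] holds. *)
Theorem nf_map_ham k : U (base k) -> nrm (nf_map k).1.1.2 < rho ->
  ham0 f Gamma omega eps (nf_map k).1 + (nf_map k).2 =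
  \sum_l ofR (omega l 0) * k.1.1.2 l 0 + k.2 + bil (Q2 (base k)) k.1.1.2 k.1.1.2.
Proof.
move=> Uk hK; have Tk := UT Uk; set z := base k in Uk Tk.
pose rh := (dpsi_mx z)^T *m k.1.1.2.
have rhE l : rh l 0 = \sum_m k.1.1.2 m 0 * 'd (psi m) (hat phi z) (e_theta l).
  by rewrite mxE; apply: eq_bigr => m _; rewrite !mxE mulrC.
have pE : (nf_map k).1.1.2 = \col_l y l z + rh.
  by apply/colP => i; rewrite !mxE; congr (_ + _); rewrite -rhE !mxE.
have KE : (nf_map k).1 = ((hat phi z).1, \col_l y l z + rh, (hat phi z).2).
  by rewrite -pE.
rewrite pE in hK.
have [c0 [c1 hc]] := f_quad (WDE (hat_phi_W Uk)).
have yr : nrm (\col_l y l z) < rho.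
  have [_ [_ [br _]]] := B'_le; apply: le_lt_trans r_rho; apply: le_trans br.
  by apply: nrm_colf => [|l]; [exact: B'_ge0|exact: yb].
have dfJ : differentiable f ((hat phi z).1, \col_l y l z, (hat phi z).2).
  by rewrite -jmap_hat; exact/f_holo/J_dom.
have ft := taylor_quadratic hc yr hK dfJ.
have fl : 'd f (J z) (0, rh, 0) = \sum_l 'd f (J z) (vp l) * rh l 0.
  apply: etrans (linXE _ _) _ => /=; rewrite mulr0 addr0 big1 ?add0r // => l _.
  by rewrite mxE mulr0.
rewrite -jmap_hat in ft.
rewrite /Q2 bil_pullback bil_lin -/rh.
have := normal_form_algebra (om := fun l => ofR (omega l 0)) (rh := fun l => rh l 0)
  (fp := fun l => 'd f (J z) (vp l)) (G := fun l => \sum_m Gamma l m * y m z)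
  (dw := fun l => 'd (phi l) z w) (fun l => y l z) (P := fun l => k.1.1.2 l 0)
  (T := fun m => 'd (psi m) (hat phi z) e_xi) (D := fun m l => 'd (psi m) (hat phi z) (e_theta l))
  (e := eps) (bil Gamma (\col_l y l z) (\col_l y l z)) (byr := bil Gamma (\col_l y l z) rh)
  (bil Gamma rh rh) (f (J z)) (bil (f2 (hat phi z)) rh rh) k.2 rhE _ _ _.
move=> H; apply: etrans (H _ _ _).
- congr (_ + (_ - _)).
    rewrite KE /ham0 /=; congr (_ + _ * _ + _ * _).
    + by apply: eq_bigr => l _; rewrite !mxE.
    + by rewrite bilDl !bilDr (bil_sym rh _ Gamma_sym).
    + exact: etrans ft (congr1 (fun c => f (J z) + c + bil (f2 (hat phi z)) rh rh) fl).
  rewrite /h0 /ham0 /=; congr (_ + _ + _).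
  by apply: eq_bigr => l _; rewrite mxE.
- move=> m; have := psi_chain U_open UU' phi_holo' psi_holo hat_phi_W psi_phi m w Uk.
  by rewrite /= mulr1 mxE.
- by move=> l; exact: dphi_w.
- by apply: eq_bigr => l _; congr (_ * _); apply: eq_bigr => m _; rewrite mxE.
Qed.

End NormalForm.

Lemma finite_bound (R : realType) (I : finType) (F : I -> R) :
  exists2 g, 0 <= g & forall i, F i <= g.
Proof.
exists (\sum_i `|F i|); first by apply: sumr_ge0 => i _; exact: normr_ge0.
move=> i; apply: le_trans (ler_norm _) _; rewrite (bigD1 i) //= lerDl.
by apply: sumr_ge0 => j _; exact: normr_ge0.
Qed.

Lemma small_factor (R : realType) (c e : R) : 0 <= c -> 0 < e ->
  exists2 d0, 0 < d0 & forall d, 0 <= d <= d0 -> d * c <= e.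
Proof.
move=> c0 e0; exists (e / (c + 1)); first by rewrite divr_gt0 // ltr_wpDl.
move=> d /andP[d0 hd]; apply: le_trans (_ : e / (c + 1) * c <= _); first exact: ler_wpM2r.
by rewrite mulrAC ler_pdivrMr ?ltr_wpDl // ler_pM2l // lerDl.
Qed.

(** * Choice of the smallness constants *)

Section Assembly.
Context {R : realType} {C : cxType R} {n : nat}.
Local Notation E := ('cV[C]_n * C)%type.
Local Notation X := ('cV[C]_n * 'cV[C]_n * C)%type.
Local Notation Z := ('cV[C]_n * 'cV[C]_n * C * C)%type.

(** [W] is an open set around the image of [K]: the inverse has to be differentiable near the image,
    not only on it. The displacement bound is linear in d, that is in the square root of eps. *)
Definition normalizing (f : X -> C) (Gamma : 'M[C]_n) (omega : 'cV[R]_n)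
    (s zt rho d c : R) (K L : Z -> Z) (W : set Z) (Q : E -> 'M[C]_n) :=
  (forall k, W k -> (exists2 e : R, 0 < e & forall t, nrm (t - k) < e -> W t)
     /\ differentiable L k) /\
  forall k, baseU s zt (base k) ->
    [/\ differentiable K k /\ W (K k), L (K k) = k,
        (forall l, K (k + (per l, 0, 0, 0)) = K k + (per l, 0, 0, 0)) /\ (K k).1.2 = k.1.2,
        forall u v, sympl ('d K k u) ('d K k v) = sympl u v &
        [/\ nrm k.1.1.2 <= 1 -> nrm (K k - k) <= c * d,
            nrm (K k).1.1.2 < rho -> ham0 f Gamma omega (ofR (d ^+ 2)) (K k).1 + (K k).2 =
              \sum_l ofR (omega l 0) * k.1.1.2 l 0 + k.2 + bil (Q (base k)) k.1.1.2 k.1.1.2 &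
            forall l, Q (base k + (per l, 0)) = Q (base k)]].

Theorem near_identity_normal_form (f : X -> C) (Gamma : 'M[C]_n) (omega : 'cV[R]_n)
    (s zt r rho Mf a : R) (f2 : E -> 'M[C]_n) :
  0 < r <= 1 -> r < rho -> 0 < a -> 0 < zt -> 0 <= Mf ->
  (forall l m, Gamma l m = Gamma m l) ->
  (forall y, domX (s + 7 * r) (4 * r) (zt + 7 * r) y -> differentiable f y) ->
  (forall y, domX (s + 7 * r) (4 * r) (zt + 7 * r) y ->
     nrm (f y) <= Mf * expR (- a * cre y.2)) ->
  (forall y l, domX (s + 7 * r) (4 * r) (zt + 7 * r) y -> f (y + (per l, 0, 0)) = f y) ->
  (forall z : E, baseU (s + 7 * r) (zt + 7 * r) z -> exists c0 (c1 : 'cV[C]_n),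
     forall p, nrm p < rho ->
     f (z.1, p, z.2) = c0 + \sum_l c1 l 0 * p l 0 + bil (f2 z) p p) ->
  (forall z l, baseU (s + 7 * r) (zt + 7 * r) z -> f2 (z + (per l, 0)) = f2 z) ->
  exists d0 c : R, [/\ 0 < d0, 0 <= c & forall d : R, 0 <= d <= d0 ->
    exists (K L : Z -> Z) (W : set Z) (Q : E -> 'M[C]_n),
      normalizing f Gamma omega s zt rho d c K L W Q].
Proof.
move=> /andP[r0 r1] rrho a0 zt0 Mf0 Gsym fh fb fp fq f2p.
have [g g0 hg'] := finite_bound (fun i : 'I_n * 'I_n => nrm (Gamma i.1 i.2)).
have hg l m : nrm (Gamma l m) <= g := hg' (l, m).
have [om om0 hom] := finite_bound (fun l : 'I_n => `|omega l 0|).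
pose s' := s + r + r + r; pose zt' := zt + r + r + r.
have s4 : s' + 4 * r <= s + 7 * r by rewrite /s'; lra.
have z4 : zt' + 4 * r <= zt + 7 * r by rewrite /zt'; lra.
have s2 : s' + 2 * r <= s + 7 * r by rewrite /s'; lra.
have z2 : zt' + 2 * r <= zt + 7 * r by rewrite /zt'; lra.
have r24 : 2 * r <= 4 * r by lra.
have D4 (y : X) : domX (s' + 4 * r) (4 * r) (zt' + 4 * r) y -> domX (s + 7 * r) (4 * r) (zt + 7 * r) y.
  exact: domXS.
have D2 (y : X) : domX (s' + 2 * r) (2 * r) (zt' + 2 * r) y -> domX (s + 7 * r) (4 * r) (zt + 7 * r) y.
  exact: domXS.
have B2 z : baseU (C := C) (n := n) (s' + 2 * r) (zt' + 2 * r) z -> baseU (s + 7 * r) (zt + 7 * r) z.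
  exact: baseUS.
have zt'0 : 0 < zt' by rewrite /zt'; lra.
pose k0 := torus_rate (n := n) zt' r Mf a g; pose e0 := exp_edge zt' a; pose b1 := 4 * k0 / a.
have k00 : 0 <= k0 by exact: torus_rate_ge0.
have e00 : 0 <= e0 by exact: expR_ge0.
have b10 : 0 <= b1 by rewrite divr_ge0 ?mulr_ge0 // ltW.
(* Two smallness conditions on d: [d1] makes Picard's iteration contract, [d2] makes the
   displacement of the angles invertible. *)
have [d1 d10 hd1] := small_factor (mulr_ge0 (ler0n R 8) k00) a0.
have [d2 d20 hd2] := small_factor (mulr_ge0 (ler0n R 128) (mulr_ge0 b10 e00)) r0.
(* The bound of [nf_map_near] for [B = d * b1], with the common factor d taken out. *)
pose c := b1 * e0 + n%:R * (32 * (b1 * e0) / r) +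
  (n%:R * (om * b1) + n%:R * (n%:R * g * b1) + Mf) * e0.
exists (Num.min 1 (Num.min d1 d2)), c; split.
- by rewrite !lt_min d10 d20 ltr01.
- rewrite /c; apply: addr_ge0; first apply: addr_ge0.
  + exact: mulr_ge0.
  + apply: mulr_ge0; first exact: ler0n.
    by apply: divr_ge0; [apply: mulr_ge0 => //; exact: mulr_ge0|exact: ltW].
  + apply: mulr_ge0 => //; apply: addr_ge0 => //; apply: addr_ge0.
      by apply: mulr_ge0 => //; exact: mulr_ge0.
    by apply: mulr_ge0 => //; apply: mulr_ge0 => //; exact: mulr_ge0.
move=> d /andP[d0]; rewrite !le_min => /and3P[dl1 dl2 dl3].
have ka : 8 * (d * k0) <= a by rewrite mulrCA; apply: hd1; rewrite d0.
have kb : 128 * (d * b1 * e0) <= r.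
  by rewrite -mulrA mulrCA; apply: hd2; rewrite d0.
have hd : 0 <= d <= 1 by rewrite d0.
have Bdef : 4 * (d * k0) / a = d * b1 by rewrite /b1; ring.
have B0 : 0 <= d * b1 by exact: mulr_ge0.
have kr : 4 * (d * k0) / a * e0 <= r / 8.
  by rewrite Bdef; have := mulr_ge0 B0 e00; move: kb; move: (d * b1 * e0) => q; lra.
have [x [y [hx hy _]]] := torus_solution omega r0 a0 Mf0 g0 (fun y Dy => fh y (D4 y Dy))
  (fun y Dy => fb y (D4 y Dy)) (fun y l Dy => fp y l (D4 y Dy)) hg hd ka kr.
rewrite Bdef in hx hy.
have xh l : holoU (baseU s' zt') (x l) by have [] := hx l.
have xd l : decays xre (baseU s' zt') a (d * b1) (x l) by have [] := hx l.
have xe l z : baseU s' zt' z -> _ := (let: And4 _ _ h _ := hx l in h z).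
have xp l m z : baseU s' zt' z -> x l (z + (per m, 0)) = x l z.
  by have [_ _ _ h] := hx l; exact: h.
have yh l : holoU (baseU s' zt') (y l) by have [] := hy l.
have yd l : decays xre (baseU s' zt') a (d * b1) (y l) by have [] := hy l.
have ye l z : baseU s' zt' z -> _ := (let: And4 _ _ h _ := hy l in h z).
have yp l m z : baseU s' zt' z -> y l (z + (per m, 0)) = y l z.
  by have [_ _ _ h] := hy l; exact: h.
have B'0 : 0 <= d * b1 * e0 by exact: mulr_ge0.
have U'T (z : E) : baseU (s + r + r) (zt + r + r) z -> baseU s' zt' z.
  by apply: baseUS; rewrite ?/s' ?/zt' lerDl ltW.
have xbd l z : baseU s' zt' z -> nrm (x l z) <= d * b1 * e0.
  move=> Uz; apply: le_trans (xd l z Uz) _; apply: ler_wpM2l => //; exact: exp_xre Uz.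
have [gg [gh gb ge gp]] := near_identity_inverse (s := s + r) (zt := zt + r) r0 B'0 kb
  (fun l z Uz => xh l z (U'T z Uz)) (fun l z Uz => xbd l z (U'T z Uz))
  (fun l m z Uz => xp l m z (U'T z Uz)).
have fh' := fun y Dy => fh y (D2 y Dy).
have fb' := fun y Dy => fb y (D2 y Dy).
have fp' := fun y l Dy => fp y l (D2 y Dy).
have fq' := fun z Dz => fq z (B2 z Dz).
have f2p' := fun z l Dz => f2p z l (B2 z Dz).
exists (nf_map f Gamma omega d x y gg), (nf_inv f Gamma omega d x y gg),
  [set k | baseU (s + r) (zt + r) (base k)], (Q2 Gamma d x gg f2).
split.
  move=> k Wk; split.
    have [e ep he] := baseU_open Wk; exists e => // t ht; apply: he.
    by apply: le_lt_trans (base_near _ _) ht.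
  exact: (nf_inv_diff omega d r0 r1 a0 B0 Gsym fh' xh yh xd yd kb gh gb Wk).
move=> k Uk; split.
- split; first exact: (nf_map_diff omega d r0 r1 a0 B0 Gsym fh' xh yh xd yd kb gh Uk).
  exact: (hat_phi_W r0 r1 a0 B0 xd kb Uk).
- exact: (nf_mapK f Gamma omega d y r0 r1 a0 B0 xh xd kb gh gb ge Uk).
- by split=> // l; exact: (nf_map_per Gamma omega d r0 r1 a0 B0 fp' xd yd xp yp kb gh gp l Uk).
- move=> u v; exact: (nf_map_symplectic r0 r1 a0 Mf0 g0 om0 d0 dl1 B0 Gsym hg hom fh' fb' xh yh xd yd
    xe ye kb gh gb ge u v Uk).
split.
- move=> hP; apply: le_trans (nf_map_near r0 r1 a0 Mf0 g0 om0 d0 dl1 B0 hg hom fb' xd yd kb gh gb Uk hP) _.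
  rewrite le_eqVlt; apply/orP; left; apply/eqP; rewrite /c /Mh -/e0 -/zt'.
  by field; rewrite gt_eqF.
- exact: (nf_map_ham r0 r1 a0 B0 Gsym fh' xh xd yd xe kb gh gb ge rrho fq' Uk).
- move=> l; exact: (Q2_per Gamma d r0 r1 a0 B0 xd xp kb gh gp f2p' l Uk).
Qed.

End Assembly.

(** * Fourier bound and the theorem *)

Lemma real_col_norm_lt (R : realType) n (v : 'cV[R]_n) (s : R) : 0 < s ->
  (`|v| < s) <-> (forall l, `|v l 0| < s).
Proof.
move=> s0; split=> [h l|h].
  apply: le_lt_trans h; rewrite [leRHS]mx_normrE.
  exact: (le_bigmax _ (fun ij : 'I_n * 'I_1 => `|v ij.1 ij.2|) (l, 0)).
by rewrite [ltLHS]mx_normrE; apply/bigmax_ltP; split=> // -[i j] _ /=; rewrite (ord1 j).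
Qed.

Section Fourier.
Context {R : realType} {C : cxType R}.

(** Up to e, the sum is one of its finite partial sums, and these are dominated by partial sums of
    the nonnegative majorant. *)
Lemma sum_bound (I : choiceType) (u : I -> C) (b : I -> \bar R) (S : C) (M : R) :
  (forall e : R, 0 < e -> exists A : {fset I}, forall B : {fset I},
     (A `<=` B)%fset -> nrm ((\sum_(i <- B) u i) - S) < e) ->
  (forall i, ((nrm (u i))%:E <= b i)%E) -> (\esum_(i in [set: I]) b i <= M%:E)%E ->
  nrm S <= M.
Proof.
move=> hS hb hM; apply/ler_addgt0Pr => e e0; have [A hA] := hS e e0.
have {hA} := hA A (fsubset_refl A); rewrite nrmBC => hA.
rewrite -(subrK (\sum_(i <- A) u i) S); apply: le_trans (nrmD _ _) _.
rewrite addrC; apply: lerD; last exact: ltW.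
have h1 : nrm (\sum_(i <- A) u i) <= \sum_(i <- A) nrm (u i).
  elim/big_rec2: _ => [|i y1 y2 _ h]; first by rewrite nrm0.
  by apply: le_trans (nrmD _ _) _; rewrite lerD2l.
apply: le_trans h1 _; rewrite -lee_fin; apply: le_trans hM.
apply: esum_ge; exists [set` A].
  by split=> //; exact: finite_fset.
rewrite -fsbig_seq ?fset_uniq // -sumEFin; apply: lee_sum => i _; exact: hb.
Qed.

Lemma cim_intr (j : int) : cim (j%:~R : C) = 0.
Proof. by rewrite -(rmorph_int (ofR (C := C))) cim_ofR. Qed.
Lemma cre_intr (j : int) : cre (j%:~R : C) = j%:~R.
Proof. by rewrite -(rmorph_int (ofR (C := C))) cre_ofR. Qed.

Lemma cim_sum n (F : 'I_n -> C) : cim (\sum_l F l) = \sum_l cim (F l).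
Proof.
elim: n F => [|n IH] F; first by rewrite !big_ord0 cim0.
by rewrite !big_ord_recl cimD IH.
Qed.

Definition cxexp (z : C) : C := ofR (expR (cre z)) * cpl C (cos (cim z)) (sin (cim z)).

Lemma nrm_cxexp z : nrm (cxexp z) = expR (cre z).
Proof.
rewrite nrmM nrm_ofR ger0_norm ?expR_ge0 // nrm_sqrt cre_cpl cim_cpl cos2Dsin2.
by rewrite sqrtr1 mulr1.
Qed.

Lemma nrm_character n (k : 'cV[int]_n) (q : 'cV[C]_n) (c : R) :
  (forall l, `|cim (q l 0)| <= c) ->
  nrm (cxexp (cpl C 0 1 * \sum_l (map_mx (fun j : int => j%:~R : C) k) l 0 * q l 0)) <=
  expR ((\sum_(l < n) `|k l 0%R|)%N%:R * c).
Proof.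
move=> hq; rewrite nrm_cxexp ler_expR creM cre_cpl cim_cpl mul0r mul1r sub0r cim_sum.
rewrite -sumrN natr_sum mulr_suml; apply: ler_sum => l _.
rewrite mxE cimM cim_intr mul0r addr0 cre_intr natr_absz.
apply: le_trans (ler_norm _) _; rewrite normrN normrM intr_norm.
by apply: ler_wpM2l.
Qed.

(** On the strip |Im q_l| <= 2 (1 - nu) sigma the character of index k is at most the weight e^(2
    |k| (1 - nu) sigma), so the Fourier norm dominates the supremum there, though not on the full
    torus. *)
Lemma fourier_bound n (rho M nu sigma : R) (fh : 'cV[int]_n -> 'cV[C]_n -> C)
    (p q : 'cV[C]_n) (S : C) : nrm p < rho -> (forall l, `|cim (q l 0)| <= 2 * (1 - nu) * sigma) ->
  (forall e : R, 0 < e -> exists A : {fset 'cV[int]_n}, forall B : {fset 'cV[int]_n},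
     (A `<=` B)%fset -> nrm ((\sum_(k <- B) fh k p *
      cxexp (cpl C 0 1 * \sum_l (map_mx (fun j : int => j%:~R : C) k) l 0 * q l 0)) - S) < e) ->
  (\esum_(k in [set: 'cV[int]_n])
     (ereal_sup [set (nrm (fh k p))%:E | p in [set p : 'cV[C]_n | (nrm p < rho)%R]] *
      (expR (2 * (\sum_(l < n) `|k l 0%R|)%N%:R * (1 - nu) * sigma))%:E) <= M%:E)%E ->
  nrm S <= M.
Proof.
move=> hp hq hS hM; apply: sum_bound hS _ hM => k.
rewrite nrmM EFinM; apply: lee_pmul; rewrite ?lee_fin ?nrm_ge0 //.
  by apply: ereal_sup_ubound; exists p.
apply: le_trans (nrm_character k hq) _; rewrite le_eqVlt; apply/orP; left; apply/eqP.
by congr expR; ring.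
Qed.

End Fourier.

Section PartialDerivatives.
Context {R : realType} {C : cxType R} {n : nat}.

Definition pderiv (l : 'I_n) (g : 'cV[C]_n -> C) : 'cV[C]_n -> C :=
  fun p => 'D_(delta_mx l 0) g p.

(** A multi-index of order at most 1 means no derivative or a single one, so the iterated operator
    never has to be unfolded further. *)
Lemma foldr_pderiv (alpha : 'I_n -> nat) (g : 'cV[C]_n -> C) (s : seq 'I_n) :
  (\sum_(l <- s) alpha l <= 1)%N ->
  foldr (fun l h => iter (alpha l) (pderiv l) h) g s = g \/
  exists l, foldr (fun l h => iter (alpha l) (pderiv l) h) g s = pderiv l g.
Proof.
elim: s => [|l s IH] /=; first by left.
rewrite big_cons; case e : (alpha l) => [|[|a]] //=.
rewrite addSn add0n ltnS leqn0 => /eqP h; right; exists l; congr (pderiv _ _).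
have {h} : forall j, j \in s -> alpha j = 0%N.
  by move=> j js; apply/eqP; move/eqP: h; rewrite sum_nat_seq_eq0 => /allP /(_ j js).
elim: s {IH} => //= j s IH h; rewrite h ?mem_head //= IH // => i hi.
by apply: h; rewrite in_cons hi orbT.
Qed.

Lemma mpartial_bil (c : 'M[C]_n) (alpha : 'I_n -> nat) : (\sum_(l < n) alpha l <= 1)%N ->
  foldr (fun l h => iter (alpha l) (pderiv l) h) (fun p => bil c p p) (enum 'I_n) 0 = 0.
Proof.
have b0 p : bil c 0 p = 0.
  by rewrite /bil big1 // => l _; rewrite big1 ?mul0r // => m _; rewrite mxE mulr0.
have b0' p : bil c p 0 = 0 by rewrite /bil big1 // => l _; rewrite mxE mulr0.
have -> : (\sum_(l < n) alpha l = \sum_(l <- enum 'I_n) alpha l)%N by rewrite big_enum.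
move=> /(foldr_pderiv (fun p => bil c p p))[->|[l ->]].
  exact: b0.
have [h1 h2] := isD_bil c 0.
rewrite /pderiv; apply: etrans (deriveE _ h1) _; apply: etrans (h2 _) _.
by rewrite b0 b0' addr0.
Qed.

End PartialDerivatives.

Lemma near_ball (R : realType) (C : cxType R) (V : normedModType C) (x : V) (P : V -> Prop) (e : R) :
  0 < e -> (forall y, nrm (y - x) < e -> P y) -> \forall y \near x, P y.
Proof. by move=> e0 h; apply/nbhs_nrmP; exists e. Qed.

Lemma half_eighth (R : realFieldType) (t : R) : 0 < t -> 0 < t / 2 < t /\ 0 < t / 8 < t.
Proof. by move=> t0; split; apply/andP; split; lra. Qed.

(** * The normal form for slowly decaying perturbations *)

Section SlowDecay.
Context {R : realType} {C : cxType R} {n : nat}.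
Local Notation E := ('cV[C]_n * C)%type.
Local Notation X := ('cV[C]_n * 'cV[C]_n * C)%type.
Local Notation Z := ('cV[C]_n * 'cV[C]_n * C * C)%type.

Definition half_dom (rho sigma : R) (k : Z) :=
  [/\ nrm k.1.1.2 < rho, forall l, `|cim (k.1.1.1 l 0)| < 2 * sigma, `|cim k.2| < rho &
      0 <= cre k.1.2 /\ cim k.1.2 = 0].

Definition full_dom (rho sigma zeta : R) (k : Z) :=
  [/\ nrm k.1.1.2 < rho, forall l, `|cim (k.1.1.1 l 0)| < 2 * sigma, `|cim k.2| < rho &
      - zeta < cre k.1.2 /\ `|cim k.1.2| < zeta].

Lemma half_dom0 (rho sigma : R) (q : 'cV[C]_n) (xi : C) : 0 < rho ->
  (forall l, `|cim (q l 0)| < 2 * sigma) -> 0 <= cre xi /\ cim xi = 0 ->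
  half_dom rho sigma (q, 0, xi, 0).
Proof. by move=> h1 h2 h3; split=> //=; rewrite ?nrm0 ?cim0 ?normr0. Qed.

Lemma restrict_diff (F : Z -> C) (k : X) (c : C) :
  differentiable F (k, c) -> differentiable (fun k => F (k, c)) k.
Proof. by move=> dF; exact: (isD_comp (isD_pair (isD_id k) (isD_cst c k)) (isD_diff dF)).1. Qed.

(** The smaller domain leaves room rho / 2 in p and eta and more than sigma in Im q; as xi does not
    move, its component needs no room. *)
Lemma full_dom_near (rho sigma zeta gap : R) (k k' : Z) : gap <= rho / 2 -> gap <= sigma ->
  0 < rho -> 0 < sigma -> 0 < zeta -> half_dom (rho / 2) (sigma / 8) k ->
  nrm (k' - k) <= gap / 2 -> k'.1.2 = k.1.2 -> full_dom rho sigma zeta k'.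
Proof.
move=> gr gs r0 s0 z0 [k1 k2 k3 [k4 k5]] hn hxi.
have n1 : nrm (k'.1 - k.1) <= gap / 2 by apply: le_trans (nrm_fst (k' - k)) hn.
have n2 : nrm (k'.2 - k.2) <= gap / 2 by apply: le_trans (nrm_snd (k' - k)) hn.
have n3 : nrm (k'.1.1 - k.1.1) <= gap / 2 by apply: le_trans (nrm_fst (k'.1 - k.1)) n1.
have n4 : nrm (k'.1.1.2 - k.1.1.2) <= gap / 2 by apply: le_trans (nrm_snd (k'.1.1 - k.1.1)) n3.
have n5 : nrm (k'.1.1.1 - k.1.1.1) <= gap / 2 by apply: le_trans (nrm_fst (k'.1.1 - k.1.1)) n3.
split.
- rewrite -(subrK k.1.1.2 k'.1.1.2); apply: le_lt_trans (nrmD _ _) _.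
  by move: n4 k1; move: (nrm _) (nrm _) => u v; clear -gr r0; lra.
- move=> l; have n6 := le_trans (nrm_col_ge (k'.1.1.1 - k.1.1.1) l) n5.
  rewrite !mxE in n6; have k2' := k2 l.
  have h : `|cim (k.1.1.1 l 0)| < 2 * sigma by apply: lt_trans k2' _; clear -s0; lra.
  apply: cim_near h _; apply: le_lt_trans n6 _.
  by move: k2'; move: `|_| => u; clear -gs s0; lra.
- have h : `|cim k.2| < rho by apply: lt_trans k3 _; clear -r0; lra.
  apply: cim_near h _; apply: le_lt_trans n2 _.
  by move: k3; move: `|_| => u; clear -gr r0; lra.
by rewrite hxi k5 normr0; split=> //; apply: lt_le_trans k4; rewrite oppr_lt0.
Qed.

(** Stated over the abstract [C], with the Fourier norm replaced by the pointwise bound that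
    [fourier_bound] extracts from it. *)
Theorem slow_decay_normal_form (Gamma : 'M[C]_n) (omega : 'cV[R]_n)
    (rho sigma zeta nu Mf a : R) (f : 'cV[C]_n -> 'cV[C]_n -> C -> C)
    (f0 : 'cV[C]_n -> C -> C) (f1 : 'cV[C]_n -> C -> 'cV[C]_n) (f2 : 'cV[C]_n -> C -> 'M[C]_n) :
  (forall l m, Gamma l m = Gamma m l) -> 0 < rho < 1 -> 0 < sigma < 1 -> 0 < zeta < 1 ->
  0 < nu <= 2^-1 -> 0 < Mf -> 0 < a ->
  (forall k : Z, full_dom rho sigma zeta k ->
     differentiable (fun k : Z => f k.1.1.1 k.1.1.2 k.1.2) k) ->
  (forall (q p : 'cV[C]_n) (xi : C), full_dom rho sigma zeta (q, p, xi, 0) ->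
     f q p xi = f0 q xi + \sum_l f1 q xi l 0 * p l 0 + bil (f2 q xi) p p) ->
  (forall (q : 'cV[C]_n) (xi : C) l, full_dom rho sigma zeta (q, 0, xi, 0) ->
     [/\ f0 (q + per l) xi = f0 q xi, f1 (q + per l) xi = f1 q xi &
         f2 (q + per l) xi = f2 q xi]) ->
  (forall (q p : 'cV[C]_n) (xi : C), (forall l : 'I_n, `|cim (q l 0)| <= 2 * (1 - nu) * sigma) ->
     full_dom rho sigma zeta (q, p, xi, 0) -> nrm (f q p xi) <= Mf * expR (- a * nrm xi)) ->
  exists eps_a rho_s sigma_s : R, [/\ 0 < eps_a, 0 < rho_s < rho & 0 < sigma_s < sigma] /\
  exists (K L : R -> Z -> Z) (Q : R -> 'cV[C]_n -> C -> 'M[C]_n),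
  (forall e : R, 0 < e -> exists2 delta : R, 0 < delta & forall eps, 0 < eps <= eps_a ->
     eps < delta -> forall k, half_dom rho_s sigma_s k -> nrm (K eps k - k) < e) /\
  forall eps, 0 < eps <= eps_a ->
    (forall k, half_dom rho_s sigma_s k ->
       (exists2 e : R, 0 < e & forall t, nrm (t - k) < e -> differentiable (K eps) t) /\
       (exists2 e : R, 0 < e & forall t, nrm (t - K eps k) < e -> differentiable (L eps) t)) /\
    (forall k, half_dom rho_s sigma_s k ->
       [/\ full_dom rho sigma zeta (K eps k), L eps (K eps k) = k,
           (forall l, K eps (k + (per l, 0, 0, 0)) = K eps k + (per l, 0, 0, 0)),
           (K eps k).1.2 = k.1.2 &
           (forall u v, sympl ('d (K eps) k u) ('d (K eps) k v) = sympl u v) /\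
           (forall l, Q eps (k.1.1.1 + per l) k.1.2 = Q eps k.1.1.1 k.1.2) /\
           ham0 (fun v => f v.1.1 v.1.2 v.2) Gamma omega (ofR eps) (K eps k).1 + (K eps k).2 =
             \sum_l ofR (omega l 0) * k.1.1.2 l 0 + k.2
             + bil (Q eps k.1.1.1 k.1.2) k.1.1.2 k.1.1.2]).
Proof.
move=> Gsym /andP[rho0 rho1] /andP[sg0 sg1] /andP[zt0 zt1] /andP[nu0 nu1] Mf0 a0 fh fq fp fb.
pose m := Num.min sigma (Num.min rho zeta).
have m0 : 0 < m by rewrite !lt_min sg0 rho0.
have ms : m <= sigma by rewrite ge_min lexx.
have mr : m <= rho by rewrite !ge_min lexx !orbT.
have mz : m <= zeta by rewrite !ge_min lexx !orbT.
(* Seven steps of [r] are spent beyond [s] and beyond the width in xi, and four in p. With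
   [s = sigma / 4] and xi-width [r], which suffices around the half-line, 64 leaves ample room. *)
pose r := m / 64.
have r0 : 0 < r by rewrite divr_gt0.
have rm : 64 * r = m by rewrite /r mulrC divfK.
clearbody r m.
(* As nu <= 1 / 2, the strip where the Fourier norm controls [f] contains |Im q_l| <= sigma; all the
   work is done inside that smaller strip. *)
have snu : sigma <= 2 * (1 - nu) * sigma.
  rewrite -[leLHS]mul1r ler_wpM2r ?(ltW sg0) //; clear -nu1; lra.
pose s := 2 * (sigma / 8).
have s7 : s + 7 * r <= sigma by rewrite /s; clear -rm ms m0; lra.
have sg2 : sigma <= 2 * sigma by clear -sg0; lra.
have z8 : r + 7 * r <= zeta by clear -rm mz m0; lra.
have r4 : 4 * r <= rho by clear -rm mr m0; lra.
have rrho : r < rho by clear -r0 r4; lra.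
have r1 : 0 < r <= 1 by rewrite r0 /= (le_trans (ltW rrho) (ltW rho1)).
have dom1 (y : X) : domX (s + 7 * r) (4 * r) (r + 7 * r) y ->
    full_dom rho sigma zeta (y, 0) /\ forall l, `|cim (y.1.1 l 0)| <= 2 * (1 - nu) * sigma.
  move=> [h1 h2 h3 h4].
  have h l : `|cim (y.1.1 l 0)| < sigma by exact: lt_le_trans (h1 l) s7.
  split; last by move=> l; apply: le_trans (ltW (h l)) snu.
  split=> /= [|l||]; [exact: lt_le_trans h2 r4|exact: lt_le_trans (h l) sg2| |].
    by rewrite cim0 normr0.
  by split; [apply: le_lt_trans h3; rewrite lerN2|exact: lt_le_trans h4 z8].
have dom2 (z : E) p : baseU (s + 7 * r) (r + 7 * r) z -> nrm p < rho ->
    full_dom rho sigma zeta (z.1, p, z.2, 0).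
  move=> [h1 h2 h3] hp; split=> /= [//|l||].
  - exact: lt_le_trans (lt_le_trans (h1 l) s7) sg2.
  - by rewrite cim0 normr0.
  by split; [apply: le_lt_trans h2; rewrite lerN2|exact: lt_le_trans h3 z8].
pose F (v : X) := f v.1.1 v.1.2 v.2.
have p0 : nrm (0 : 'cV[C]_n) < rho by rewrite nrm0.
have [|||||d0 [c [d00 c0 HK]]] := @near_identity_normal_form R C n F Gamma omega s r r rho Mf a
  (fun z => f2 z.1 z.2) r1 rrho a0 r0 (ltW Mf0) Gsym.
- move=> y /dom1[Dy _]; exact: (restrict_diff (fh _ Dy)).
- move=> y /dom1[Dy hy]; case: y Dy hy => [[q p] xi] Dy hy.
  (* Here |xi| in the exponent is weakened to Re xi, the weight adapted to the rays. *)
  apply: le_trans (fb q p xi hy Dy) _; rewrite ler_wpM2l ?(ltW Mf0) // ler_expR.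
  by rewrite !mulNr lerN2 ler_pM2l //; apply: le_trans (ler_norm _) (cre_le xi).
- move=> y l Dy; have [Dy0 _] := dom1 _ Dy; have [Dy1 _] := dom1 _ (domX_per l Dy).
  case: y Dy Dy0 Dy1 => [[q p] xi] Dy Dy0 Dy1.
  have Dq : full_dom rho sigma zeta (q, 0, xi, 0) by have [h1 h2 h3 h4] := Dy0; split.
  have [e0 e1 e2] := fp q xi l Dq.
  rewrite /F /= !addr0 fq; last by have [h1 h2 h3 h4] := Dy1; move: h1 h4; rewrite /= !addr0.
  by rewrite (fq q) // e0 e1 e2.
- move=> z Dz; exists (f0 z.1 z.2), (f1 z.1 z.2) => p hp.
  exact: (fq _ _ _ (dom2 z p Dz hp)).
- move=> z l Dz; have [_ _ e2] := fp z.1 z.2 l (dom2 z 0 Dz p0).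
  by rewrite /= addr0.
pose gap := Num.min (rho / 2) sigma.
have gap0 : 0 < gap by rewrite lt_min sg0 divr_gt0.
have gr : gap <= rho / 2 by rewrite ge_min lexx.
have gs : gap <= sigma by rewrite ge_min lexx orbT.
have [d1 d10 hd1] := small_factor c0 (divr_gt0 gap0 (ltr0Sn _ 1)).
pose dm := Num.min d0 d1.
have dm0 : 0 < dm by rewrite lt_min d00.
pose good d (t : (Z -> Z) * (Z -> Z) * set Z * (E -> 'M[C]_n)) := 0 <= d <= d0 ->
  normalizing F Gamma omega s r rho d c t.1.1.1 t.1.1.2 t.1.2 t.2.
have ex d : exists t, good d t.
  (* Arbitrary values outside the admissible range of d make the data total functions of d, as the
     choice of one family in eps requires. *)
  have [hd|hd] := boolP (0 <= d <= d0); last by exists (id, id, setT, fun=> 0) => h; rewrite h in hd.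
  by have [K [L [W [Q h]]]] := HK d hd; exists (K, L, W, Q).
have [T hT] := choice ex.
(* eps = d^2 turns the bound [dm] on d into its square; sigma / 8 matches [s], since the angles are
   restricted to |Im q_l| < 2 (sigma / 8). *)
exists (dm ^+ 2), (rho / 2), (sigma / 8); split.
  by split; [rewrite exprn_gt0|have [] := half_eighth rho0|have [] := half_eighth sg0].
exists (fun e => (T (Num.sqrt e)).1.1.1), (fun e => (T (Num.sqrt e)).1.1.2),
  (fun e q xi => (T (Num.sqrt e)).2 (q, xi)).
have hs eps : 0 < eps <= dm ^+ 2 -> 0 <= Num.sqrt eps <= d0 /\ Num.sqrt eps * c <= gap / 2.
  move=> /andP[e0 e1]; have h : Num.sqrt eps <= dm.
    by rewrite -(ger0_norm (ltW dm0)) -sqrtr_sqr ler_wsqrtr.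
  split; first by rewrite sqrtr_ge0 /=; apply: le_trans h _; rewrite ge_min lexx.
  by apply: hd1; rewrite sqrtr_ge0 /=; apply: le_trans h _; rewrite ge_min lexx orbT.
have hbase (k : Z) : half_dom (rho / 2) (sigma / 8) k -> baseU s r (base k).
  by move=> [h1 h2 h3 [h4 h5]]; split=> //=; [apply: lt_le_trans h4; rewrite oppr_lt0|rewrite h5 normr0].
have hp1 (k : Z) : half_dom (rho / 2) (sigma / 8) k -> nrm k.1.1.2 <= 1.
  move=> [h1 _ _ _]; apply: le_trans (ltW h1) _; apply: le_trans _ (ltW rho1).
  by have [/andP[_ /ltW]] := half_eighth rho0.
split.
  move=> e e0; have [d2 d20 hd2] := small_factor c0 (divr_gt0 e0 (ltr0Sn _ 1)).
  exists (d2 ^+ 2); first by rewrite exprn_gt0.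
  move=> eps he he2 k Dk; have [hs1 _] := hs eps he.
  have [_ /(_ k (hbase k Dk))[_ _ _ _ [h _ _]]] := hT _ hs1.
  apply: le_lt_trans (h (hp1 k Dk)) _; rewrite mulrC; apply: le_lt_trans (hd2 _ _) _; last by have [/andP[]] := half_eighth e0.
  rewrite sqrtr_ge0 /= -(ger0_norm (ltW d20)) -sqrtr_sqr ler_wsqrtr //; exact: ltW.
move=> eps he; have [hs1 hs2] := hs eps he; have [hW hK] := hT _ hs1.
have epsE : Num.sqrt eps ^+ 2 = eps by rewrite sqr_sqrtr //; case/andP: he => /ltW.
split=> k Dk; have Uk := hbase k Dk.
  split.
    have [e e0 he'] := baseU_open Uk; exists e => // t ht.
    by have [[]] := hK t (he' _ (le_lt_trans (base_near _ _) ht)).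
  have [[_ Wk] _ _ _ _] := hK k Uk; have [[e e0 he'] _] := hW _ Wk.
  by exists e => // t /he' Wt; have [] := hW t Wt.
have [[_ _] hLK [hper hxi] hsym [hnear hnf hQ]] := hK k Uk.
have hn : nrm ((T (Num.sqrt eps)).1.1.1 k - k) <= gap / 2.
  by apply: le_trans (hnear (hp1 k Dk)) _; rewrite mulrC.
have KD := full_dom_near gr gs rho0 sg0 zt0 Dk hn hxi.
split=> //.
have hp : nrm ((T (Num.sqrt eps)).1.1.1 k).1.1.2 < rho by have [] := KD.
split=> //; split=> [l|].
  by have := hQ l; rewrite /base /=; have -> : ((k.1.1.1, k.1.2) + (per l, 0) : E) =
    (k.1.1.1 + per l, k.1.2) by congr (_, _); rewrite addr0.
by have := hnf hp; rewrite epsE.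
Qed.

End SlowDecay.

(** * The complex numbers R[i] as an instance *)

Section Model.
Context (R : realType).
Local Notation Ri := (R[i]%C).

Let reR (z : Ri) : R := complex.Re z.
Let imR (z : Ri) : R := complex.Im z.

Lemma Ri_ext (z w : Ri) : reR z = reR w -> imR z = imR w -> z = w.
Proof. by case: z w => [a b] [c d] /= -> ->. Qed.
Lemma Ri_reD (z w : Ri) : reR (z + w) = reR z + reR w.
Proof. by case: z w => [a b] [c d]. Qed.
Lemma Ri_imD (z w : Ri) : imR (z + w) = imR z + imR w.
Proof. by case: z w => [a b] [c d]. Qed.
Lemma Ri_reM (z w : Ri) : reR (z * w) = reR z * reR w - imR z * imR w.
Proof. by case: z w => [a b] [c d]. Qed.
Lemma Ri_imM (z w : Ri) : imR (z * w) = reR z * imR w + imR z * reR w.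
Proof. by case: z w => [a b] [c d]. Qed.
Lemma Ri_ge0 (z : Ri) : (0 <= z) = (imR z == 0) && (0 <= reR z).
Proof. exact: lecE. Qed.
Lemma Ri_norm (z : Ri) : `|z| = Complex (Num.sqrt (reR z ^+ 2 + imR z ^+ 2)) 0.
Proof. exact: normc_def. Qed.

Definition CxModel : cxType R :=
  @CxType R (Cx R) (@ReC R) (@ImC R) (@Complex R) (fun _ _ => erefl) (fun _ _ => erefl)
    Ri_ext Ri_reD Ri_imD Ri_reM Ri_imM erefl erefl Ri_ge0 Ri_norm.

End Model.

Section Transfer.
Context {R : realType} {n : nat}.
Local Notation C := (CxModel R).

Lemma TorusP (s : R) (q : 'cV[Cx R]_n) : 0 < s ->
  Torus s q <-> (forall l, `|ImC (q l 0)| < s).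
Proof.
move=> s0; apply: (iff_trans (real_col_norm_lt _ s0)); split=> h l; have := h l; by rewrite mxE.
Qed.

Lemma Dom_half (rho sigma : R) (k : phase R n) : 0 < sigma ->
  Dom rho sigma (@Halfline R) k <-> half_dom (C := C) rho sigma k.
Proof.
move=> s0; have s2 : 0 < 2 * sigma by rewrite mulr_gt0.
by split=> -[h1 h2 h3 h4]; split=> //; apply/(TorusP _ s2).
Qed.

Lemma Dom_full (rho sigma zeta : R) (k : phase R n) : 0 < sigma ->
  Dom rho sigma (Rzeta zeta) k <-> full_dom (C := C) rho sigma zeta k.
Proof.
move=> s0; have s2 : 0 < 2 * sigma by rewrite mulr_gt0.
by split=> -[h1 h2 h3 h4]; split=> //; apply/(TorusP _ s2).
Qed.

Lemma dot_bil (c : 'M[Cx R]_n) (p : 'cV[Cx R]_n) : dot (c *m p) p = bil (C := C) c p p.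
Proof. by apply: eq_bigr => l _; rewrite mxE. Qed.

End Transfer.

Theorem theorem2p2 (R : realType) (n : nat) (hn : (1 <= n)%N)
    (Gamma : 'M[R]_n) (hGamma : Gamma^T = Gamma)
    (Phat omega : 'cV[R]_n) (homega : omega = Gamma *m Phat)
    (rho sigma zeta : R)
    (hrho : 0 < rho < 1) (hsigma : 0 < sigma < 1) (hzeta : 0 < zeta < 1)
    (nu : R) (hnu : 0 < nu <= 2^-1)
    (f : 'cV[Cx R]_n -> 'cV[Cx R]_n -> Cx R -> Cx R)
    (hfquad : quadratic_in_p rho sigma zeta f)
    (m : R) (hm : 0 < m < 1)
    (hGammam : forall v : 'cV[Cx R]_n,
        cnorm (mxofR Gamma *m v) <= m^-1 * cnorm v)
    (hfan : analytic_on (Dom rho sigma (Rzeta zeta))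
        (fun z : phase R n => f (qof z) (pof z) (xiof z)))
    (fhat : 'cV[int]_n -> 'cV[Cx R]_n -> Cx R -> Cx R)
    (hfhat : fourier_expansion rho sigma zeta f fhat)
    (Mf a : R) (hMf : 0 < Mf) (ha : 0 < a < 1)
    (hdecay : forall xi, Rzeta zeta xi ->
        (fourier_norm nu rho sigma fhat xi
           <= (Mf * expR (- a * cnorm xi))%:E)%E)
    (gamma tau : R) (hgamma : 0 < gamma) (htau : n%:R - 1 < tau)
    (hdioph : Diophantine gamma tau omega) :
  exists eps_a rho_s sigma_s : R,
    [/\ 0 < eps_a, 0 < rho_s < rho & 0 < sigma_s < sigma] /\
    let D : set (phase R n) := Dom rho sigma (Rzeta zeta) in
    let Ds : set (phase R n) := Dom rho_s sigma_s (@Halfline R) in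
    Ds `<=` D /\
    exists K : R -> phase R n -> phase R n,
      tends_to_id eps_a Ds K /\
      forall eps : R, 0 < eps <= eps_a ->
        [/\ (forall z, Ds z -> D (K eps z)),
            analytic_change_of_variables Ds (K eps),
            canonical_on Ds (K eps),
            (forall z, Ds z -> xiof (K eps z) = xiof z) &
            exists (Q : 'cV[Cx R]_n -> 'cV[Cx R]_n -> Cx R -> Cx R)
                   (c : Cx R -> Cx R),
              Kolmogorov_remainder sigma_s Q /\
              forall z, Ds z ->
                Ham Gamma omega eps f (K eps z)
                = Kolmogorov_nf omega Q z + c (xiof z)].

Proof.
have [sg0 sg1] := andP hsigma; have [rho0 rho1] := andP hrho; have [zt0 zt1] := andP hzeta.
have [a0 a1] := andP ha.
have [f0 [f1 [f2 [p0 p1 p2 fE]]]] := hfquad.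
have Gsym l k : mxofR Gamma l k = mxofR Gamma k l by rewrite !mxE -{1}hGamma mxE.
have full (k : phase R n) : full_dom (C := CxModel R) rho sigma zeta k ->
    Dom rho sigma (Rzeta zeta) k by move=> h; exact/Dom_full.
have H := @slow_decay_normal_form R (CxModel R) n (mxofR Gamma) omega rho sigma zeta nu Mf a f
  f0 f1 f2 Gsym hrho hsigma hzeta hnu hMf a0.
have [||||eps_a [rho_s [sigma_s [[e0 hr hs] [K [L [Q [hid hK]]]]]]]] := H.
- by move=> k hk; exact: nbhs_singleton (hfan k (full k hk)).
- move=> q p xi hk; have [h1 h2 h3 h4] := full (q, p, xi, 0) hk.
  by apply: etrans (fE q p xi h2 h1 h4) _; rewrite dot_bil.
- move=> q xi l hk; have [h1 h2 h3 h4] := full (q, 0, xi, 0) hk.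
  by split; [exact: p0|exact: p1|exact: p2].
- move=> q p xi hq hk; have [h1 h2 h3 h4] := full (q, p, xi, 0) hk.
  exact: (@fourier_bound R (CxModel R) n rho _ nu sigma (fun k p => fhat k p xi) p q (f q p xi)
    h1 hq (hfhat q p xi h2 h1 h4) (hdecay xi h4)).
have [hr0 hr1] := andP hr; have [hs0 hs1] := andP hs.
exists eps_a, rho_s, sigma_s; split=> //; split.
  move=> z [h1 h2 h3 [h4 h5]]; split.
  - exact: lt_trans h1 hr1.
  - by apply: lt_trans h2 _; rewrite ltr_pM2l.
  - exact: lt_trans h3 hr1.
  - by split; [apply: lt_le_trans h4; rewrite oppr_lt0|rewrite h5 normr0].
exists K; split.
  move=> e ep; have [delta delta0 hdelta] := hid e ep; exists delta => // eps he hl z Dz.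
  exact: (hdelta eps he hl z ((Dom_half _ _ hs0).1 Dz)).
move=> eps he; have [hA hB] := hK eps he.
have half z : Dom rho_s sigma_s (@Halfline R) z -> half_dom (C := CxModel R) rho_s sigma_s z.
  by move=> Dz; exact: (Dom_half _ _ hs0).1 Dz.
split.
- by move=> z /half Dz; have [h _ _ _ _] := hB z Dz; exact: full.
- split.
  + move=> z /half Dz; have [[e ep h] _] := hA z Dz.
    exact: (@near_ball R (CxModel R) (phase R n) z _ e ep h).
  + exists (L eps); split=> [_ [z /half Dz <-]|z /half Dz].
      have [_ [e ep h]] := hA z Dz.
      exact: (@near_ball R (CxModel R) (phase R n) _ _ e ep h).
    by have [_ h _ _ _] := hB z Dz; exact: h.
  + by move=> z /half Dz l; have [_ _ h _ _] := hB z Dz; exact: h.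
- by move=> z /half Dz u v; have [_ _ _ _ [h _]] := hB z Dz; exact: h.
- by move=> z /half Dz; have [_ _ _ h _] := hB z Dz; exact: h.
(* The additive function of xi is zero because the lift already subtracts the energy of the torus in
   the eta component. *)
exists (fun q p xi => dot (Q eps q xi *m p) p), (fun=> 0); split.
  split.
    move=> q xi hq hxi alpha halpha.
    have -> : (fun p : 'cV[Cx R]_n => dot (Q eps q xi *m p) p) =
        (fun p => bil (C := CxModel R) (Q eps q xi) p p) by apply/funext => p; exact: dot_bil.
    exact: (@mpartial_bil R (CxModel R) n (Q eps q xi) alpha halpha).
  exists (Q eps); split=> // q xi hq hxi l.
  have s2 : 0 < 2 * sigma_s by rewrite mulr_gt0.
  have Dz := @half_dom0 R (CxModel R) n rho_s sigma_s q xi hr0 ((TorusP q s2).1 hq) hxi.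
  by have [_ _ _ _ [_ [h _]]] := hB _ Dz; exact: h.
move=> z /half Dz; have [_ _ _ _ [_ [_ h]]] := hB z Dz.
have dotE p : dot (mxofR omega) p = \sum_l cofR (omega l 0) * p l 0.
  by apply: eq_bigr => l _; rewrite mxE.
rewrite addr0 /Ham /Kolmogorov_nf !dot_bil !dotE; apply: etrans (addrAC _ _ _) _; exact: h.
Qed.
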